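(* Consider the planar piecewise linear systems with real parameters $(\gamma_L,\gamma_R,b,x_L,x_R)$ $$\begin{cases}\dot x=2\gamma_L x-y-b,\\ \dot y=(1+\gamma_L^2)(x-x_L),\end{cases}\ \text{if } x\le 0,\qquad \begin{cases}\dot x=2\gamma_R x-y+b,\\ \dot y=(1+\gamma_R^2)(x-x_R),\end{cases}\ \text{if } x>0.$$ Let $\eta,\xi$ be non-zero real numbers. The local cyclicity of the periodic orbit at infinity, of center type, defined by $\gamma_L=\gamma_R=0$, $x_L=\eta$, $x_R=\xi$ and $b=0$, when perturbed in this class of systems, is at least $1$ when $\eta=-\xi$, at least $2$ when $\eta\neq\pm\xi$, and at least $3$ when $\eta=\xi$.
   Context: On $\Sigma=\{x=0\}$ the systems are understood with the Filippov convention; orbits far from the origin cross $\Sigma$ and turn around the origin, so there is a ''periodic orbit at infinity''. It is of center type if all orbits sufficiently far from the origin are periodic. The local cyclicity of the periodic orbit at infinity of a given center system, within the class, is the maximum number of limit cycles of big amplitude that can bifurcate from it, i.e. the maximum $k$ such that in every neighborhood of the given parameter values and for every $M>0$ there are parameters $(\gamma_L,\gamma_R,b,x_L,x_R)$ in that neighborhood whose system has $k$ limit cycles (isolated crossing periodic orbits) intersecting the positive $y$-axis at ordinates larger than $M$. *)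

(* Defs.v *)
From Stdlib Require Import Reals.
From Coquelicot Require Import Coquelicot.
Open Scope R_scope.

(* (gamma_L, gamma_R, b, x_L, x_R) *)
Definition params : Type := (R * R * R * R * R)%type.

Definition left_field (p : params) (z : R * R) : R * R :=
  let '(gL, gR, b, xL, xR) := p in
  let '(x, y) := z in
  (2 * gL * x - y - b, (1 + gL ^ 2) * (x - xL)).

Definition right_field (p : params) (z : R * R) : R * R :=
  let '(gL, gR, b, xL, xR) := p in
  let '(x, y) := z in
  (2 * gR * x - y + b, (1 + gR ^ 2) * (x - xR)).

(* Filippov's crossing region of the line {x = 0}: both fields are transversal
   to the line and point to the same side of it. *)
Definition crossing_point (p : params) (z : R * R) : Prop :=
  fst z = 0 /\ 0 < fst (left_field p z) * fst (right_field p z).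

Definition follows (F : R * R -> R * R) (x y : R -> R) (t : R) : Prop :=
  is_derive x t (fst (F (x t, y t))) /\ is_derive y t (snd (F (x t, y t))).

(* A complete Filippov orbit that meets {x = 0} only at crossing points, where
   solutions of the two systems are concatenated.  Nothing is asked of the
   derivative at a crossing time, where (x, y) has in general a corner.  The
   [locally'] clause (crossing times are isolated) forbids curves that stay on
   {x = 0}, which the remaining clauses would not constrain. *)
Definition crossing_solution (p : params) (x y : R -> R) : Prop :=
  forall t : R,
    continuous x t /\ continuous y t /\
    (x t < 0 -> follows (left_field p) x y t) /\
    (0 < x t -> follows (right_field p) x y t) /\
    (x t = 0 ->
       crossing_point p (x t, y t) /\ locally' t (fun s => x s <> 0)).

(* Orbits are sets of points, so a change of the time origin or of the chosen
   period does not give a new orbit. *)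
Definition crossing_periodic_orbit (p : params) (G : R * R -> Prop) : Prop :=
  exists (x y : R -> R) (T : R),
    0 < T /\ crossing_solution p x y /\
    (forall t, x (t + T) = x t /\ y (t + T) = y t) /\
    (exists t, x t = 0) /\
    (forall z, G z <-> exists t, z = (x t, y t)).

(* Isolation among crossing periodic orbits is isolation among all periodic
   orbits: near a crossing periodic orbit every orbit crosses {x = 0}. *)
Definition limit_cycle (p : params) (G : R * R -> Prop) : Prop :=
  crossing_periodic_orbit p G /\
  exists U : R * R -> Prop,
    open U /\ (forall z, G z -> U z) /\
    forall G' : R * R -> Prop,
      crossing_periodic_orbit p G' -> (forall z, G' z -> U z) ->
      forall z, G' z <-> G z.

Definition center_at_infinity (p : params) : Prop :=
  exists r : R, forall z : R * R,
    r < sqrt (fst z ^ 2 + snd z ^ 2) ->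
    exists G : R * R -> Prop, crossing_periodic_orbit p G /\ G z.

Definition has_big_limit_cycles (p : params) (k : nat) (M : R) : Prop :=
  exists G : nat -> R * R -> Prop,
    (forall i, (i < k)%nat ->
       limit_cycle p (G i) /\ exists y, M < y /\ G i (0, y)) /\
    (forall i j, (i < k)%nat -> (j < k)%nat -> i <> j ->
       ~ (forall z, G i z <-> G j z)).

Definition bifurcate_from_infinity (p : params) (k : nat) : Prop :=
  forall V : params -> Prop, locally p V ->
  forall M : R, 0 < M ->
  exists q : params, V q /\ has_big_limit_cycles q k M.

(* The supremum in Rbar is the maximum whenever the set of such k is bounded,
   and p_infty otherwise. *)
Definition local_cyclicity_at_infinity (p : params) : Rbar :=
  Lub_Rbar (fun r => exists k : nat, r = INR k /\ bifurcate_from_infinity p k).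

(* Main.v *)
Require Import Defs.
From Stdlib Require Import Reals ZArith Lra Lia Psatz Ranalysis5.
From Coquelicot Require Import Coquelicot.
Open Scope R_scope.

(* Write the ordinates of an orbit on [{x = 0}] as [u > 0] and [- v < 0], and set
   [r = (u + v) / 2], [K = (v - u) / 2 - b].  The left half-return map becomes a graph
   [K = KL r], the right one [- K - 2 b = KR r], so crossing periodic orbits correspond
   to the zeros of [KL r + KR r + 2 b].  Here [KL r = r * kL (x_L / r)] and
   [KR r = r * kR (- x_R / r)], where [k z] (for given gamma) is explicit in terms of the
   flight time and satisfies
   [k z = gamma (PI/2 - 2 z + PI/2 z^2 - 2/3 z^3) + O(gamma z^4 + gamma^3)], with the
   corresponding estimate for increments.  With [/ r = s X], [gamma_L = s^2] and
   [gamma_R = - s^2 + O(s^3)], the leading term of [(KL r + KR r + 2 b) / r] as [s -> 0]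
   is, up to a power of [s], a polynomial in [X] of degree at most 3.  It can be given the
   simple roots 1; 1, 2 if [x_L^2 <> x_R^2]; or 1, 2, 3 if [x_L = x_R], where [x_R] has to
   be perturbed as well.  Simple roots persist and give limit cycles crossing the positive
   y-axis at ordinates of order [/ s]. *)

(** * Arcs of the linear systems *)

(** The delicate part of a limit cycle is its isolation: a nearby periodic orbit is an arbitrary
    curve that may cross the line many times in one period. Arcs, first-return times and the order
    of crossings must therefore be controlled for every such curve. The half-return maps have no
    closed form in the ordinate, so they are reached by inverting the flight-time parametrization;
    what is kept of them are bounds on increments, which are enough for simple roots to persist.

    The scale [gamma = s^2] balances the two errors: for [z] of order [s], both [gamma z^4] and
    [gamma^3] are of order [s^6], one order beyond the cubic term [gamma z^3]. In the displacement,
    [gamma_L + gamma_R] tunes the constant coefficient and [b] the linear one. To leading order the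
    quadratic one is proportional to [x_L^2 - x_R^2] and the cubic one to [x_L^3 + x_R^3]. Both
    vanish when [eta = - xi]. When [eta = xi] the cubic one survives, and moving [x_R] by a multiple
    of [s] supplies a quadratic term of the same order. *)

Lemma is_derive_continuous (f : R -> R) (t l : R) :
  is_derive f t l -> continuous f t.
Proof.
  intros H. apply (@ex_derive_continuous R_AbsRing R_NormedModule). now exists l.
Qed.

(** The solution of [x' = 2 g x - y], [y' = (1 + g ^ 2) (x - c)] issued from [(0, Y)], that is, of
    the left system in the ordinate [y + b]. The eigenvalues are [g + i] and [g - i], hence the
    factor [exp (g t)] and the unit frequency. *)
Definition arc_x (g c Y t : R) : R :=
  c + exp (g * t) * ((g * c - Y) * sin t - c * cos t).

Definition arc_y (g c Y t : R) : R :=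
  2 * g * arc_x g c Y t
  - exp (g * t) * ((c * (1 + g ^ 2) - g * Y) * sin t - Y * cos t).

Lemma arc_x_0 g c Y : arc_x g c Y 0 = 0.
Proof. unfold arc_x. rewrite Rmult_0_r, exp_0, sin_0, cos_0. ring. Qed.

Lemma arc_y_0 g c Y : arc_y g c Y 0 = Y.
Proof.
  unfold arc_y. rewrite arc_x_0, !Rmult_0_r, exp_0, sin_0, cos_0. ring.
Qed.

Lemma is_derive_arc_x g c Y t :
  is_derive (arc_x g c Y) t (2 * g * arc_x g c Y t - arc_y g c Y t).
Proof. unfold arc_y, arc_x. auto_derive; [easy | ring]. Qed.

Lemma is_derive_arc_y g c Y t :
  is_derive (arc_y g c Y) t ((1 + g ^ 2) * (arc_x g c Y t - c)).
Proof. unfold arc_y, arc_x. auto_derive; [easy | ring]. Qed.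

Lemma continuous_arc_x g c Y t : continuous (arc_x g c Y) t.
Proof. eapply is_derive_continuous, is_derive_arc_x. Qed.

Lemma continuous_arc_y g c Y t : continuous (arc_y g c Y) t.
Proof. eapply is_derive_continuous, is_derive_arc_y. Qed.

(** Only the end points are prescribed; that the arc stays in the left half plane in between is
    derived in [half_arc_neg], thanks to the bound [2 PI]. [Y] and [- V] are values of the shifted
    ordinate [y + b]. *)
Definition half_arc (g c Y V tau : R) : Prop :=
  0 < tau < 2 * PI /\ 0 < Y /\ 0 < V /\
  arc_x g c Y tau = 0 /\ arc_y g c Y tau = - V.

(** Differentiability is asked only inside the interval because orbits have corners at the crossing
    times, which will be its end points. *)
Lemma MVT_open (f df : R -> R) (a b : R) :
  a < b ->
  (forall t, a < t < b -> is_derive f t (df t)) ->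
  (forall t, a <= t <= b -> continuous f t) ->
  exists t, a < t < b /\ f b - f a = df t * (b - a).
Proof.
  intros Hab Hd Hc.
  assert (pr1 : forall t, a < t < b -> derivable_pt f t).
  { intros t Ht. exists (df t). apply is_derive_Reals. now apply Hd. }
  assert (pr2 : forall t, a < t < b -> derivable_pt id t).
  { intros t _. apply derivable_pt_id. }
  destruct (MVT f id a b pr1 pr2 Hab) as [t [Ht E]].
  - intros t Ht. apply continuity_pt_filterlim. now apply Hc.
  - intros t Ht. apply derivable_continuous_pt, derivable_pt_id.
  - exists t. split; [exact Ht|].
    assert (E1 : derive_pt f t (pr1 t Ht) = df t).
    { apply derive_pt_eq_0. apply is_derive_Reals. now apply Hd. }
    assert (E2 : derive_pt id t (pr2 t Ht) = 1).
    { apply derive_pt_eq_0. apply derivable_pt_lim_id. }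
    rewrite E1, E2 in E. unfold id in E. lra.
Qed.

(* [exp (- g t) x'(t)] is a sinusoid, negative at [0] and positive at [tau]; as
   [tau < 2 PI] it has a single zero in between. *)
Lemma half_arc_neg g c Y V tau t :
  half_arc g c Y V tau -> 0 < t < tau -> arc_x g c Y t < 0.
Proof.
  intros [Htau [HY [HV [Hx Hy]]]] Ht.
  set (q := fun t => (c * (1 + g ^ 2) - g * Y) * sin t - Y * cos t).
  assert (Hd : forall t, is_derive (arc_x g c Y) t (exp (g * t) * q t)).
  { intros t0. generalize (is_derive_arc_x g c Y t0). unfold arc_y, q.
    intros H. evar_last. apply H. ring. }
  destruct (MVT_open (arc_x g c Y) (fun t => exp (g * t) * q t) 0 tau)
    as [m [Hm E]]; [lra | easy | intros; apply continuous_arc_x |].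
  rewrite Hx, arc_x_0 in E.
  assert (Hq : q m = 0).
  { apply Rmult_eq_reg_l with (exp (g * m) * tau).
    - rewrite Rmult_0_r. rewrite <- (Rminus_diag 0), E. ring.
    - apply Rgt_not_eq. apply Rmult_lt_0_compat; [apply exp_pos | lra]. }
  set (rho := (c * (1 + g ^ 2) - g * Y) * cos m + Y * sin m).
  assert (Hs : forall t, q t = rho * sin (t - m)).
  { intros t0. transitivity (q m * cos (t0 - m) + rho * sin (t0 - m)).
    - unfold q, rho. replace t0 with (m + (t0 - m)) at 1 2 by ring.
      rewrite sin_plus, cos_plus. ring.
    - rewrite Hq. ring. }
  assert (H0 : q 0 < 0) by (unfold q; rewrite sin_0, cos_0; lra).
  assert (H1 : 0 < q tau).
  { unfold arc_y in Hy. rewrite Hx in Hy. fold (q tau) in Hy.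
    apply Rmult_lt_reg_l with (exp (g * tau)); [apply exp_pos|]. lra. }
  rewrite Hs in H0, H1.
  replace (0 - m) with (- m) in H0 by ring. rewrite sin_neg in H0.
  (* As [m] and [tau - m] add up to less than [2 PI], they are not both at least [PI]; the signs of
     [q] at the two ends then force both to be below [PI]. *)
  assert (Hcase : 0 < rho /\ m < PI /\ tau - m < PI).
  { destruct (Rlt_or_le m PI) as [A | A].
    - assert (0 < sin m) by (apply sin_gt_0; lra).
      assert (0 < rho) by nra.
      repeat split; try easy.
      destruct (Rlt_or_le (tau - m) PI) as [B | B]; [easy|].
      assert (sin (tau - m) <= 0) by (apply sin_le_0; lra). nra.
    - assert (sin m <= 0) by (apply sin_le_0; lra).
      assert (rho < 0) by nra.
      assert (0 < sin (tau - m)) by (apply sin_gt_0; lra). nra. }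
  destruct Hcase as [Hrho [Hm1 Hm2]].
  destruct (Rle_or_lt t m) as [B | B].
  - destruct (MVT_open (arc_x g c Y) (fun t => exp (g * t) * q t) 0 t)
      as [n [Hn En]]; [lra | easy | intros; apply continuous_arc_x |].
    rewrite arc_x_0 in En.
    assert (q n < 0).
    { rewrite Hs. replace (n - m) with (- (m - n)) by ring. rewrite sin_neg.
      assert (0 < sin (m - n)) by (apply sin_gt_0; lra). nra. }
    assert (0 < exp (g * n)) by apply exp_pos.
    assert (exp (g * n) * q n < 0) by nra. nra.
  - destruct (MVT_open (arc_x g c Y) (fun t => exp (g * t) * q t) t tau)
      as [n [Hn En]]; [lra | easy | intros; apply continuous_arc_x |].
    rewrite Hx in En.
    assert (0 < q n).
    { rewrite Hs. assert (0 < sin (n - m)) by (apply sin_gt_0; lra). nra. }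
    assert (0 < exp (g * n)) by apply exp_pos.
    assert (0 < exp (g * n) * q n) by nra. nra.
Qed.

(* For the difference [(X, Z)] of two solutions, [(Z - g X)^2 + X^2] has
   logarithmic derivative [2 g]. *)
Lemma arc_unique g b c x y t0 t1 :
  (forall t, t0 <= t <= t1 -> continuous x t /\ continuous y t) ->
  (forall t, t0 < t < t1 ->
     is_derive x t (2 * g * x t - y t - b) /\
     is_derive y t ((1 + g ^ 2) * (x t - c))) ->
  x t0 = 0 ->
  forall t, t0 <= t <= t1 ->
    x t = arc_x g c (y t0 + b) (t - t0) /\
    y t = arc_y g c (y t0 + b) (t - t0) - b.
Proof.
  intros Hc Hd Hx0 t Ht.
  set (Y := y t0 + b).
  set (X := fun s => x s - arc_x g c Y (s - t0)).
  set (Z := fun s => y s + b - arc_y g c Y (s - t0)).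
  set (N := fun s => exp (- 2 * g * s) * ((Z s - g * X s) ^ 2 + X s ^ 2)).
  assert (N0 : N t0 = 0).
  { unfold N, Z, X. rewrite Rminus_diag, arc_x_0, arc_y_0, Hx0. unfold Y. ring. }
  assert (dX : forall s, t0 < s < t1 -> is_derive X s (2 * g * X s - Z s)).
  { intros s Hs. destruct (Hd s Hs) as [H1 H2]. unfold X at 1.
    evar_last.
    - apply @is_derive_minus; [exact H1|].
      apply (is_derive_comp (arc_x g c Y) (fun s => s - t0)).
      apply is_derive_arc_x. auto_derive; [easy | reflexivity].
    - unfold X, Z, minus, plus, opp, scal; simpl; unfold mult; simpl. ring. }
  assert (dZ : forall s, t0 < s < t1 -> is_derive Z s ((1 + g ^ 2) * X s)).
  { intros s Hs. destruct (Hd s Hs) as [H1 H2]. unfold Z at 1.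
    evar_last.
    - apply @is_derive_minus.
      + apply @is_derive_plus; [exact H2 | apply @is_derive_const].
      + apply (is_derive_comp (arc_y g c Y) (fun s => s - t0)).
        apply is_derive_arc_y. auto_derive; [easy | reflexivity].
    - unfold X, Z, minus, plus, opp, scal, zero; simpl; unfold mult; simpl. ring. }
  assert (dN : forall s, t0 < s < t1 -> is_derive N s 0).
  { intros s Hs. generalize (dX s Hs) (dZ s Hs). intros H1 H2. unfold N.
    auto_derive.
    - repeat split; eexists; eassumption.
    - replace (Derive (fun x0 => X x0) s) with (2 * g * X s - Z s)
        by (symmetry; now apply is_derive_unique).
      replace (Derive (fun x0 => Z x0) s) with ((1 + g ^ 2) * X s)
        by (symmetry; now apply is_derive_unique).
      ring. }
  assert (cX : forall s, t0 <= s <= t1 -> continuous X s).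
  { intros s Hs. unfold X. apply @continuous_minus; [now apply Hc|].
    apply (continuous_comp (fun s => s - t0) (arc_x g c Y)).
    - apply @continuous_minus; [apply continuous_id | apply continuous_const].
    - apply continuous_arc_x. }
  assert (cZ : forall s, t0 <= s <= t1 -> continuous Z s).
  { intros s Hs. unfold Z. apply @continuous_minus.
    - apply @continuous_plus; [now apply Hc | apply continuous_const].
    - apply (continuous_comp (fun s => s - t0) (arc_y g c Y)).
      + apply @continuous_minus; [apply continuous_id | apply continuous_const].
      + apply continuous_arc_y. }
  assert (cN : forall s, t0 <= s <= t1 -> continuous N s).
  { intros s Hs. unfold N. apply @continuous_mult.
    - apply (@ex_derive_continuous R_AbsRing R_NormedModule). auto_derive. easy.
    - apply @continuous_plus.
      + apply (continuous_comp (fun s => Z s - g * X s) (fun v => v ^ 2)).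
        * apply @continuous_minus; [now apply cZ|].
          apply @continuous_mult; [apply continuous_const | now apply cX].
        * apply (@ex_derive_continuous R_AbsRing R_NormedModule). auto_derive. easy.
      + apply (continuous_comp X (fun v => v ^ 2)); [now apply cX|].
        apply (@ex_derive_continuous R_AbsRing R_NormedModule). auto_derive. easy. }
  assert (Nt : N t = 0).
  { destruct (Req_dec t t0) as [-> | Hne]; [exact N0|].
    destruct (MVT_open N (fun _ => 0) t0 t) as [m [_ E]]; [lra | | |].
    - intros s Hs. apply dN. lra.
    - intros s Hs. apply cN. lra.
    - lra. }
  assert (Hsum : (Z t - g * X t) ^ 2 + X t ^ 2 = 0).
  { unfold N in Nt. apply Rmult_integral in Nt. destruct Nt as [H | H]; [|easy].
    generalize (exp_pos (- 2 * g * t)). lra. }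
  assert (HX : X t = 0).
  { apply Rsqr_0_uniq. unfold Rsqr.
    assert (0 <= (Z t - g * X t) ^ 2) by apply pow2_ge_0.
    assert (0 <= X t ^ 2) by apply pow2_ge_0. lra. }
  assert (HZ : Z t = 0).
  { apply Rsqr_0_uniq. unfold Rsqr. rewrite HX in Hsum. lra. }
  unfold X in HX. unfold Z in HZ. lra.
Qed.

(** Solution and arc agree up to [t1]. If [t1] came before [t0 + tau], the arc would vanish inside
    its half plane; if it came after, the solution would. *)
Lemma arc_unique_half g b c V tau x y t0 t1 :
  (forall t, t0 <= t <= t1 -> continuous x t /\ continuous y t) ->
  (forall t, t0 < t < t1 -> x t < 0 /\
     is_derive x t (2 * g * x t - y t - b) /\
     is_derive y t ((1 + g ^ 2) * (x t - c))) ->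
  t0 < t1 -> x t0 = 0 -> x t1 = 0 ->
  half_arc g c (y t0 + b) V tau ->
  t1 = t0 + tau /\ y t1 + b = - V /\
  forall t, t0 <= t <= t1 ->
    x t = arc_x g c (y t0 + b) (t - t0) /\
    y t = arc_y g c (y t0 + b) (t - t0) - b.
Proof.
  intros Hc Hd Ht Hx0 Hx1 Ha.
  assert (Hu := arc_unique g b c x y t0 t1 Hc
                  (fun t Ht => proj2 (Hd t Ht)) Hx0).
  assert (E : t1 = t0 + tau).
  { destruct (Rtotal_order t1 (t0 + tau)) as [H | [H | H]]; [|easy|].
    - destruct (Hu t1) as [H1 _]; [lra|].
      assert (arc_x g c (y t0 + b) (t1 - t0) < 0)
        by (apply half_arc_neg with V tau; [easy | lra]). lra.
    - assert (0 < tau) by apply Ha.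
      destruct (Hu (t0 + tau)) as [H1 _]; [lra|].
      destruct (Hd (t0 + tau)) as [H2 _]; [lra|].
      replace (t0 + tau - t0) with tau in H1 by ring.
      destruct Ha as [_ [_ [_ [H3 _]]]]. lra. }
  repeat split.
  - exact E.
  - destruct (Hu t1) as [_ H1]; [lra|].
    replace (t1 - t0) with tau in H1 by lra.
    destruct Ha as [_ [_ [_ [_ H3]]]]. lra.
  - now apply Hu.
  - now apply Hu.
Qed.

(** * Crossings *)

Lemma continuous_locally_lt (f : R -> R) (t l : R) :
  continuous f t -> f t < l -> locally t (fun s => f s < l).
Proof. intros Hc H. apply (Hc (fun v => v < l)). now apply open_lt. Qed.

Lemma continuous_locally_gt (f : R -> R) (t l : R) :
  continuous f t -> l < f t -> locally t (fun s => l < f s).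
Proof. intros Hc H. apply (Hc (fun v => l < v)). now apply open_gt. Qed.

Lemma locally_exists_interval (P : R -> Prop) t :
  locally t P -> exists e, 0 < e /\ forall s, t - e < s < t + e -> P s.
Proof.
  intros [e He]. exists e. split; [apply cond_pos|].
  intros s Hs. apply He. unfold ball; simpl; unfold AbsRing_ball; simpl.
  unfold abs, minus, plus, opp; simpl. apply Rabs_def1; lra.
Qed.


Lemma IVT_zero (f : R -> R) (a b : R) :
  (forall t, continuous f t) -> a <= b -> f a * f b <= 0 ->
  exists t, a <= t <= b /\ f t = 0.
Proof.
  intros Hc Hab H.
  destruct (IVT_gen f a b 0) as [t [Ht E]].
  - intros s. apply continuity_pt_filterlim, Hc.
  - unfold Rmin, Rmax. destruct (Rle_dec (f a) (f b)); nra.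
  - rewrite Rmin_left, Rmax_right in Ht by lra. now exists t.
Qed.

Lemma nonzero_constant_sign (f : R -> R) (a b : R) :
  (forall t, continuous f t) -> (forall t, a < t < b -> f t <> 0) ->
  (forall t, a < t < b -> f t < 0) \/ (forall t, a < t < b -> 0 < f t).
Proof.
  intros Hc Hn.
  destruct (Rlt_or_le a b) as [Hab | Hab]; [| left; intros; lra].
  set (m := (a + b) / 2).
  assert (Hs : forall t, a < t < b -> 0 < f m * f t).
  { intros t Ht. destruct (Rlt_or_le 0 (f m * f t)) as [H | H]; [easy | exfalso].
    destruct (Rle_or_lt m t) as [B | B].
    - destruct (IVT_zero f m t) as [z [Hz E]]; try easy.
      apply (Hn z); [unfold m in *; lra | easy].
    - destruct (IVT_zero f t m) as [z [Hz E]]; try easy; [lra | lra |].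
      apply (Hn z); [unfold m in *; lra | easy]. }
  assert (Hm : f m <> 0) by (apply Hn; unfold m; lra).
  destruct (Rlt_or_le (f m) 0) as [H | H]; [left | right]; intros t Ht;
    specialize (Hs t Ht); nra.
Qed.

(** The zero is the supremum of the times up to which [f] has not vanished since [t]. *)
Lemma next_zero (f : R -> R) (t t1 : R) :
  (forall s, continuous f s) -> f t <> 0 -> t < t1 -> f t1 = 0 ->
  exists z, t < z /\ f z = 0 /\ forall s, t <= s < z -> f s <> 0.
Proof.
  intros Hc Ht Htt Ht1.
  set (E := fun s => t <= s /\ forall u, t <= u <= s -> f u <> 0).
  assert (HE : E t).
  { split; [lra|]. intros u Hu. replace u with t by lra. easy. }
  destruct (completeness E) as [z [Hub Hlub]].
  - exists t1. intros s [Hs Hn]. destruct (Rle_or_lt s t1) as [H | H]; [easy|].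
    exfalso. apply (Hn t1); [lra | easy].
  - now exists t.
  - assert (Htz : t <= z) by now apply Hub.
    assert (Hbelow : forall s, t <= s < z -> f s <> 0).
    { intros s Hs H. assert (z <= s); [|lra]. apply Hlub.
      intros u [Hu Hn]. destruct (Rle_or_lt u s) as [B | B]; [easy|].
      exfalso. apply (Hn s); [lra | easy]. }
    assert (Hz : f z = 0).
    { destruct (Req_dec (f z) 0) as [H | H]; [easy | exfalso].
      assert (Hl : locally z (fun s => f s <> 0)).
      { destruct (Rlt_or_le (f z) 0) as [B | B].
        - generalize (continuous_locally_lt f z 0 (Hc z) B).
          apply filter_imp. intros; lra.
        - generalize (continuous_locally_gt f z 0 (Hc z)).
          intros G. generalize (G ltac:(lra)). apply filter_imp. intros; lra. }
      destruct (locally_exists_interval _ _ Hl) as [e [He Hn]].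
      assert (z + e / 2 <= z); [|lra]. apply Hub. split; [lra|].
      intros u Hu. destruct (Rlt_or_le u z) as [B | B].
      - apply Hbelow. lra.
      - apply Hn. lra. }
    exists z. repeat split; try easy.
    destruct Htz as [H | H]; [easy|]. now subst z.
Qed.

Lemma previous_zero (f : R -> R) (t t1 : R) :
  (forall s, continuous f s) -> f t <> 0 -> t1 < t -> f t1 = 0 ->
  exists z, z < t /\ f z = 0 /\ forall s, z < s <= t -> f s <> 0.
Proof.
  intros Hc Ht Htt Ht1.
  destruct (next_zero (fun s => f (- s)) (- t) (- t1)) as [z [Hz [E Hn]]].
  - intros s. apply (continuous_comp Ropp f).
    + apply @continuous_opp, continuous_id.
    + apply Hc.
  - now rewrite Ropp_involutive.
  - lra.
  - now rewrite Ropp_involutive.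
  - exists (- z). repeat split; [lra | easy |].
    intros s Hs. replace s with (- - s) by ring. apply Hn. lra.
Qed.

Lemma periodic_nat (f : R -> R) T :
  (forall t, f (t + T) = f t) -> forall n t, f (t + INR n * T) = f t.
Proof.
  intros H n. induction n as [|n IH]; intros t.
  - simpl. f_equal. ring.
  - rewrite S_INR. replace (t + (INR n + 1) * T) with (t + INR n * T + T) by ring.
    now rewrite H.
Qed.

Lemma exists_multiple_above T M : 0 < T -> exists n, M < INR n * T.
Proof.
  intros HT. destruct (nfloor_ex (Rabs (M / T))) as [n [_ Hn]].
  { apply Rabs_pos. }
  exists (S n). rewrite S_INR.
  assert (M / T < INR n + 1) by (generalize (Rle_abs (M / T)); lra).
  apply Rmult_lt_reg_r with (/ T); [now apply Rinv_0_lt_compat|].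
  field_simplify; [unfold Rdiv in *; lra | lra | lra].
Qed.

(** Periodicity repeats the zero [t0] on both sides of [t], so nearest zeros exist in both
    directions. *)
Lemma zero_free_gap (f : R -> R) (T t0 t : R) :
  (forall s, continuous f s) -> 0 < T -> (forall s, f (s + T) = f s) ->
  f t0 = 0 -> f t <> 0 ->
  exists a b, a < t < b /\ f a = 0 /\ f b = 0 /\
    forall s, a < s < b -> f s <> 0.
Proof.
  intros Hc HT Hp H0 Ht.
  destruct (exists_multiple_above T (t - t0) HT) as [n Hn].
  destruct (exists_multiple_above T (t0 - t) HT) as [m Hm].
  destruct (next_zero f t (t0 + INR n * T)) as [b [Hb [Eb Hnb]]]; try easy.
  - lra.
  - now rewrite periodic_nat.
  - destruct (previous_zero f t (t0 - INR m * T)) as [a [Ha [Ea Hna]]]; try easy.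
    + lra.
    + rewrite <- (periodic_nat f T Hp m).
      now replace (t0 - INR m * T + INR m * T) with t0 by ring.
    + exists a, b. repeat split; try easy.
      intros s Hs. destruct (Rle_or_lt s t); [apply Hna | apply Hnb]; lra.
Qed.

Lemma crossing_solution_continuous p x y :
  crossing_solution p x y -> forall t, continuous x t /\ continuous y t.
Proof. intros H t. split; apply (H t). Qed.

Lemma crossing_solution_left gL gR b c d x y t :
  crossing_solution (gL, gR, b, c, d) x y -> x t < 0 ->
  is_derive x t (2 * gL * x t - y t - b) /\
  is_derive y t ((1 + gL ^ 2) * (x t - c)).
Proof. intros H Ht. now apply (H t). Qed.

(* The symmetry [(x, y) -> (- x, - y)] exchanges the two systems. *)
Lemma crossing_solution_opp gL gR b c d x y :
  crossing_solution (gL, gR, b, c, d) x y ->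
  crossing_solution (gR, gL, b, - d, - c) (fun t => - x t) (fun t => - y t).
Proof.
  intros H t. destruct (H t) as [Hx [Hy [HL [HR H0]]]].
  split; [|split; [|split; [|split]]].
  - now apply @continuous_opp.
  - now apply @continuous_opp.
  - intros Ht. destruct HR as [H1 H2]; [lra|].
    split; simpl in *; (evar_last; [apply @is_derive_opp; eassumption|]);
      unfold opp; simpl; ring.
  - intros Ht. destruct HL as [H1 H2]; [lra|].
    split; simpl in *; (evar_last; [apply @is_derive_opp; eassumption|]);
      unfold opp; simpl; ring.
  - intros Ht. destruct H0 as [H1 H2]; [lra|]. split.
    + destruct H1 as [_ H1]. split; simpl in *; [easy|].
      assert (x t = 0) by lra. nra.
    + revert H2. apply filter_imp. intros s Hs. lra.
Qed.

(** For [y > |b|] both horizontal speeds [- y - b] and [- y + b] are negative. Since crossing times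
    are isolated, [x] has a constant sign on each side of [t], and the mean value theorem excludes
    the wrong one. *)
Lemma crossing_upper gL gR b c d x y t :
  crossing_solution (gL, gR, b, c, d) x y -> x t = 0 -> Rabs b < y t ->
  exists e, 0 < e /\ (forall s, t < s < t + e -> x s < 0) /\
    (forall s, t - e < s < t -> 0 < x s).
Proof.
  intros H Ht Hy.
  assert (Hcx : forall s, continuous x s) by (intros; apply (H s)).
  destruct (H t) as [_ [Cy [_ [_ H0]]]].
  destruct (H0 Ht) as [_ Hl].
  unfold locally', within in Hl.
  assert (CL : locally t (fun s => 2 * gL * x s - y s - b < 0)).
  { apply (continuous_locally_lt (fun s => 2 * gL * x s - y s - b)).
    - apply @continuous_minus; [apply @continuous_minus|]; try easy.
      + apply @continuous_mult; [apply continuous_const | easy].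
      + apply continuous_const.
    - rewrite Ht. generalize (Rle_abs (- b)). rewrite Rabs_Ropp. lra. }
  assert (CR : locally t (fun s => 2 * gR * x s - y s + b < 0)).
  { apply (continuous_locally_lt (fun s => 2 * gR * x s - y s + b)).
    - apply @continuous_plus; [apply @continuous_minus|]; try easy.
      + apply @continuous_mult; [apply continuous_const | easy].
      + apply continuous_const.
    - rewrite Ht. generalize (Rle_abs b). lra. }
  destruct (locally_exists_interval _ _ (filter_and _ _ Hl (filter_and _ _ CL CR)))
    as [e [He Hall]].
  exists e. split; [easy|]. split.
  - destruct (nonzero_constant_sign x t (t + e) Hcx) as [N | P].
    { intros s Hs. apply Hall; lra. }
    { exact N. }
    exfalso.
    destruct (MVT_open x (fun s => 2 * gR * x s - y s + b) t (t + e / 2))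
      as [m [Hm E]]; [lra | | easy |].
    { intros s Hs. apply (H s). apply P. lra. }
    destruct (Hall m) as [_ [_ H2]]; [lra|].
    assert (0 < x (t + e / 2)) by (apply P; lra). simpl in *. nra.
  - destruct (nonzero_constant_sign x (t - e) t Hcx) as [N | P].
    { intros s Hs. apply Hall; lra. }
    2: exact P.
    exfalso.
    destruct (MVT_open x (fun s => 2 * gL * x s - y s - b) (t - e / 2) t)
      as [m [Hm E]]; [lra | | easy |].
    { intros s Hs. apply (H s). apply N. lra. }
    destruct (Hall m) as [_ [H2 _]]; [lra|].
    assert (x (t - e / 2) < 0) by (apply N; lra). simpl in *. nra.
Qed.

Lemma crossing_lower gL gR b c d x y t :
  crossing_solution (gL, gR, b, c, d) x y -> x t = 0 -> y t < - Rabs b ->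
  exists e, 0 < e /\ (forall s, t < s < t + e -> 0 < x s) /\
    (forall s, t - e < s < t -> x s < 0).
Proof.
  intros H Ht Hy.
  destruct (crossing_upper _ _ _ _ _ _ _ t (crossing_solution_opp _ _ _ _ _ _ _ H))
    as [e [He [H1 H2]]]; [lra | lra |].
  exists e. repeat split; try easy; intros s Hs.
  - specialize (H1 s Hs). lra.
  - specialize (H2 s Hs). lra.
Qed.

(** * Closed orbits from two half arcs *)

Lemma locally_open_interval (P : R -> Prop) (t a b : R) :
  a < t < b -> (forall s, a < s < b -> P s) -> locally t P.
Proof.
  intros [Ha Hb] H. apply (locally_interval P t a b); try easy.
  intros s H1 H2. apply H. split; [exact H1 | exact H2].
Qed.

Lemma continuous_glue (f g h : R -> R) (t e : R) :
  0 < e -> continuous g t -> continuous h t ->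
  (forall s, t <= s < t + e -> f s = g s) ->
  (forall s, t - e < s <= t -> f s = h s) -> continuous f t.
Proof.
  intros He Cg Ch Hg Hh P HP.
  assert (Eg : f t = g t) by (apply Hg; lra).
  assert (Eh : f t = h t) by (apply Hh; lra).
  assert (Lg : locally t (fun s => P (g s))) by (apply Cg; now rewrite <- Eg).
  assert (Lh : locally t (fun s => P (h s))) by (apply Ch; now rewrite <- Eh).
  assert (Le : locally t (fun s => t - e < s < t + e)).
  { apply (locally_open_interval _ t (t - e) (t + e)); [lra | easy]. }
  change (locally t (fun s => P (f s))).
  generalize (filter_and _ _ Lg (filter_and _ _ Lh Le)).
  apply filter_imp. intros s [H1 [H2 H3]].
  destruct (Rle_or_lt t s) as [B | B].
  - rewrite Hg; [easy | lra].
  - rewrite Hh; [easy | lra].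
Qed.

Lemma continuous_ext_locally (f g : R -> R) (t : R) :
  locally t (fun s => f s = g s) -> continuous g t -> continuous f t.
Proof.
  intros H Hg. apply (continuous_ext_loc f g); [|easy].
  revert H. apply filter_imp. easy.
Qed.

Lemma continuous_shift (f : R -> R) (t0 t : R) :
  (forall s, continuous f s) -> continuous (fun s => f (s - t0)) t.
Proof.
  intros H. apply (continuous_comp (fun s => s - t0) f); [|apply H].
  apply @continuous_minus; [apply continuous_id | apply continuous_const].
Qed.

Lemma is_derive_shift (f : R -> R) (t0 t l : R) :
  is_derive f (t - t0) l -> is_derive (fun s => f (s - t0)) t l.
Proof.
  intros H. evar_last.
  - apply (is_derive_comp f (fun s => s - t0)); [exact H|].
    auto_derive; [easy | reflexivity].
  - unfold scal; simpl; unfold mult; simpl. ring.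
Qed.

Definition wrap (T t : R) : R := t - IZR (Int_part (t / T)) * T.

Lemma wrap_range T t : 0 < T -> 0 <= wrap T t < T.
Proof.
  intros HT. unfold wrap. destruct (base_Int_part (t / T)) as [H1 H2].
  set (n := IZR (Int_part (t / T))) in *.
  assert (E : t = t / T * T) by (field; lra).
  split; rewrite E at 1; nra.
Qed.

Lemma wrap_eq T t n : 0 < T -> 0 <= t - IZR n * T < T -> wrap T t = t - IZR n * T.
Proof.
  intros HT H. unfold wrap. replace (Int_part (t / T)) with n; [easy|].
  assert (E : t = t / T * T) by (field; lra).
  rewrite E in H. set (q := t / T) in *.
  destruct (base_Int_part q) as [H1 H2].
  assert (IZR n <= q) by nra.
  assert (q < IZR n + 1) by nra.
  assert (n < Int_part q + 1)%Z by (apply lt_IZR; rewrite plus_IZR; lra).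
  assert (Int_part q < n + 1)%Z by (apply lt_IZR; rewrite plus_IZR; lra).
  lia.
Qed.

Definition concat (A B : R -> R) (tau sigma t : R) : R :=
  let s := wrap (tau + sigma) t in
  if Rle_dec s tau then A s else B (s - tau).

Section Concat.

Context (A B : R -> R) (tau sigma : R) (Htau : 0 < tau) (Hsigma : 0 < sigma).

Let T := tau + sigma.

Lemma concat_fst n s : 0 <= s <= tau -> concat A B tau sigma (s + IZR n * T) = A s.
Proof.
  intros H. unfold concat. fold T. rewrite (wrap_eq T _ n); unfold T in *; try lra.
  replace (s + IZR n * (tau + sigma) - IZR n * (tau + sigma)) with s by ring.
  destruct (Rle_dec s tau); [easy | lra].
Qed.

(** At [s = 0] and [s = sigma] the definition evaluates [A], because the tie at [tau] goes to [A]
    and because [wrap] starts the next period; the matching conditions cover these two values. *)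
Lemma concat_snd n s :
  A tau = B 0 -> B sigma = A 0 -> 0 <= s <= sigma ->
  concat A B tau sigma (tau + s + IZR n * T) = B s.
Proof.
  intros E1 E2 H.
  destruct (Req_dec s 0) as [-> | Hs0].
  { rewrite Rplus_0_r, concat_fst; lra. }
  destruct (Req_dec s sigma) as [-> | Hs1].
  { replace (tau + sigma + IZR n * T) with (0 + IZR (n + 1) * T)
      by (rewrite plus_IZR; unfold T; ring).
    rewrite concat_fst; lra. }
  unfold concat. fold T. rewrite (wrap_eq T _ n); unfold T in *; try lra.
  destruct (Rle_dec _ tau); [lra|]. f_equal. ring.
Qed.

Lemma concat_periodic t : concat A B tau sigma (t + T) = concat A B tau sigma t.
Proof.
  unfold concat. fold T.
  replace (wrap T (t + T)) with (wrap T t); [easy|].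
  rewrite (wrap_eq T (t + T) (Int_part (t / T) + 1)).
  - rewrite plus_IZR. unfold wrap. fold T. ring.
  - unfold T; lra.
  - rewrite plus_IZR. generalize (wrap_range T t). unfold wrap, T in *. lra.
Qed.

End Concat.

Lemma wrap_cases tau sigma t :
  0 < tau -> 0 < sigma ->
  exists n s, t = s + IZR n * (tau + sigma) /\
    (s = 0 \/ 0 < s < tau \/ s = tau \/ tau < s < tau + sigma).
Proof.
  intros Ht Hs. exists (Int_part (t / (tau + sigma))), (wrap (tau + sigma) t).
  split; [unfold wrap; ring|].
  generalize (wrap_range (tau + sigma) t). lra.
Qed.

Lemma concat_locally_fst (A B : R -> R) (tau sigma : R) (n : Z) (s : R) :
  0 < s < tau -> 0 < sigma ->
  locally (s + IZR n * (tau + sigma))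
    (fun t => concat A B tau sigma t = A (t - IZR n * (tau + sigma))).
Proof.
  intros Hs Hsigma.
  apply (locally_open_interval _ _ (IZR n * (tau + sigma))
           (tau + IZR n * (tau + sigma))); [lra|].
  intros t Ht. rewrite <- (concat_fst A B tau sigma) with (n := n) by lra.
  f_equal. ring.
Qed.

Lemma concat_locally_snd (A B : R -> R) (tau sigma : R) (n : Z) (s : R) :
  A tau = B 0 -> B sigma = A 0 ->
  0 < tau -> tau < s < tau + sigma ->
  locally (s + IZR n * (tau + sigma))
    (fun t => concat A B tau sigma t = B (t - (tau + IZR n * (tau + sigma)))).
Proof.
  intros E1 E2 Htau Hs.
  apply (locally_open_interval _ _ (tau + IZR n * (tau + sigma))
           (tau + sigma + IZR n * (tau + sigma))); [lra|].
  intros t Ht. rewrite <- (concat_snd A B tau sigma) with (n := n) by lra.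
  f_equal. ring.
Qed.

Lemma continuous_concat (A B : R -> R) (tau sigma t : R) :
  (forall s, continuous A s) -> (forall s, continuous B s) ->
  0 < tau -> 0 < sigma -> A tau = B 0 -> B sigma = A 0 ->
  continuous (concat A B tau sigma) t.
Proof.
  intros CA CB Htau Hsigma E1 E2.
  destruct (wrap_cases tau sigma t Htau Hsigma) as [n [s [-> Hs]]].
  destruct Hs as [-> | [Hs | [-> | Hs]]].
  - rewrite Rplus_0_l.
    (* Just before the start of period [n] the curve runs through the [B] part of period [n - 1]. *)
    apply continuous_glue
      with (fun t => A (t - IZR n * (tau + sigma)))
           (fun t => B (t - (tau + IZR (n - 1) * (tau + sigma)))) (Rmin tau sigma).
    + now apply Rmin_glb_lt.
    + now apply continuous_shift.
    + now apply continuous_shift.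
    + intros t Ht. generalize (Rmin_l tau sigma). intros.
      rewrite <- (concat_fst A B tau sigma) with (n := n) by lra. f_equal. ring.
    + intros t Ht. generalize (Rmin_r tau sigma). intros.
      rewrite <- (concat_snd A B tau sigma) with (n := (n - 1)%Z);
        rewrite ?minus_IZR; try lra.
      f_equal. ring.
  - apply continuous_ext_locally with (fun t => A (t - IZR n * (tau + sigma))).
    + exact (concat_locally_fst A B tau sigma n s Hs Hsigma).
    + now apply continuous_shift.
  - apply continuous_glue
      with (fun t => B (t - (tau + IZR n * (tau + sigma))))
           (fun t => A (t - IZR n * (tau + sigma))) (Rmin tau sigma).
    + now apply Rmin_glb_lt.
    + now apply continuous_shift.
    + now apply continuous_shift.
    + intros t Ht. generalize (Rmin_r tau sigma). intros.
      rewrite <- (concat_snd A B tau sigma) with (n := n) by lra. f_equal. ring.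
    + intros t Ht. generalize (Rmin_l tau sigma). intros.
      rewrite <- (concat_fst A B tau sigma) with (n := n) by lra. f_equal. ring.
  - apply continuous_ext_locally
      with (fun t => B (t - (tau + IZR n * (tau + sigma)))).
    + exact (concat_locally_snd A B tau sigma n s E1 E2 Htau Hs).
    + now apply continuous_shift.
Qed.

(** The right half is a left arc seen through [(x, y) -> (- x, - y)]: this symmetry keeps [b],
    replaces [d] by [- d] and makes the arc start at the ordinate [v]. *)
Definition loop (gL gR b c d u v tau sigma : R) (z : R * R) : Prop :=
  (exists s, 0 <= s <= tau /\
     z = (arc_x gL c (u + b) s, arc_y gL c (u + b) s - b)) \/
  (exists s, 0 <= s <= sigma /\
     z = (- arc_x gR (- d) (v + b) s, - (arc_y gR (- d) (v + b) s - b))).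

(** In shifted ordinates the left arc runs from [u + b] to [- (v - b)] and the turned right arc from
    [v + b] to [- (u - b)], so the two arcs close up. *)
Lemma loop_crossing_periodic_orbit gL gR b c d u v tau sigma :
  half_arc gL c (u + b) (v - b) tau ->
  half_arc gR (- d) (v + b) (u - b) sigma ->
  crossing_periodic_orbit (gL, gR, b, c, d) (loop gL gR b c d u v tau sigma).
Proof.
  intros HL HR.
  assert (NL := fun t => half_arc_neg _ _ _ _ _ t HL).
  assert (NR := fun t => half_arc_neg _ _ _ _ _ t HR).
  destruct HL as [HtL [HuL [HvL [HxL HyL]]]].
  destruct HR as [HtR [HvR [HuR [HxR HyR]]]].
  set (Ax := arc_x gL c (u + b)) in *.
  set (Ay := fun t => arc_y gL c (u + b) t - b).
  set (Bx := fun t => - arc_x gR (- d) (v + b) t).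
  set (By := fun t => - (arc_y gR (- d) (v + b) t - b)).
  assert (Ax0 : Ax 0 = 0) by apply arc_x_0.
  assert (Ay0 : Ay 0 = u) by (unfold Ay; rewrite arc_y_0; ring).
  assert (Bx0 : Bx 0 = 0) by (unfold Bx; rewrite arc_x_0; ring).
  assert (By0 : By 0 = - v) by (unfold By; rewrite arc_y_0; ring).
  assert (Ax1 : Ax tau = 0) by easy.
  assert (Ay1 : Ay tau = - v) by (unfold Ay; lra).
  assert (Bx1 : Bx sigma = 0) by (unfold Bx; lra).
  assert (By1 : By sigma = u) by (unfold By; lra).
  assert (CAx : forall s, continuous Ax s) by apply continuous_arc_x.
  assert (CAy : forall s, continuous Ay s).
  { intros s. apply @continuous_minus;
      [apply continuous_arc_y | apply continuous_const]. }
  assert (CBx : forall s, continuous Bx s).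
  { intros s. apply @continuous_opp, continuous_arc_x. }
  assert (CBy : forall s, continuous By s).
  { intros s. apply @continuous_opp. apply @continuous_minus;
      [apply continuous_arc_y | apply continuous_const]. }
  assert (DAx : forall s, is_derive Ax s (2 * gL * Ax s - Ay s - b)).
  { intros s. evar_last; [apply is_derive_arc_x|]. unfold Ax, Ay. ring. }
  assert (DAy : forall s, is_derive Ay s ((1 + gL ^ 2) * (Ax s - c))).
  { intros s. evar_last; [apply @is_derive_minus;
      [apply is_derive_arc_y | apply @is_derive_const]|].
    unfold Ax, minus, plus, opp, zero; simpl. ring. }
  assert (DBx : forall s, is_derive Bx s (2 * gR * Bx s - By s + b)).
  { intros s. evar_last; [apply @is_derive_opp, is_derive_arc_x|].
    unfold Bx, By, opp; simpl. ring. }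
  assert (DBy : forall s, is_derive By s ((1 + gR ^ 2) * (Bx s - d))).
  { intros s. evar_last; [apply @is_derive_opp, @is_derive_minus;
      [apply is_derive_arc_y | apply @is_derive_const]|].
    unfold Bx, minus, plus, opp, zero; simpl. ring. }
  set (T := tau + sigma).
  set (X := concat Ax Bx tau sigma). set (Y := concat Ay By tau sigma).
  assert (CX : forall t, continuous X t) by (intros; apply continuous_concat; lra || easy).
  assert (CY : forall t, continuous Y t) by (intros; apply continuous_concat; lra || easy).
  assert (XA : forall n s, 0 <= s <= tau -> X (s + IZR n * T) = Ax s)
    by (intros; apply concat_fst; lra).
  assert (YA : forall n s, 0 <= s <= tau -> Y (s + IZR n * T) = Ay s)
    by (intros; apply concat_fst; lra).
  assert (XB : forall n s, 0 <= s <= sigma -> X (tau + s + IZR n * T) = Bx s)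
    by (intros; apply concat_snd; lra).
  assert (YB : forall n s, 0 <= s <= sigma -> Y (tau + s + IZR n * T) = By s)
    by (intros; apply concat_snd; lra).
  assert (Hfollow1 : forall n s, 0 < s < tau ->
    follows (left_field (gL, gR, b, c, d)) X Y (s + IZR n * T)).
  { intros n s Hs. split; simpl.
    - rewrite XA, YA by lra.
      apply (is_derive_ext_loc (fun t => Ax (t - IZR n * T))).
      + generalize (concat_locally_fst Ax Bx tau sigma n s Hs ltac:(lra)).
        apply filter_imp. intros; now symmetry.
      + apply is_derive_shift. replace (s + IZR n * T - IZR n * T) with s by ring.
        apply DAx.
    - rewrite XA by lra. replace (gL * (gL * 1)) with (gL ^ 2) by ring.
      apply (is_derive_ext_loc (fun t => Ay (t - IZR n * T))).
      + generalize (concat_locally_fst Ay By tau sigma n s Hs ltac:(lra)).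
        apply filter_imp. intros; now symmetry.
      + apply is_derive_shift. replace (s + IZR n * T - IZR n * T) with s by ring.
        apply DAy. }
  assert (Hfollow2 : forall n s, tau < s < T ->
    follows (right_field (gL, gR, b, c, d)) X Y (s + IZR n * T)).
  { intros n s Hs. unfold T in Hs.
    assert (EX : X (s + IZR n * T) = Bx (s - tau)).
    { rewrite <- (XB n) by lra. f_equal. ring. }
    assert (EY : Y (s + IZR n * T) = By (s - tau)).
    { rewrite <- (YB n) by lra. f_equal. ring. }
    split; simpl.
    - rewrite EX, EY.
      apply (is_derive_ext_loc (fun t => Bx (t - (tau + IZR n * T)))).
      + generalize (concat_locally_snd Ax Bx tau sigma n s ltac:(lra) ltac:(lra)
                      ltac:(lra) Hs).
        apply filter_imp. intros; now symmetry.
      + apply is_derive_shift.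
        replace (s + IZR n * T - (tau + IZR n * T)) with (s - tau) by ring.
        apply DBx.
    - rewrite EX. replace (gR * (gR * 1)) with (gR ^ 2) by ring.
      apply (is_derive_ext_loc (fun t => By (t - (tau + IZR n * T)))).
      + generalize (concat_locally_snd Ay By tau sigma n s ltac:(lra) ltac:(lra)
                      ltac:(lra) Hs).
        apply filter_imp. intros; now symmetry.
      + apply is_derive_shift.
        replace (s + IZR n * T - (tau + IZR n * T)) with (s - tau) by ring.
        apply DBy. }
  assert (Hneg : forall n s, 0 < s < tau -> X (s + IZR n * T) < 0).
  { intros n s Hs. rewrite XA by lra. now apply NL. }
  assert (Hpos : forall n s, tau < s < T -> 0 < X (s + IZR n * T)).
  { intros n s Hs. unfold T in Hs.
    replace (s + IZR n * T) with (tau + (s - tau) + IZR n * T) by ring.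
    rewrite XB by lra. unfold Bx. specialize (NR (s - tau)). lra. }
  exists X, Y, T. split; [unfold T; lra|]. split; [|split; [|split]].
  - intros t. split; [apply CX | split; [apply CY|]].
    destruct (wrap_cases tau sigma t) as [n [s [-> Hs]]]; [lra | lra |].
    fold T. destruct Hs as [-> | [Hs | [-> | Hs]]].
    + assert (E : X (0 + IZR n * T) = 0) by (rewrite XA; lra).
      assert (E' : Y (0 + IZR n * T) = u) by (rewrite YA; lra).
      split; [lra | split; [lra|]]. intros _. split.
      (* The product of the speeds is [(u + b) (u - b)]; the first factor is the start of the left
         arc and the second the end of the right arc, both positive. *)
      * split; [easy|]. simpl. rewrite E, E'. nra.
      * apply (locally_open_interval _ _ (- sigma + IZR n * T) (tau + IZR n * T)).
        { lra. }
        intros t Ht Hne. destruct (Rlt_or_le t (0 + IZR n * T)) as [B | B].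
        -- replace t with ((t - IZR (n - 1) * T) + IZR (n - 1) * T) by ring.
           apply Rgt_not_eq, Hpos. rewrite minus_IZR. unfold T in *. lra.
        -- replace t with ((t - IZR n * T) + IZR n * T) by ring.
           apply Rlt_not_eq, Hneg. lra.
    + specialize (Hneg n s Hs).
      split; [intros; now apply Hfollow1 | split; [intros; exfalso; lra | intros; exfalso; lra]].
    + assert (E : X (tau + IZR n * T) = 0) by (rewrite XA; lra).
      assert (E' : Y (tau + IZR n * T) = - v) by (rewrite YA; lra).
      split; [lra | split; [lra|]]. intros _. split.
      * split; [easy|]. simpl. rewrite E, E'. nra.
      * apply (locally_open_interval _ _ (IZR n * T) (T + IZR n * T)).
        { unfold T. lra. }
        intros t Ht Hne.
        replace t with ((t - IZR n * T) + IZR n * T) by ring.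
        destruct (Rlt_or_le t (tau + IZR n * T)) as [B | B].
        -- apply Rlt_not_eq, Hneg. lra.
        -- apply Rgt_not_eq, Hpos. lra.
    + specialize (Hpos n s Hs).
      split; [intros; exfalso; lra | split; [intros; now apply Hfollow2 | intros; exfalso; lra]].
  - intros t. split; apply concat_periodic; lra.
  - exists 0. replace 0 with (0 + IZR 0 * T) at 1 by (simpl; ring).
    rewrite XA; lra.
  - intros z. split.
    + intros [[s [Hs ->]] | [s [Hs ->]]].
      * exists (s + IZR 0 * T). now rewrite XA, YA.
      * exists (tau + s + IZR 0 * T). now rewrite XB, YB.
    + intros [t ->].
      destruct (wrap_cases tau sigma t) as [n [s [-> Hs]]]; [lra | lra |].
      fold T. destruct (Rle_or_lt s tau) as [H | H].
      * left. exists s. assert (0 <= s <= tau) by lra.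
        split; [easy|]. now rewrite XA, YA.
      * right. exists (s - tau). assert (0 <= s - tau <= sigma) by lra.
        split; [easy|]. replace (s + IZR n * T) with (tau + (s - tau) + IZR n * T) by ring.
        now rewrite XB, YB.
Qed.

(** * Orbits near a closed orbit *)

Lemma loop_section gL gR b c d u v tau sigma z :
  half_arc gL c (u + b) (v - b) tau ->
  half_arc gR (- d) (v + b) (u - b) sigma ->
  loop gL gR b c d u v tau sigma z -> fst z = 0 -> snd z = u \/ snd z = - v.
Proof.
  intros HL HR [[s [Hs ->]] | [s [Hs ->]]]; simpl; intros H0.
  - destruct (Req_dec s 0) as [-> | N0].
    { left. rewrite arc_y_0. ring. }
    destruct (Req_dec s tau) as [-> | N1].
    { right. destruct HL as [_ [_ [_ [_ ->]]]]. ring. }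
    assert (arc_x gL c (u + b) s < 0) by (apply half_arc_neg with (v - b) tau; lra || easy).
    lra.
  - destruct (Req_dec s 0) as [-> | N0].
    { right. rewrite arc_y_0. ring. }
    destruct (Req_dec s sigma) as [-> | N1].
    { left. destruct HR as [_ [_ [_ [_ ->]]]]. ring. }
    assert (arc_x gR (- d) (v + b) s < 0)
      by (apply half_arc_neg with (u - b) sigma; lra || easy).
    lra.
Qed.

Lemma loop_upper gL gR b c d u v tau sigma :
  0 < tau -> loop gL gR b c d u v tau sigma (0, u).
Proof.
  intros H. left. exists 0. rewrite arc_x_0, arc_y_0.
  split; [lra | f_equal; ring].
Qed.

Lemma loop_lower gL gR b c d u v tau sigma :
  0 < sigma -> loop gL gR b c d u v tau sigma (0, - v).
Proof.
  intros H. right. exists 0. rewrite arc_x_0, arc_y_0.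
  split; [lra | f_equal; ring].
Qed.

Lemma periodic_Z (f : R -> R) T :
  (forall t, f (t + T) = f t) -> forall n t, f (t + IZR n * T) = f t.
Proof.
  intros H n t. destruct (Z.le_gt_cases 0 n) as [Hn | Hn].
  - rewrite <- (Z2Nat.id n Hn), <- INR_IZR_INZ. now apply periodic_nat.
  - rewrite <- (periodic_nat f T H (Z.to_nat (- n))). f_equal.
    rewrite INR_IZR_INZ, Z2Nat.id, opp_IZR by lia. ring.
Qed.

(** By periodicity only the times in [[0, T]] matter. There the zeros of [x] with [y >= m] form a
    compact set, on which [y] attains its maximum. *)
Lemma max_on_zeros (x y : R -> R) (T m t0 : R) :
  (forall t, continuous x t /\ continuous y t) -> 0 < T ->
  (forall t, x (t + T) = x t /\ y (t + T) = y t) ->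
  x t0 = 0 -> m <= y t0 ->
  exists t1, x t1 = 0 /\ m <= y t1 /\
    forall t, x t = 0 -> m <= y t -> y t <= y t1.
Proof.
  intros Hc HT Hp Hx0 Hy0.
  set (D := fun t => 0 <= t <= T /\ x t = 0 /\ m <= y t).
  assert (Hred : forall t, x t = 0 -> m <= y t -> exists s, D s /\ y s = y t).
  { intros t H1 H2. exists (wrap T t).
    assert (Ex : x (wrap T t) = x t).
    { rewrite <- (periodic_Z x T) with (n := Int_part (t / T)) by apply Hp.
      f_equal. unfold wrap. ring. }
    assert (Ey : y (wrap T t) = y t).
    { rewrite <- (periodic_Z y T) with (n := Int_part (t / T)) by apply Hp.
      f_equal. unfold wrap. ring. }
    generalize (wrap_range T t HT). intros. unfold D. rewrite Ex, Ey. lra. }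
  assert (HD : compact D).
  { apply compact_P4 with (fun t => 0 <= t <= T).
    - apply compact_P3.
    - intros t Ht. unfold complementary in Ht.
      assert (HL : locally t (fun s => ~ D s)).
      { destruct (Rlt_or_le t 0) as [A | A].
        { generalize (continuous_locally_lt id t 0 (continuous_id t) A).
          apply filter_imp. unfold id, D. intros; lra. }
        destruct (Rlt_or_le T t) as [B | B].
        { generalize (continuous_locally_gt id t T (continuous_id t) B).
          apply filter_imp. unfold id, D. intros; lra. }
        destruct (Rlt_or_le (x t) 0) as [C | C].
        { generalize (continuous_locally_lt x t 0 (proj1 (Hc t)) C).
          apply filter_imp. unfold D. intros; lra. }
        destruct (Rlt_or_le 0 (x t)) as [E | E].
        { generalize (continuous_locally_gt x t 0 (proj1 (Hc t)) E).
          apply filter_imp. unfold D. intros; lra. }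
        destruct (Rlt_or_le (y t) m) as [F | F].
        { generalize (continuous_locally_lt y t m (proj2 (Hc t)) F).
          apply filter_imp. unfold D. intros; lra. }
        exfalso. apply Ht. unfold D. lra. }
      destruct HL as [e He]. exists e. intros s Hs. now apply He.
    - intros t Ht. apply Ht. }
  assert (HY : compact (image_dir y D)).
  { apply continuity_compact; [|easy].
    intros t. apply continuity_pt_filterlim, Hc. }
  destruct (Hred t0 Hx0 Hy0) as [s0 [Hs0 _]].
  destruct (completeness (image_dir y D)) as [M [HM1 HM2]].
  - destruct (compact_P1 _ HY) as [lo [hi Hb]]. exists hi. intros v Hv.
    now apply Hb.
  - exists (y s0). now exists s0.
  - assert (HMin : image_dir y D M).
    (* Otherwise the closed image would miss an interval around its supremum [M], and a smaller
       number would be an upper bound. *)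
    { destruct (Classical_Prop.classic (image_dir y D M)) as [H | H]; [easy | exfalso].
      destruct (compact_P2 _ HY M H) as [e He].
      assert (M <= M - e / 2); [|generalize (cond_pos e); lra].
      apply HM2. intros v Hv. destruct (Rle_or_lt v (M - e / 2)) as [B | B]; [easy|].
      exfalso. apply (He v); [|easy]. assert (v <= M) by now apply HM1.
      generalize (cond_pos e). intros. unfold disc. apply Rabs_def1; lra. }
    destruct HMin as [t1 [E [_ [H1 H2]]]]. exists t1. repeat split; try easy.
    intros t Ht1 Ht2. destruct (Hred t Ht1 Ht2) as [s [Hs <-]].
    rewrite <- E. apply HM1. now exists s.
Qed.

Lemma gap_after (f : R -> R) (T t e : R) :
  (forall s, continuous f s) -> 0 < T -> (forall s, f (s + T) = f s) ->
  f t = 0 -> 0 < e -> (forall s, t < s < t + e -> f s <> 0) ->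
  exists z, t < z /\ f z = 0 /\ forall s, t < s < z -> f s <> 0.
Proof.
  intros Hc HT Hp Ht He Hn.
  destruct (zero_free_gap f T t (t + e / 2)) as [a [z [Haz [Ha [Hz Hs]]]]]; try easy.
  - apply Hn. lra.
  - destruct (Rtotal_order a t) as [H | [-> | H]].
    + exfalso. apply (Hs t); [lra | easy].
    + exists z. repeat split; easy || lra.
    + exfalso. apply (Hn a); [lra | easy].
Qed.

Lemma gap_before (f : R -> R) (T t e : R) :
  (forall s, continuous f s) -> 0 < T -> (forall s, f (s + T) = f s) ->
  f t = 0 -> 0 < e -> (forall s, t - e < s < t -> f s <> 0) ->
  exists z, z < t /\ f z = 0 /\ forall s, z < s < t -> f s <> 0.
Proof.
  intros Hc HT Hp Ht He Hn.
  destruct (zero_free_gap f T t (t - e / 2)) as [a [z [Haz [Ha [Hz Hs]]]]]; try easy.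
  - apply Hn. lra.
  - destruct (Rtotal_order z t) as [H | [-> | H]].
    + exfalso. apply (Hn z); [lra | easy].
    + exists a. repeat split; easy || lra.
    + exfalso. apply (Hs t); [lra | easy].
Qed.

Lemma crossing_upper_next gL gR b c d x y T t :
  crossing_solution (gL, gR, b, c, d) x y ->
  0 < T -> (forall s, x (s + T) = x s) ->
  x t = 0 -> Rabs b < y t ->
  exists z, t < z /\ x z = 0 /\ forall s, t < s < z -> x s < 0.
Proof.
  intros H HT Hp Ht Hy.
  assert (Hc : forall s, continuous x s) by (intros; apply (H s)).
  destruct (crossing_upper _ _ _ _ _ _ _ t H Ht Hy) as [e [He [H1 _]]].
  destruct (gap_after x T t e) as [z [Hz [Ez Hn]]]; try easy.
  { intros s Hs. apply Rlt_not_eq. now apply H1. }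
  exists z. repeat split; try easy.
  destruct (nonzero_constant_sign x t z Hc Hn) as [N | P]; [easy|].
  exfalso. set (s := t + Rmin (e / 2) ((z - t) / 2)).
  assert (0 < Rmin (e / 2) ((z - t) / 2)) by (apply Rmin_glb_lt; lra).
  assert (Rmin (e / 2) ((z - t) / 2) <= e / 2) by apply Rmin_l.
  assert (Rmin (e / 2) ((z - t) / 2) <= (z - t) / 2) by apply Rmin_r.
  assert (x s < 0) by (apply H1; unfold s; lra).
  assert (0 < x s) by (apply P; unfold s; lra). lra.
Qed.

Lemma crossing_lower_next gL gR b c d x y T t :
  crossing_solution (gL, gR, b, c, d) x y ->
  0 < T -> (forall s, x (s + T) = x s) ->
  x t = 0 -> y t < - Rabs b ->
  exists z, t < z /\ x z = 0 /\ forall s, t < s < z -> 0 < x s.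
Proof.
  intros H HT Hp Ht Hy.
  destruct (crossing_upper_next _ _ _ _ _ _ _ T t (crossing_solution_opp _ _ _ _ _ _ _ H))
    as [z [Hz [Ez Hn]]]; try lra.
  - intros s. now rewrite Hp.
  - exists z. split; [easy|]. split; [lra|]. intros s Hs. specialize (Hn s Hs). lra.
Qed.

Lemma crossing_upper_previous gL gR b c d x y T t :
  crossing_solution (gL, gR, b, c, d) x y ->
  0 < T -> (forall s, x (s + T) = x s) ->
  x t = 0 -> Rabs b < y t ->
  exists z, z < t /\ x z = 0 /\ forall s, z < s < t -> 0 < x s.
Proof.
  intros H HT Hp Ht Hy.
  assert (Hc : forall s, continuous x s) by (intros; apply (H s)).
  destruct (crossing_upper _ _ _ _ _ _ _ t H Ht Hy) as [e [He [_ H1]]].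
  destruct (gap_before x T t e) as [z [Hz [Ez Hn]]]; try easy.
  { intros s Hs. apply Rgt_not_eq. now apply H1. }
  exists z. repeat split; try easy.
  destruct (nonzero_constant_sign x z t Hc Hn) as [N | P]; [|easy].
  exfalso. set (s := t - Rmin (e / 2) ((t - z) / 2)).
  assert (0 < Rmin (e / 2) ((t - z) / 2)) by (apply Rmin_glb_lt; lra).
  assert (Rmin (e / 2) ((t - z) / 2) <= e / 2) by apply Rmin_l.
  assert (Rmin (e / 2) ((t - z) / 2) <= (t - z) / 2) by apply Rmin_r.
  assert (0 < x s) by (apply H1; unfold s; lra).
  assert (x s < 0) by (apply N; unfold s; lra). lra.
Qed.

Lemma crossing_lower_previous gL gR b c d x y T t :
  crossing_solution (gL, gR, b, c, d) x y ->
  0 < T -> (forall s, x (s + T) = x s) ->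
  x t = 0 -> y t < - Rabs b ->
  exists z, z < t /\ x z = 0 /\ forall s, z < s < t -> x s < 0.
Proof.
  intros H HT Hp Ht Hy.
  destruct (crossing_upper_previous _ _ _ _ _ _ _ T t
              (crossing_solution_opp _ _ _ _ _ _ _ H))
    as [z [Hz [Ez Hn]]]; try lra.
  - intros s. now rewrite Hp.
  - exists z. split; [easy|]. split; [lra|]. intros s Hs. specialize (Hn s Hs). lra.
Qed.

Lemma left_transit gL gR b c d x y t0 t1 V tau :
  crossing_solution (gL, gR, b, c, d) x y ->
  t0 < t1 -> x t0 = 0 -> x t1 = 0 -> (forall s, t0 < s < t1 -> x s < 0) ->
  half_arc gL c (y t0 + b) V tau ->
  t1 = t0 + tau /\ y t1 = - (V + b) /\
  forall s, t0 <= s <= t1 ->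
    x s = arc_x gL c (y t0 + b) (s - t0) /\
    y s = arc_y gL c (y t0 + b) (s - t0) - b.
Proof.
  intros H Ht Hx0 Hx1 Hn Ha.
  destruct (arc_unique_half gL b c V tau x y t0 t1) as [H1 [H2 H3]]; try easy.
  - intros s _. now apply (crossing_solution_continuous _ _ _ H).
  - intros s Hs. split; [now apply Hn|].
    apply (crossing_solution_left _ _ _ _ _ _ _ _ H). now apply Hn.
  - split; [easy|]. split; [lra | easy].
Qed.

Lemma right_transit gL gR b c d x y t0 t1 V tau :
  crossing_solution (gL, gR, b, c, d) x y ->
  t0 < t1 -> x t0 = 0 -> x t1 = 0 -> (forall s, t0 < s < t1 -> 0 < x s) ->
  half_arc gR (- d) (- y t0 + b) V tau ->
  t1 = t0 + tau /\ y t1 = V + b /\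
  forall s, t0 <= s <= t1 ->
    x s = - arc_x gR (- d) (- y t0 + b) (s - t0) /\
    y s = - (arc_y gR (- d) (- y t0 + b) (s - t0) - b).
Proof.
  intros H Ht Hx0 Hx1 Hn Ha.
  destruct (left_transit _ _ _ _ _ _ _ t0 t1 V tau (crossing_solution_opp _ _ _ _ _ _ _ H))
    as [H1 [H2 H3]]; try lra.
  - intros s Hs. specialize (Hn s Hs). lra.
  - easy.
  - split; [easy|]. split; [lra|]. intros s Hs. specialize (H3 s Hs). lra.
Qed.

(** Periodicity provides a next crossing after each crossing; the two transits then identify the
    pieces in between with the halves of the loop. *)
Lemma loop_return gL gR b c d u v tau sigma x y T t :
  half_arc gL c (u + b) (v - b) tau ->
  half_arc gR (- d) (v + b) (u - b) sigma ->
  crossing_solution (gL, gR, b, c, d) x y ->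
  0 < T -> (forall s, x (s + T) = x s) -> x t = 0 -> y t = u ->
  x (t + (tau + sigma)) = 0 /\ y (t + (tau + sigma)) = u /\
  (forall s, t <= s <= t + (tau + sigma) ->
     loop gL gR b c d u v tau sigma (x s, y s)) /\
  (forall z, loop gL gR b c d u v tau sigma z -> exists s, z = (x s, y s)).
Proof.
  intros HL HR H HT Hp Hx Hy.
  assert (Hub : Rabs b < u).
  { destruct HL as [_ [H1 _]]. destruct HR as [_ [_ [H2 _]]]. apply Rabs_def1; lra. }
  assert (Hvb : Rabs b < v).
  { destruct HL as [_ [_ [H1 _]]]. destruct HR as [_ [H2 _]]. apply Rabs_def1; lra. }
  destruct (crossing_upper_next _ _ _ _ _ _ _ T t H HT Hp Hx) as [t1 [Ht1 [Hx1 Hn1]]].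
  { lra. }
  rewrite <- Hy in HL.
  destruct (left_transit _ _ _ _ _ _ _ t t1 _ tau H Ht1 Hx Hx1 Hn1 HL)
    as [E1 [Ey1 F1]].
  assert (Ey1' : y t1 = - v) by lra.
  destruct (crossing_lower_next _ _ _ _ _ _ _ T t1 H HT Hp Hx1) as [t2 [Ht2 [Hx2 Hn2]]].
  { lra. }
  replace v with (- y t1) in HR by lra.
  destruct (right_transit _ _ _ _ _ _ _ t1 t2 _ sigma H Ht2 Hx1 Hx2 Hn2 HR)
    as [E2 [Ey2 F2]].
  replace (t + (tau + sigma)) with t2 by lra.
  rewrite Hy in F1. rewrite Ey1', Ropp_involutive in F2.
  split; [easy | split; [lra | split]].
  - intros s Hs. destruct (Rle_or_lt s t1) as [B | B].
    + left. exists (s - t). destruct (F1 s) as [-> ->]; [lra|].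
      split; [lra | easy].
    + right. exists (s - t1). destruct (F2 s) as [-> ->]; [lra|].
      split; [lra | easy].
  - intros z [[s [Hs ->]] | [s [Hs ->]]].
    + exists (t + s). destruct (F1 (t + s)) as [-> ->]; [lra|].
      now replace (t + s - t) with s by ring.
    + exists (t1 + s). destruct (F2 (t1 + s)) as [-> ->]; [lra|].
      now replace (t1 + s - t1) with s by ring.
Qed.

(** The given period [T] need not be [tau + sigma]. The orbit is back at [(0, u)] after every
    multiple of [tau + sigma], and any time, moved beyond [t0] by multiples of [T], falls into one
    of these turns. *)
Lemma orbit_through_loop gL gR b c d u v tau sigma x y T t0 :
  half_arc gL c (u + b) (v - b) tau ->
  half_arc gR (- d) (v + b) (u - b) sigma ->
  crossing_solution (gL, gR, b, c, d) x y ->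
  0 < T -> (forall s, x (s + T) = x s /\ y (s + T) = y s) ->
  x t0 = 0 -> y t0 = u ->
  forall z, (exists t, z = (x t, y t)) <-> loop gL gR b c d u v tau sigma z.
Proof.
  intros HL HR H HT Hp Hx Hy z.
  assert (Hpx : forall s, x (s + T) = x s) by apply Hp.
  assert (Hpy : forall s, y (s + T) = y s) by apply Hp.
  set (T0 := tau + sigma).
  assert (HT0 : 0 < T0).
  { destruct HL as [HL _]. destruct HR as [HR _]. unfold T0. lra. }
  assert (Hall : forall n : nat, x (t0 + INR n * T0) = 0 /\ y (t0 + INR n * T0) = u).
  { induction n as [|n [IHx IHy]].
    - simpl. replace (t0 + 0 * T0) with t0 by ring. easy.
    - rewrite S_INR.
      replace (t0 + (INR n + 1) * T0) with (t0 + INR n * T0 + T0) by ring.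
      destruct (loop_return gL gR b c d u v tau sigma x y T (t0 + INR n * T0))
        as [H1 [H2 _]]; easy. }
  split.
  - intros [t ->]. destruct (exists_multiple_above T (t0 - t) HT) as [n Hn].
    rewrite <- (periodic_nat x T Hpx n t), <- (periodic_nat y T Hpy n t).
    set (s := t + INR n * T) in *.
    destruct (nfloor_ex ((s - t0) / T0)) as [m Hm].
    { apply Rdiv_le_0_compat; unfold s; lra. }
    destruct (Hall m) as [Hxm Hym].
    destruct (loop_return gL gR b c d u v tau sigma x y T (t0 + INR m * T0))
      as [_ [_ [H1 _]]]; try easy.
    apply H1. fold T0.
    assert (E : s - t0 = (s - t0) / T0 * T0) by (field; lra).
    set (q := (s - t0) / T0) in *. nra.
  - destruct (loop_return gL gR b c d u v tau sigma x y T t0)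
      as [_ [_ [_ H1]]]; try easy. apply H1.
Qed.

(* With [Y = r - K r] and [V = r + K r] the bound on the increments of [K] makes
   both end points of the half arc increasing functions of [r]. *)
Definition arc_family (g c : R) (K : R -> R) (r1 r2 : R) : Prop :=
  (forall r, r1 < r < r2 -> exists tau, half_arc g c (r - K r) (r + K r) tau) /\
  (forall r r', r1 < r -> r < r' -> r' < r2 -> Rabs (K r' - K r) < r' - r).

Lemma Rabs_increment_lt (a h : R) : Rabs a < h -> - h < a < h.
Proof. intros H. generalize (Rle_abs a) (Rle_abs (- a)). rewrite Rabs_Ropp. lra. Qed.

(** [r - K r] is increasing and 2-Lipschitz, so the intermediate value theorem applies. Every
    starting ordinate close to that of [r0] thus belongs to the family, which makes the arcs of
    neighbouring orbits explicit. *)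
Lemma arc_family_onto g c K r1 r2 r0 :
  arc_family g c K r1 r2 -> r1 < r0 < r2 ->
  exists delta, 0 < delta /\
    forall h, Rabs (h - (r0 - K r0)) < delta ->
      exists r, r1 < r < r2 /\ r - K r = h.
Proof.
  intros [_ HK] H0.
  set (f := fun r => r - K r).
  assert (Hlip : forall r r', r1 < r < r2 -> r1 < r' < r2 ->
                   Rabs (f r' - f r) <= 2 * Rabs (r' - r)).
  { assert (Hw : forall r r', r1 < r -> r < r' -> r' < r2 ->
                   Rabs (f r' - f r) <= 2 * Rabs (r' - r)).
    { intros r r' A1 A2 A3.
      generalize (Rabs_increment_lt _ _ (HK r r' A1 A2 A3)). intros.
      rewrite (Rabs_pos_eq (r' - r)) by lra. apply Rabs_le. unfold f. lra. }
    intros r r' A B. destruct (Rtotal_order r r') as [C | [-> | C]].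
    - apply Hw; lra.
    - rewrite !Rminus_diag, Rabs_R0. lra.
    - rewrite <- (Rabs_Ropp (f r' - f r)), <- (Rabs_Ropp (r' - r)), !Ropp_minus_distr.
      apply Hw; lra. }
  assert (Hcont : forall r, r1 < r < r2 -> continuity_pt f r).
  { intros r Hr e He.
    exists (Rmin (e / 3) (Rmin (r - r1) (r2 - r))).
    split; [repeat apply Rmin_glb_lt; lra|].
    intros s [_ Hs]. simpl in *. unfold Rdist in *.
    generalize (Rmin_l (e / 3) (Rmin (r - r1) (r2 - r)))
      (Rmin_r (e / 3) (Rmin (r - r1) (r2 - r)))
      (Rmin_l (r - r1) (r2 - r)) (Rmin_r (r - r1) (r2 - r)). intros.
    assert (Hs' : Rabs (s - r) < Rmin (r - r1) (r2 - r)) by lra.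
    generalize (Rabs_increment_lt _ _ Hs'). intros.
    apply Rle_lt_trans with (2 * Rabs (s - r)); [apply Hlip; lra | lra]. }
  assert (Hmono : forall r r', r1 < r -> r < r' -> r' < r2 -> f r < f r').
  { intros r r' A B C. generalize (Rabs_increment_lt _ _ (HK r r' A B C)).
    unfold f. lra. }
  (* Midpoints, because [K] is controlled only inside the open interval. *)
  set (a := (r1 + r0) / 2). set (b := (r0 + r2) / 2).
  assert (Ha : f a < f r0) by (apply Hmono; unfold a; lra).
  assert (Hb : f r0 < f b) by (apply Hmono; unfold b; lra).
  exists (Rmin (f r0 - f a) (f b - f r0)). split; [apply Rmin_glb_lt; lra|].
  intros h Hh.
  generalize (Rmin_l (f r0 - f a) (f b - f r0)) (Rmin_r (f r0 - f a) (f b - f r0)).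
  generalize (Rabs_increment_lt _ _ Hh). fold (f r0). intros.
  destruct (IVT_interv (fun r => f r - h) a b) as [r [Hr E]].
  - intros r Hr. apply continuity_pt_minus.
    + apply Hcont. unfold a, b in *. lra.
    + apply continuity_pt_const. now intros ? ?.
  - unfold a, b. lra.
  - lra.
  - lra.
  - exists r. split; [unfold a, b in *; lra | unfold f in E; lra].
Qed.

(* Isolation: among the crossings of a periodic orbit close to the given one take
   the highest.  Since the half-return maps are increasing and both the image and
   the preimage of that crossing are not higher, it is a fixed point of the return
   map, hence the crossing of the given orbit. *)
Lemma limit_cycle_of_isolated_zero gL gR b c d KL KR r1 r2 r0 :
  arc_family gL c KL r1 r2 -> arc_family gR (- d) KR r1 r2 ->
  r1 < r0 < r2 -> KL r0 + KR r0 + 2 * b = 0 ->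
  (forall r, r1 < r < r2 -> KL r + KR r + 2 * b = 0 -> r = r0) ->
  exists G u v,
    limit_cycle (gL, gR, b, c, d) G /\
    0 < u /\ 0 < v /\ u = r0 - KL r0 - b /\ v = r0 + KL r0 + b /\
    forall y, G (0, y) <-> y = u \/ y = - v.
Proof.
  intros FL FR Hr0 Hz Huniq.
  set (u := r0 - KL r0 - b). set (v := r0 + KL r0 + b).
  destruct (proj1 FL r0 Hr0) as [tau HL].
  destruct (proj1 FR r0 Hr0) as [sigma HR].
  replace (r0 - KL r0) with (u + b) in HL by (unfold u; ring).
  replace (r0 + KL r0) with (v - b) in HL by (unfold v; ring).
  (* Here the zero of [KL + KR + 2 b] is used: it says that the right arc starts where the left one
     ends, and ends where that one starts. *)
  replace (r0 - KR r0) with (v + b) in HR by (unfold v; lra).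
  replace (r0 + KR r0) with (u - b) in HR by (unfold u; lra).
  assert (Hu : Rabs b < u).
  { destruct HL as [_ [H1 _]]. destruct HR as [_ [_ [H2 _]]]. apply Rabs_def1; lra. }
  assert (Hv : Rabs b < v).
  { destruct HL as [_ [_ [H1 _]]]. destruct HR as [_ [H2 _]]. apply Rabs_def1; lra. }
  assert (Hb0 : 0 <= Rabs b) by apply Rabs_pos.
  set (G := loop gL gR b c d u v tau sigma).
  assert (HG : crossing_periodic_orbit (gL, gR, b, c, d) G)
    by now apply loop_crossing_periodic_orbit.
  assert (Hsec : forall z, G z -> fst z = 0 -> snd z = u \/ snd z = - v)
    by (intros z Hz'; now apply (loop_section _ _ _ _ _ _ _ _ _ z HL HR)).
  exists G, u, v. split; [split; [exact HG|] | ].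
  2: { repeat split; try easy; try lra.
       - intros Hy. now apply (Hsec (0, y)).
       - intros [-> | ->].
         + apply loop_upper. destruct HL; lra.
         + apply loop_lower. destruct HR; lra. }
  destruct (arc_family_onto _ _ _ _ _ r0 FL Hr0) as [dL [HdL OL]].
  destruct (arc_family_onto _ _ _ _ _ r0 FR Hr0) as [dR [HdR OR]].
  (* The first two bounds put nearby crossings into the two arc families; the last two keep them
     above [|b|] or below [- |b|], where the direction of crossing is known. *)
  set (delta := Rmin (Rmin dL dR) (Rmin (u - Rabs b) (v - Rabs b))).
  assert (Hdelta : 0 < delta) by (repeat apply Rmin_glb_lt; lra).
  assert (D1 : delta <= dL) by (eapply Rle_trans; apply Rmin_l).
  assert (D2 : delta <= dR) by (eapply Rle_trans; [apply Rmin_l | apply Rmin_r]).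
  assert (D3 : delta <= u - Rabs b) by (eapply Rle_trans; [apply Rmin_r | apply Rmin_l]).
  assert (D4 : delta <= v - Rabs b) by (eapply Rle_trans; apply Rmin_r).
  (* Points off the line are left free; it is enough to confine the crossings. *)
  exists (fun z => fst z <> 0 \/ (Rabs (snd z - u) < delta \/ Rabs (snd z - - v) < delta)).
  split; [|split].
  - apply open_or; [|apply open_or].
    + apply (open_comp (fun z : R * R => fst z) (fun a => a <> 0)).
      * intros z _. apply continuous_fst.
      * apply open_neq.
    + apply (open_comp (fun z : R * R => snd z) (fun a => Rabs (a - u) < delta)).
      * intros z _. apply continuous_snd.
      * apply (open_comp (fun a => Rabs (a - u)) (fun a => a < delta)).
        -- intros a _. apply (continuous_comp (fun a => a - u) Rabs).
           ++ apply @continuous_minus; [apply continuous_id | apply continuous_const].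
           ++ apply continuous_Rabs.
        -- apply open_lt.
    + apply (open_comp (fun z : R * R => snd z) (fun a => Rabs (a - - v) < delta)).
      * intros z _. apply continuous_snd.
      * apply (open_comp (fun a => Rabs (a - - v)) (fun a => a < delta)).
        -- intros a _. apply (continuous_comp (fun a => a - - v) Rabs).
           ++ apply @continuous_minus; [apply continuous_id | apply continuous_const].
           ++ apply continuous_Rabs.
        -- apply open_lt.
  - intros z Hz'. destruct (Req_dec (fst z) 0) as [E | N]; [right | now left].
    destruct (Hsec z Hz' E) as [-> | ->]; [left | right];
      now rewrite Rminus_diag, Rabs_R0.
  - intros G' [x [y [T [HT [H [Hp [[t0 Ht0] HG']]]]]]] HU.
    assert (Hpx : forall s, x (s + T) = x s) by apply Hp.
    assert (Hsides : forall t, x t = 0 ->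
              (Rabs (y t - u) < delta /\ Rabs b < y t) \/
              (Rabs (y t - - v) < delta /\ y t < - Rabs b)).
    { intros t Ht. destruct (HU (x t, y t)) as [N | [A | A]].
      - apply HG'. now exists t.
      - now simpl in N.
      - left. split; [exact A|]. generalize (Rabs_increment_lt _ _ A). simpl. lra.
      - right. split; [exact A|]. generalize (Rabs_increment_lt _ _ A). simpl. lra. }
    assert (Hnot_upper : forall s z, s < z -> x s = 0 ->
              (forall q, s < q < z -> 0 < x q) -> ~ Rabs b < y s).
    { intros s z Hsz Hs Hq A.
      destruct (crossing_upper _ _ _ _ _ _ _ s H Hs A) as [e [He [H1 _]]].
      assert (0 < Rmin e (z - s)) by (apply Rmin_glb_lt; lra).
      generalize (Rmin_l e (z - s)) (Rmin_r e (z - s)). intros.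
      specialize (H1 (s + Rmin e (z - s) / 2)). specialize (Hq (s + Rmin e (z - s) / 2)).
      lra. }
    assert (Hnot_lower : forall s z, s < z -> x s = 0 ->
              (forall q, s < q < z -> x q < 0) -> ~ y s < - Rabs b).
    { intros s z Hsz Hs Hq A.
      destruct (crossing_lower _ _ _ _ _ _ _ s H Hs A) as [e [He [H1 _]]].
      assert (0 < Rmin e (z - s)) by (apply Rmin_glb_lt; lra).
      generalize (Rmin_l e (z - s)) (Rmin_r e (z - s)). intros.
      specialize (H1 (s + Rmin e (z - s) / 2)). specialize (Hq (s + Rmin e (z - s) / 2)).
      lra. }
    (* A passage through [x < 0] can only start at an upper crossing, which lies close to [u]; it is
       therefore an arc of the left family, with some parameter [r]. *)
    assert (GL : forall s z, s < z -> x s = 0 -> x z = 0 ->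
              (forall q, s < q < z -> x q < 0) ->
              Rabs b < y s /\ y z < - Rabs b /\
              exists r, r1 < r < r2 /\ y s = r - KL r - b /\ - y z = r + KL r + b).
    { intros s z Hsz Hs Hz' Hq.
      destruct (Hsides s Hs) as [[A B] | [_ B]]; [|now elim (Hnot_lower s z)].
      destruct (OL (y s + b)) as [r [Hr Er]].
      { replace (y s + b - (r0 - KL r0)) with (y s - u) by (unfold u; ring). lra. }
      destruct (proj1 FL r Hr) as [tau' Hh]. rewrite Er in Hh.
      destruct (left_transit _ _ _ _ _ _ _ s z _ tau' H Hsz Hs Hz' Hq Hh) as [_ [E _]].
      split; [exact B|]. split; [|exists r; repeat split; lra].
      destruct (Hsides z Hz') as [[_ A'] | [_ A']]; [|easy].
      assert (0 < r + KL r) by apply Hh.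
      generalize (Rle_abs (- b)). rewrite Rabs_Ropp. lra. }
    assert (GR : forall s z, s < z -> x s = 0 -> x z = 0 ->
              (forall q, s < q < z -> 0 < x q) ->
              y s < - Rabs b /\ Rabs b < y z /\
              exists r, r1 < r < r2 /\ - y s = r - KR r - b /\ y z = r + KR r + b).
    { intros s z Hsz Hs Hz' Hq.
      destruct (Hsides s Hs) as [[_ B] | [A B]]; [now elim (Hnot_upper s z)|].
      destruct (OR (- y s + b)) as [r [Hr Er]].
      { replace (- y s + b - (r0 - KR r0)) with (- (y s - - v)) by (unfold v; lra).
        rewrite Rabs_Ropp. lra. }
      destruct (proj1 FR r Hr) as [tau' Hh]. rewrite Er in Hh.
      destruct (right_transit _ _ _ _ _ _ _ s z _ tau' H Hsz Hs Hz' Hq Hh) as [_ [E _]].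
      split; [exact B|]. split; [|exists r; repeat split; lra].
      destruct (Hsides z Hz') as [[_ A'] | [_ A']]; [easy|].
      assert (0 < r + KR r) by apply Hh.
      generalize (Rle_abs (- b)). rewrite Rabs_Ropp. lra. }
    assert (Hup : exists t, x t = 0 /\ 0 <= y t).
    { destruct (Hsides t0 Ht0) as [[_ A] | [_ A]].
      - exists t0. split; [easy | lra].
      - destruct (crossing_lower_next _ _ _ _ _ _ _ T t0 H HT Hpx Ht0 A)
          as [z [H1 [H2 H3]]].
        exists z. destruct (GR t0 z) as [_ [B _]]; try easy. split; [easy | lra]. }
    destruct Hup as [t1 [Hx1 Hy1]].
    destruct (max_on_zeros x y T 0 t1 (crossing_solution_continuous _ _ _ H) HT Hp Hx1 Hy1)
      as [tm [Hxm [Hym Hmax]]].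
    assert (Hbm : Rabs b < y tm) by (destruct (Hsides tm Hxm) as [[_ A] | [_ A]]; lra).
    (* Five consecutive crossings are built around the highest one, [tq < tp < tm < ts < tt],
       alternately upper and lower. The four passages between them have the parameters [rq], [rp],
       [rs], [rt]. *)
    destruct (crossing_upper_previous _ _ _ _ _ _ _ T tm H HT Hpx Hxm Hbm)
      as [tp [Hp1 [Hp2 Hp3]]].
    destruct (GR tp tm) as [Hbp [_ [rp [Rp [Ep Ep']]]]]; try easy.
    destruct (crossing_lower_previous _ _ _ _ _ _ _ T tp H HT Hpx Hp2 Hbp)
      as [tq [Hq1 [Hq2 Hq3]]].
    destruct (GL tq tp) as [Hbq [_ [rq [Rq [Eq Eq']]]]]; try easy.
    destruct (crossing_upper_next _ _ _ _ _ _ _ T tm H HT Hpx Hxm Hbm)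
      as [ts [Hs1 [Hs2 Hs3]]].
    destruct (GL tm ts) as [_ [Hbs [rs [Rs [Es Es']]]]]; try easy.
    destruct (crossing_lower_next _ _ _ _ _ _ _ T ts H HT Hpx Hs2 Hbs)
      as [tt [Ht1 [Ht2 Ht3]]].
    destruct (GR ts tt) as [_ [Hbt [rt [Rt [Et Et']]]]]; try easy.
    assert (Mq : y tq <= y tm) by (apply Hmax; [easy | lra]).
    assert (Mt : y tt <= y tm) by (apply Hmax; [easy | lra]).
    assert (IL : forall r r', r1 < r -> r < r' -> r' < r2 ->
                   r - KL r < r' - KL r' /\ r + KL r < r' + KL r').
    { intros r r' A B C. generalize (Rabs_increment_lt _ _ (proj2 FL r r' A B C)). lra. }
    assert (IR : forall r r', r1 < r -> r < r' -> r' < r2 ->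
                   r - KR r < r' - KR r' /\ r + KR r < r' + KR r').
    { intros r r' A B C. generalize (Rabs_increment_lt _ _ (proj2 FR r r' A B C)). lra. }
    (* [tq] is not higher than [tm], and the left map is increasing: the lower crossing at [ts] is
       at least as deep as the one at [tp]. *)
    assert (L1 : rq + KL rq <= rs + KL rs).
    { destruct (Rtotal_order rq rs) as [A | [-> | A]]; [| lra |].
      - apply Rlt_le, IL; lra.
      - generalize (IL rs rq). lra. }
    (* By the depths just compared, the right passage from [ts] starts at least as deep as that from
       [tp], yet it ends at [tt], not higher than [tm]; the right map being increasing, the two
       passages coincide. *)
    assert (L2 : rp = rt).
    { destruct (Rtotal_order rp rt) as [A | [A | A]]; [| easy |].
      - generalize (IR rp rt). lra.
      - generalize (IR rt rp). lra. }
    (* The passages [rs] and [rt] now close up. Adding the equations of their end points gives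
       [rs = rt]; subtracting them gives the zero. *)
    assert (L3 : rs = r0).
    { apply Huniq; [easy|]. assert (rs = rt) by (subst rp; lra). subst rt rp. lra. }
    assert (Hyu : y tm = u) by (rewrite Es, L3; reflexivity).
    intros z. rewrite HG'.
    exact (orbit_through_loop _ _ _ _ _ _ _ _ _ x y T tm HL HR H HT Hp Hxm Hyu z).
Qed.

(** * Explicit half-return maps *)

(* Half arcs with flight time [PI - 2 atan w]: up to a scaling, [c = slope g w],
   [Y = 1 - defect g w] and [V = 1 + defect g w]. *)
Definition flight (w : R) : R := PI - 2 * atan w.

Definition dilation (g w : R) : R :=
  1 + (cosh (g * flight w) - 1) * (1 + w ^ 2) / 2.

Definition slope (g w : R) : R := w / dilation g w.

Definition defect (g w : R) : R :=
  sinh (g * flight w) * (1 + w ^ 2) / (2 * dilation g w) - g * slope g w.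

Lemma cosh_ge_1 x : 1 <= cosh x.
Proof.
  unfold cosh. generalize (exp_ineq1_le x) (exp_ineq1_le (- x)). lra.
Qed.

Lemma dilation_ge_1 g w : 1 <= dilation g w.
Proof. unfold dilation. generalize (cosh_ge_1 (g * flight w)). nra. Qed.

Lemma flight_range w : 0 < flight w < 2 * PI.
Proof. unfold flight. generalize (atan_bound w). lra. Qed.

Lemma cos_atan_pos w : 0 < cos (atan w).
Proof. generalize (atan_bound w). intros. apply cos_gt_0; lra. Qed.

Lemma sin_atan_eq w : sin (atan w) = w * cos (atan w).
Proof.
  rewrite <- (tan_atan w) at 2. unfold tan. field.
  apply Rgt_not_eq, cos_atan_pos.
Qed.

Lemma cos_atan_sqr w : cos (atan w) ^ 2 = / (1 + w ^ 2).
Proof.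
  generalize (sin2_cos2 (atan w)). unfold Rsqr. rewrite sin_atan_eq. intros H.
  apply Rmult_eq_reg_l with (1 + w ^ 2); [|nra]. rewrite Rinv_r by nra. nra.
Qed.

Lemma sin_flight w : sin (flight w) = 2 * w / (1 + w ^ 2).
Proof.
  unfold flight. rewrite sin_minus, sin_PI, cos_PI, sin_2a.
  rewrite sin_atan_eq. unfold Rdiv. rewrite <- cos_atan_sqr. ring.
Qed.

Lemma cos_flight w : cos (flight w) = (w ^ 2 - 1) / (1 + w ^ 2).
Proof.
  unfold flight. rewrite cos_minus, sin_PI, cos_PI, cos_2a_cos.
  replace (cos (atan w) * cos (atan w)) with (cos (atan w) ^ 2) by ring.
  replace (2 * cos (atan w) * cos (atan w)) with (2 * cos (atan w) ^ 2) by ring.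
  rewrite cos_atan_sqr. field. nra.
Qed.

(** For a given flight time the end conditions are two homogeneous linear equations in [(c, Y, V)],
    and [dilation] normalizes [Y + V]. As [w] is the cotangent of half the flight time, its sine and
    cosine are rational in [w], so everything reduces to an identity between rational functions of
    [w] and [p]. *)
Lemma half_arc_param g w r :
  0 < r -> Rabs (defect g w) < 1 ->
  half_arc g (r * slope g w) (r * (1 - defect g w)) (r * (1 + defect g w)) (flight w).
Proof.
  intros Hr Hk.
  assert (Hk' := Rabs_increment_lt _ _ Hk).
  assert (HD := dilation_ge_1 g w).
  set (a := g * flight w).
  assert (Ha : exp a * exp (- a) = 1)
    by (rewrite <- exp_plus, Rplus_opp_r; apply exp_0).
  assert (ED : dilation g w = 1 + ((exp a + exp (- a)) / 2 - 1) * (1 + w ^ 2) / 2)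
    by reflexivity.
  assert (Ek : defect g w = (exp a - exp (- a)) / 2 * (1 + w ^ 2) / (2 * dilation g w)
                 - g * (w / dilation g w)) by reflexivity.
  set (D := dilation g w) in *.
  assert (Hw : 0 < 1 + w ^ 2) by nra.
  assert (Hp : 0 < exp a) by apply exp_pos.
  rewrite exp_Ropp in *. set (p := exp a) in *.
  assert (Hside : 1 + w ^ 2 <> 0 /\ p <> 0 /\
            p * 2 * 2 + (p * p + 1 - p * 2) * (1 + w ^ 2) <> 0).
  { repeat split; try lra.
    apply Rgt_not_eq. assert (0 <= (p - 1) ^ 2) by apply pow2_ge_0. nra. }
  assert (Hx : arc_x g (r * slope g w) (r * (1 - defect g w)) (flight w) = 0).
  { unfold arc_x. fold a. fold p. rewrite sin_flight, cos_flight, Ek.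
    unfold slope. fold D. rewrite ED. field. tauto. }
  split; [apply flight_range|]. split; [nra|]. split; [nra|]. split; [exact Hx|].
  unfold arc_y. rewrite Hx. fold a. fold p. rewrite sin_flight, cos_flight, Ek.
  unfold slope. fold D. rewrite ED. field. tauto.
Qed.

(** * The center at infinity of the unperturbed system *)

Lemma defect_0 w : defect 0 w = 0.
Proof. unfold defect. rewrite !Rmult_0_l, sinh_0. unfold Rdiv. ring. Qed.

Lemma slope_0 w : slope 0 w = w.
Proof. unfold slope, dilation. rewrite Rmult_0_l, cosh_0. field. Qed.

Lemma half_arc_center c u : 0 < u -> half_arc 0 c u u (flight (c / u)).
Proof.
  intros Hu. generalize (half_arc_param 0 (c / u) u Hu).
  rewrite defect_0, slope_0, Rabs_R0.
  replace (u * (c / u)) with c by (field; lra).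
  rewrite Rminus_0_r, Rplus_0_r, Rmult_1_r. intros H. apply H. lra.
Qed.

Lemma exists_angle a b :
  a ^ 2 + b ^ 2 = 1 -> exists t, 0 <= t < 2 * PI /\ a = cos t /\ b = sin t.
Proof.
  intros H. assert (Ha : -1 <= a <= 1) by nra.
  assert (HP := PI_RGT_0).
  assert (Hb : sqrt (1 - a ^ 2) = Rabs b).
  { replace (1 - a ^ 2) with (Rsqr b) by (unfold Rsqr; lra). apply sqrt_Rsqr_abs. }
  generalize (acos_bound a). intros Hac.
  destruct (Rle_or_lt 0 b) as [B | B].
  - exists (acos a). split; [lra|]. rewrite cos_acos, sin_acos by easy.
    unfold Rsqr. replace (a * a) with (a ^ 2) by ring.
    rewrite Hb, Rabs_pos_eq; easy.
  - exists (2 * PI - acos a).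
    assert (0 < acos a).
    { destruct (Req_dec (acos a) 0) as [E | E]; [|lra].
      assert (a = 1) by (rewrite <- (cos_acos a), E; [apply cos_0 | easy]).
      subst a. nra. }
    split; [lra|].
    rewrite cos_minus, sin_minus, cos_2PI, sin_2PI, cos_acos, sin_acos by easy.
    unfold Rsqr. replace (a * a) with (a ^ 2) by ring.
    rewrite Hb, Rabs_left by easy. split; ring.
Qed.

(** With [w = c / u], half-angle formulas factor [x] as [2 u sin (t / 2) (w sin (t / 2) - cos (t /
    2))]. The last factor has the sign of [- cos (atan w + t / 2)], and after the flight time that
    angle has passed [PI / 2]. *)
Lemma center_arc_pos c u t :
  0 < u -> flight (c / u) < t < 2 * PI -> 0 < arc_x 0 c u t.
Proof.
  intros Hu Ht. set (w := c / u) in *.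
  assert (Hc : 0 < cos (atan w)) by apply cos_atan_pos.
  unfold flight in Ht. generalize (atan_bound w). intros Hb.
  unfold arc_x. rewrite !Rmult_0_l, exp_0.
  replace c with (u * w) by (unfold w; field; lra).
  replace t with (2 * (t / 2)) by field. set (h := t / 2) in *.
  assert (Hs : 0 < sin h) by (apply sin_gt_0; unfold h; lra).
  assert (Hcos : cos (atan w + h) < 0)
    by (apply cos_lt_0; unfold h; lra).
  rewrite cos_plus, sin_atan_eq in Hcos.
  rewrite sin_2a, cos_2a_sin.
  assert (Hw : cos h - w * sin h < 0) by nra.
  match goal with |- 0 < ?e => replace e with (2 * u * sin h * (w * sin h - cos h)) end.
  - repeat apply Rmult_lt_0_compat; lra.
  - ring.
Qed.

(** For [g = 0] the arcs lie on circles about [(c, 0)]. An angle in [[0, 2 PI)] exists for every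
    point of the circle, and [center_arc_pos] bounds it by the flight time because [px <= 0]. *)
Lemma center_arc_covers c u px py :
  0 < u -> px <= 0 -> (px - c) ^ 2 + py ^ 2 = u ^ 2 + c ^ 2 ->
  exists t, 0 <= t <= flight (c / u) /\ px = arc_x 0 c u t /\ py = arc_y 0 c u t.
Proof.
  intros Hu Hpx H. assert (HN : 0 < u ^ 2 + c ^ 2) by nra.
  destruct (exists_angle ((u * py - c * (px - c)) / (u ^ 2 + c ^ 2))
              ((- u * (px - c) - c * py) / (u ^ 2 + c ^ 2))) as [t [Ht [E1 E2]]].
  { transitivity (((px - c) ^ 2 + py ^ 2) / (u ^ 2 + c ^ 2)).
    - field. lra.
    - rewrite H. field. lra. }
  assert (Ex : px = arc_x 0 c u t).
  { unfold arc_x. rewrite !Rmult_0_l, exp_0, <- E1, <- E2. field. lra. }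
  assert (Ey : py = arc_y 0 c u t).
  { unfold arc_y. rewrite !Rmult_0_r, !Rmult_0_l, exp_0, <- E1, <- E2. field. lra. }
  exists t. repeat split; try easy.
  destruct (Rle_or_lt t (flight (c / u))) as [A | A]; [easy|].
  generalize (center_arc_pos c u t Hu). lra.
Qed.

(** The circle about [(c, 0)] through the point meets the line at ordinates [u] and [- u] with
    [u ^ 2 = px ^ 2 - 2 c px + py ^ 2]. The radius assumed makes this positive for [c = eta] and
    [c = xi], and the two circular arcs over the same [u] close up. *)
Lemma center_crossing_periodic_orbit eta xi px py :
  2 * (Rabs eta + Rabs xi) < sqrt (px ^ 2 + py ^ 2) ->
  exists G, crossing_periodic_orbit (0, 0, 0, eta, xi) G /\ G (px, py).
Proof.
  intros H.
  assert (Hc : forall c, Rabs c <= Rabs eta + Rabs xi ->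
    exists u, 0 < u /\ (px - c) ^ 2 + py ^ 2 = u ^ 2 + c ^ 2).
  { intros c Hc. set (rho := sqrt (px ^ 2 + py ^ 2)) in *.
    assert (Hrho : rho ^ 2 = px ^ 2 + py ^ 2) by (apply pow2_sqrt; nra).
    assert (Hpos : 0 < px ^ 2 - 2 * c * px + py ^ 2).
    { assert (Hle : Rabs px <= rho).
      { apply Rsqr_incr_0_var; [|apply sqrt_pos]. fold rho. unfold Rsqr.
        replace (Rabs px * Rabs px) with (px * px)
          by (rewrite <- Rabs_mult, Rabs_pos_eq; [easy | nra]).
        nra. }
      assert (0 <= Rabs c) by apply Rabs_pos.
      assert (0 <= Rabs px) by apply Rabs_pos.
      assert (c * px <= Rabs c * Rabs px) by (rewrite <- Rabs_mult; apply Rle_abs).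
      nra. }
    exists (sqrt (px ^ 2 - 2 * c * px + py ^ 2)).
    split; [now apply sqrt_lt_R0|]. rewrite pow2_sqrt by lra. ring. }
  generalize (Rabs_pos eta) (Rabs_pos xi). intros He Hx.
  assert (Hloop : forall u, 0 < u -> crossing_periodic_orbit (0, 0, 0, eta, xi)
    (loop 0 0 0 eta xi u u (flight (eta / u)) (flight (- xi / u)))).
  { intros u Hu. apply loop_crossing_periodic_orbit;
      rewrite Rplus_0_r, Rminus_0_r; now apply half_arc_center. }
  destruct (Rle_or_lt px 0) as [B | B].
  - destruct (Hc eta) as [u [Hu E]]; [lra|].
    destruct (center_arc_covers eta u px py Hu B E) as [t [Ht [-> ->]]].
    exists (loop 0 0 0 eta xi u u (flight (eta / u)) (flight (- xi / u))).
    split; [now apply Hloop|]. left. exists t. split; [easy|].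
    now rewrite Rplus_0_r, Rminus_0_r.
  - destruct (Hc xi) as [u [Hu E]]; [lra|].
    destruct (center_arc_covers (- xi) u (- px) (- py) Hu) as [t [Ht [E1 E2]]];
      [lra | rewrite <- (Rplus_0_r (_ + _)); nra |].
    exists (loop 0 0 0 eta xi u u (flight (eta / u)) (flight (- xi / u))).
    split; [now apply Hloop|]. right. exists t. split; [easy|].
    rewrite Rplus_0_r, Rminus_0_r, <- E1, <- E2. f_equal; ring.
Qed.

(** * Elementary bounds for [sinh], [cosh] and [atan] *)

Lemma MVT_Rabs_le (f df : R -> R) (a b M : R) :
  (forall t, Rmin a b <= t <= Rmax a b -> is_derive f t (df t)) ->
  (forall t, Rmin a b <= t <= Rmax a b -> Rabs (df t) <= M) ->
  Rabs (f b - f a) <= M * Rabs (b - a).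
Proof.
  intros Hd Hb.
  destruct (MVT_gen f a b df) as [t [Ht E]].
  - intros t Ht. apply Hd. lra.
  - intros t Ht. apply continuity_pt_filterlim.
    apply (is_derive_continuous f t (df t)). now apply Hd.
  - rewrite E, Rabs_mult. apply Rmult_le_compat_r; [apply Rabs_pos|]. now apply Hb.
Qed.

Lemma Rmin_Rmax_0 a t : Rmin 0 a <= t <= Rmax 0 a -> Rabs t <= Rabs a.
Proof.
  unfold Rmin, Rmax. destruct (Rle_dec 0 a); intros.
  - rewrite !Rabs_pos_eq; lra.
  - rewrite (Rabs_left1 t), (Rabs_left a); lra.
Qed.

Lemma is_derive_sinh x : is_derive sinh x (cosh x).
Proof. apply is_derive_Reals, derivable_pt_lim_sinh. Qed.

Lemma is_derive_cosh x : is_derive cosh x (sinh x).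
Proof. apply is_derive_Reals, derivable_pt_lim_cosh. Qed.

Lemma cosh_le_3 a : Rabs a <= 1 -> cosh a <= 3.
Proof.
  intros H. assert (H' := Rabs_le_between a 1). apply H' in H.
  unfold cosh.
  assert (E : forall x, x <= 1 -> exp x <= 3).
  { intros x Hx. apply Rle_trans with (exp 1); [|apply exp_le_3].
    destruct Hx as [Hx | ->]; [left; now apply exp_increasing | lra]. }
  generalize (E a) (E (- a)). lra.
Qed.

Lemma sinh_bound a : Rabs a <= 1 -> Rabs (sinh a) <= 3 * Rabs a.
Proof.
  intros H. generalize (MVT_Rabs_le sinh cosh 0 a 3).
  rewrite sinh_0, !Rminus_0_r. intros G. apply G.
  - intros; apply is_derive_sinh.
  - intros t Ht. apply Rmin_Rmax_0 in Ht. rewrite Rabs_pos_eq.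
    + apply cosh_le_3. lra.
    + generalize (cosh_ge_1 t). lra.
Qed.

Lemma cosh_bound a : Rabs a <= 1 -> cosh a - 1 <= 3 * a ^ 2.
Proof.
  intros H. generalize (MVT_Rabs_le cosh sinh 0 a (3 * Rabs a)).
  rewrite cosh_0, Rminus_0_r. intros G.
  apply Rle_trans with (1 := Rle_abs _).
  rewrite <- (pow2_abs a).
  apply Rle_trans with (3 * Rabs a * Rabs a); [|lra]. apply G.
  - intros; apply is_derive_cosh.
  - intros t Ht. apply Rmin_Rmax_0 in Ht.
    apply Rle_trans with (1 := sinh_bound t ltac:(lra)). lra.
Qed.

Lemma sinh_bound_3 a : Rabs a <= 1 -> Rabs (sinh a - a) <= 3 * Rabs a ^ 3.
Proof.
  intros H. generalize (MVT_Rabs_le (fun t => sinh t - t) (fun t => cosh t - 1)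
                          0 a (3 * Rabs a ^ 2)).
  rewrite sinh_0, !Rminus_0_r. intros G.
  apply Rle_trans with (3 * Rabs a ^ 2 * Rabs a); [|lra]. apply G.
  - intros t _. apply @is_derive_minus; [apply is_derive_sinh | apply @is_derive_id].
  - intros t Ht. apply Rmin_Rmax_0 in Ht.
    rewrite Rabs_pos_eq by (generalize (cosh_ge_1 t); lra).
    apply Rle_trans with (1 := cosh_bound t ltac:(lra)).
    rewrite <- (pow2_abs t).
    apply Rmult_le_compat_l; [lra|]. apply pow_incr. split; [apply Rabs_pos | easy].
Qed.

Lemma atan_bound_3 w : Rabs (w - atan w) <= Rabs w ^ 3.
Proof.
  generalize (MVT_Rabs_le (fun t => t - atan t) (fun t => 1 - / (1 + t ^ 2))
                0 w (Rabs w ^ 2)).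
  rewrite atan_0, !Rminus_0_r. intros G.
  apply Rle_trans with (Rabs w ^ 2 * Rabs w); [|lra]. apply G.
  - intros t _. apply @is_derive_minus; [apply @is_derive_id|].
    evar_last; [apply is_derive_atan|]. unfold Rsqr. f_equal. ring.
  - intros t Ht. apply Rmin_Rmax_0 in Ht.
    assert (E : 1 - / (1 + t ^ 2) = t ^ 2 / (1 + t ^ 2)) by (field; nra).
    rewrite E. assert (0 <= t ^ 2) by apply pow2_ge_0.
    assert (t ^ 2 / (1 + t ^ 2) <= t ^ 2).
    { apply Rmult_le_reg_r with (1 + t ^ 2); [lra|]. unfold Rdiv.
      rewrite Rmult_assoc, Rinv_l by lra. nra. }
    rewrite Rabs_pos_eq.
    + apply Rle_trans with (t ^ 2); [easy|]. rewrite <- (pow2_abs t).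
      apply pow_incr. split; [apply Rabs_pos | easy].
    + apply Rdiv_le_0_compat; lra.
Qed.

(* Third order Taylor polynomial of [(1 + z^2) (PI / 2 - atan z) - z], the limit of
   [defect g w / g] as [g] tends to [0], where [z = slope g w]. *)
Definition taylor (z : R) : R := PI / 2 - 2 * z + PI / 2 * z ^ 2 - 2 / 3 * z ^ 3.

Definition Dslope (g w : R) : R :=
  (dilation g w - w * (- g * sinh (g * flight w) + (cosh (g * flight w) - 1) * w))
  / dilation g w ^ 2.

Definition Ddefect (g w : R) : R :=
  (- g * cosh (g * flight w) + w * sinh (g * flight w)) / dilation g w
  - sinh (g * flight w) * (1 + w ^ 2) / (2 * dilation g w ^ 2)
    * (- g * sinh (g * flight w) + (cosh (g * flight w) - 1) * w)
  - g * Dslope g w.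

(** * Derivatives along the flight-time parametrization *)

Lemma is_derive_flight w : is_derive flight w (- 2 / (1 + w ^ 2)).
Proof.
  unfold flight. evar_last.
  - apply @is_derive_minus; [apply @is_derive_const|].
    apply is_derive_scal. apply is_derive_atan.
  - unfold minus, plus, opp, zero, Rsqr; simpl. field. nra.
Qed.

Lemma is_derive_sinh_flight g w :
  is_derive (fun w => sinh (g * flight w)) w
    (- 2 * g * cosh (g * flight w) / (1 + w ^ 2)).
Proof.
  evar_last.
  - apply (is_derive_comp sinh (fun w => g * flight w)).
    + apply is_derive_sinh.
    + apply is_derive_scal, is_derive_flight.
  - unfold scal; simpl; unfold mult; simpl. field. nra.
Qed.

Lemma is_derive_cosh_flight g w :
  is_derive (fun w => cosh (g * flight w)) w
    (- 2 * g * sinh (g * flight w) / (1 + w ^ 2)).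
Proof.
  evar_last.
  - apply (is_derive_comp cosh (fun w => g * flight w)).
    + apply is_derive_cosh.
    + apply is_derive_scal, is_derive_flight.
  - unfold scal; simpl; unfold mult; simpl. field. nra.
Qed.

Lemma is_derive_dilation g w :
  is_derive (dilation g) w
    (- g * sinh (g * flight w) + (cosh (g * flight w) - 1) * w).
Proof.
  unfold dilation. generalize (is_derive_cosh_flight g w). intros H.
  set (C := fun w => cosh (g * flight w)) in *.
  apply (is_derive_ext (fun w => 1 + (C w - 1) * (1 + w ^ 2) / 2)); [easy|].
  auto_derive; [repeat split; eexists; exact H|].
  replace (Derive (fun x => C x) w) with (- 2 * g * sinh (g * flight w) / (1 + w ^ 2))
    by (symmetry; now apply is_derive_unique).
  unfold C. field. nra.
Qed.

Lemma is_derive_slope g w : is_derive (slope g) w (Dslope g w).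
Proof.
  unfold slope. generalize (is_derive_dilation g w) (dilation_ge_1 g w). intros H HD.
  auto_derive; [repeat split; [eexists; exact H | lra]|].
  replace (Derive (fun x => dilation g x) w)
    with (- g * sinh (g * flight w) + (cosh (g * flight w) - 1) * w)
    by (symmetry; now apply is_derive_unique).
  unfold Dslope. field. lra.
Qed.

Lemma is_derive_defect g w : is_derive (defect g) w (Ddefect g w).
Proof.
  unfold defect, Ddefect.
  generalize (is_derive_dilation g w) (is_derive_sinh_flight g w)
    (is_derive_slope g w) (dilation_ge_1 g w). intros H HS Hs HD.
  set (S := fun w => sinh (g * flight w)) in *.
  apply (is_derive_ext
    (fun w => S w * (1 + w ^ 2) / (2 * dilation g w) - g * slope g w)); [easy|].
  auto_derive; [repeat split; try (eexists; eassumption); lra|].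
  replace (Derive (fun x => dilation g x) w)
    with (- g * sinh (g * flight w) + (cosh (g * flight w) - 1) * w)
    by (symmetry; now apply is_derive_unique).
  replace (Derive (fun x => S x) w)
    with (- 2 * g * cosh (g * flight w) / (1 + w ^ 2))
    by (symmetry; now apply is_derive_unique).
  replace (Derive (fun x => slope g x) w) with (Dslope g w)
    by (symmetry; now apply is_derive_unique).
  unfold S. field. split; [lra | nra].
Qed.

Lemma Rabs_triang_4 a b c d A B C D :
  Rabs a <= A -> Rabs b <= B -> Rabs c <= C -> Rabs d <= D ->
  Rabs (a + b + c + d) <= A + B + C + D.
Proof.
  intros. repeat (eapply Rle_trans; [apply Rabs_triang|];
    apply Rplus_le_compat); easy.
Qed.

Lemma Rabs_mult_le a b A B :
  Rabs a <= A -> Rabs b <= B -> Rabs (a * b) <= A * B.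
Proof.
  intros. rewrite Rabs_mult. apply Rmult_le_compat; easy || apply Rabs_pos.
Qed.

(** * Crude explicit estimates, uniform for small [g] and [w] *)

Section Bounds.

Context (g w : R) (Hg : Rabs g <= / 100) (Hw : Rabs w <= / 2).

Let a := g * flight w.
Let D := dilation g w.

Lemma PI_le_4 : 0 < PI <= 4.
Proof. generalize PI_4 PI_RGT_0. lra. Qed.

Lemma Rabs_flight_le : Rabs (flight w) <= 8.
Proof.
  generalize (flight_range w) PI_le_4. intros. apply Rabs_le. lra.
Qed.

Lemma Rabs_angle_le : Rabs a <= 8 * Rabs g.
Proof.
  unfold a. rewrite Rmult_comm. apply Rabs_mult_le; [apply Rabs_flight_le | lra].
Qed.

Lemma sqr_le_small : 0 <= g ^ 2 <= / 10000.
Proof. rewrite <- pow2_abs. generalize (Rabs_pos g). nra. Qed.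

Lemma sinh_angle_le : Rabs (sinh a) <= 24 * Rabs g.
Proof.
  generalize Rabs_angle_le (sinh_bound a). lra.
Qed.

Lemma sinh_angle_minus_le : Rabs (sinh a - a) <= 1536 * Rabs g ^ 3.
Proof.
  assert (H : Rabs a ^ 3 <= (8 * Rabs g) ^ 3).
  { apply pow_incr. split; [apply Rabs_pos | apply Rabs_angle_le]. }
  generalize Rabs_angle_le (sinh_bound_3 a). lra.
Qed.

Lemma cosh_angle_le : 0 <= cosh a - 1 <= 192 * g ^ 2.
Proof.
  assert (H : Rabs a ^ 2 <= (8 * Rabs g) ^ 2).
  { apply pow_incr. split; [apply Rabs_pos | apply Rabs_angle_le]. }
  generalize Rabs_angle_le (cosh_bound a) (cosh_ge_1 a) (pow2_abs a) (pow2_abs g). lra.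
Qed.

Lemma sqr_w_le : 0 <= w ^ 2 <= / 4.
Proof. rewrite <- pow2_abs. generalize (Rabs_pos w). nra. Qed.

Lemma dilation_le : 1 <= D <= 1 + 120 * g ^ 2.
Proof.
  split; [apply dilation_ge_1|]. unfold D, dilation. fold a.
  generalize cosh_angle_le sqr_w_le. nra.
Qed.

Lemma Ddilation_le : Rabs (- g * sinh a + (cosh a - 1) * w) <= 120 * g ^ 2.
Proof.
  eapply Rle_trans; [apply Rabs_triang|].
  assert (H1 : Rabs (- g * sinh a) <= Rabs g * (24 * Rabs g)).
  { apply Rabs_mult_le; [now rewrite Rabs_Ropp; right | apply sinh_angle_le]. }
  assert (H2 : Rabs ((cosh a - 1) * w) <= 192 * g ^ 2 * / 2).
  { apply Rabs_mult_le; [|easy]. generalize cosh_angle_le. intros.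
    rewrite Rabs_pos_eq; lra. }
  generalize (pow2_abs g). lra.
Qed.

Lemma Dslope_near_1 : Rabs (Dslope g w - 1) <= 180 * g ^ 2.
Proof.
  unfold Dslope. fold a. fold D. generalize dilation_le Ddilation_le.
  set (e := - g * sinh a + (cosh a - 1) * w). intros HD He.
  replace ((D - w * e) / D ^ 2 - 1) with (- ((D - 1) * / D + w * e * / D ^ 2))
    by (field; lra).
  rewrite Rabs_Ropp. eapply Rle_trans; [apply Rabs_triang|].
  assert (Hi : Rabs (/ D) <= 1).
  { rewrite Rabs_pos_eq by (left; apply Rinv_0_lt_compat; lra).
    rewrite <- Rinv_1. apply Rinv_le_contravar; lra. }
  assert (Hi2 : Rabs (/ D ^ 2) <= 1).
  { rewrite <- pow_inv. replace (/ D ^ 2) with (/ D * / D) by (field; lra).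
    replace ((/ D) ^ 2) with (/ D * / D) by ring.
    replace 1 with (1 * 1) by ring. now apply Rabs_mult_le. }
  assert (H1 : Rabs ((D - 1) * / D) <= 120 * g ^ 2 * 1).
  { apply Rabs_mult_le; [rewrite Rabs_pos_eq; lra | easy]. }
  assert (H2 : Rabs (w * e * / D ^ 2) <= / 2 * (120 * g ^ 2) * 1).
  { apply Rabs_mult_le; [now apply Rabs_mult_le | easy]. }
  lra.
Qed.

Lemma slope_near : Rabs (slope g w - w) <= 60 * g ^ 2.
Proof.
  unfold slope. fold D. generalize dilation_le. intros HD.
  replace (w / D - w) with (- (w * ((D - 1) * / D))) by (field; lra).
  rewrite Rabs_Ropp.
  replace (60 * g ^ 2) with (/ 2 * (120 * g ^ 2 * 1)) by field.
  apply Rabs_mult_le; [easy|]. apply Rabs_mult_le.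
  - rewrite Rabs_pos_eq; lra.
  - rewrite Rabs_pos_eq by (left; apply Rinv_0_lt_compat; lra).
    rewrite <- Rinv_1. apply Rinv_le_contravar; lra.
Qed.

Lemma defect_le : Rabs (defect g w) <= 16 * Rabs g.
Proof.
  unfold defect. fold a. fold D. generalize dilation_le sqr_w_le. intros HD HW.
  assert (Hi : Rabs (/ (2 * D)) <= / 2).
  { rewrite Rabs_pos_eq by (left; apply Rinv_0_lt_compat; lra).
    apply Rinv_le_contravar; lra. }
  assert (H1 : Rabs (sinh a * (1 + w ^ 2) * / (2 * D)) <= 24 * Rabs g * (5 / 4) * / 2).
  { apply Rabs_mult_le; [apply Rabs_mult_le|]; [apply sinh_angle_le | | exact Hi].
    rewrite Rabs_pos_eq; lra. }
  assert (Hs : Rabs (slope g w) <= 1).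
  { generalize slope_near sqr_le_small (Rabs_triang (slope g w - w) w).
    replace (slope g w - w + w) with (slope g w) by ring. lra. }
  assert (H2 : Rabs (- g * slope g w) <= Rabs g * 1).
  { apply Rabs_mult_le; [rewrite Rabs_Ropp; lra | easy]. }
  generalize (Rabs_triang (sinh a * (1 + w ^ 2) * / (2 * D)) (- g * slope g w)).
  unfold Rdiv. unfold Rminus. rewrite <- Ropp_mult_distr_l in *.
  generalize (Rabs_pos g). lra.
Qed.

(** The derivative of [(1 + w^2) (PI / 2 - atan w) - w] is [- 2 + PI w - 2 w atan w]. Replacing
    [atan w] by [w] costs the term in [|w| ^ 3], and every dependence on [g] beyond first order
    costs a multiple of [|g| ^ 3]. *)
Lemma Ddefect_near :
  Rabs (Ddefect g w - g * (- 2 + PI * slope g w - 2 * slope g w ^ 2) * Dslope g w)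
    <= 10000 * Rabs g * (Rabs w ^ 3 + g ^ 2).
Proof.
  generalize dilation_le sqr_w_le PI_le_4 sqr_le_small Rabs_flight_le (Rabs_pos g)
    cosh_angle_le sinh_angle_le sinh_angle_minus_le slope_near Dslope_near_1
    Ddilation_le (atan_bound_3 w) (pow2_abs g).
  intros HD HW Hpi Hg2 Hf Hg0 HC HS HSm Hs HDs He Hat Hgg.
  unfold Ddefect. fold a. fold D.
  set (e := - g * sinh a + (cosh a - 1) * w) in *.
  set (z := slope g w) in *. set (s := Dslope g w) in *.
  assert (Hi : Rabs (/ D) <= 1).
  { rewrite Rabs_pos_eq by (left; apply Rinv_0_lt_compat; lra).
    rewrite <- Rinv_1. apply Rinv_le_contravar; lra. }
  (* The error splits by origin: linearizing the hyperbolic functions and [D] ([T1]), the derivative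
     of the dilation ([T2]), [slope] against the identity ([T3]), and [atan] against the identity
     ([T4]). *)
  set (T1 := (- g * (cosh a - 1) + w * (sinh a - a)
              + g * (1 - w * flight w) * (D - 1)) * / D).
  set (T2 := - (sinh a * (1 + w ^ 2) * / 2 * e * (/ D * / D))).
  set (T3 := - (g * ((s - 1) * (- 1 + PI * z - 2 * z ^ 2)
                + (z - w) * (PI - 2 * (z + w))))).
  set (T4 := 2 * g * w * (w - atan w)).
  assert (E : (- g * cosh a + w * sinh a) / D
              - sinh a * (1 + w ^ 2) / (2 * D ^ 2) * e - g * s
              - g * (- 2 + PI * z - 2 * z ^ 2) * s = T1 + T2 + T3 + T4).
  { assert (Ea : a = g * (PI - 2 * atan w)) by reflexivity.
    assert (Ef : flight w = PI - 2 * atan w) by reflexivity.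
    unfold T1, T2, T3, T4. generalize (sinh a) (cosh a). intros S C.
    rewrite Ea, Ef. field. lra. }
  rewrite E.
  assert (Hz : Rabs z <= 1).
  { generalize (Rabs_triang (z - w) w). replace (z - w + w) with z by ring. lra. }
  apply Rabs_le_between in Hz. assert (Hw' := Hw). apply Rabs_le_between in Hw'.
  assert (B1 : Rabs T1 <= 10 * Rabs g * (192 * g ^ 2)).
  { unfold T1.
    assert (X1 : Rabs (- g * (cosh a - 1)) <= Rabs g * (192 * g ^ 2)).
    { apply Rabs_mult_le; [rewrite Rabs_Ropp; lra | rewrite Rabs_pos_eq; lra]. }
    assert (X2 : Rabs (w * (sinh a - a)) <= / 2 * (1536 * Rabs g ^ 3))
      by now apply Rabs_mult_le.
    assert (X3 : Rabs (g * (1 - w * flight w) * (D - 1)) <= Rabs g * 5 * (120 * g ^ 2)).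
    { apply Rabs_mult_le; [apply Rabs_mult_le; [lra|] | rewrite Rabs_pos_eq; lra].
      assert (Rabs (w * flight w) <= / 2 * 8) by now apply Rabs_mult_le.
      apply Rabs_le_between in H. apply Rabs_le. lra. }
    replace (10 * Rabs g * (192 * g ^ 2)) with (1920 * (Rabs g * Rabs g ^ 2) * 1)
      by (rewrite Hgg; ring).
    apply Rabs_mult_le; [|easy].
    eapply Rle_trans; [apply Rabs_triang|].
    eapply Rle_trans; [apply Rplus_le_compat_r, Rabs_triang|].
    assert (0 <= Rabs g * g ^ 2) by (apply Rmult_le_pos; lra).
    replace (Rabs g ^ 3) with (Rabs g * g ^ 2) in X2 by (rewrite <- Hgg; ring).
    rewrite Hgg. lra. }
  assert (B2 : Rabs T2 <= 24 * Rabs g * (5 / 4) * / 2 * (120 * g ^ 2) * (1 * 1)).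
  { unfold T2. rewrite Rabs_Ropp.
    apply Rabs_mult_le; [apply Rabs_mult_le; [apply Rabs_mult_le;
      [apply Rabs_mult_le|]|] | apply Rabs_mult_le]; try easy;
      rewrite Rabs_pos_eq; lra. }
  assert (B3 : Rabs T3 <= Rabs g * (180 * g ^ 2 * 7 + 60 * g ^ 2 * 8)).
  { unfold T3. rewrite Rabs_Ropp. apply Rabs_mult_le; [lra|].
    eapply Rle_trans; [apply Rabs_triang|]. apply Rplus_le_compat.
    - apply Rabs_mult_le; [easy|]. apply Rabs_le. nra.
    - apply Rabs_mult_le; [easy|]. apply Rabs_le. lra. }
  assert (B4 : Rabs T4 <= 2 * Rabs g * / 2 * Rabs w ^ 3).
  { unfold T4. apply Rabs_mult_le; [apply Rabs_mult_le; [apply Rabs_mult_le|]|];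
      try easy; try lra.
    rewrite Rabs_pos_eq; lra. }
  generalize (Rabs_triang_4 T1 T2 T3 T4 _ _ _ _ B1 B2 B3 B4).
  assert (0 <= Rabs g * g ^ 2) by (apply Rmult_le_pos; lra).
  assert (0 <= Rabs g * Rabs w ^ 3)
    by (apply Rmult_le_pos; [lra | apply pow_le, Rabs_pos]).
  lra.
Qed.

End Bounds.

(** * The half-return map as a function of the slope *)

Lemma Rmin_Rmax_between a b t M :
  Rabs a <= M -> Rabs b <= M -> Rmin a b <= t <= Rmax a b -> Rabs t <= M.
Proof.
  intros Ha Hb Ht. apply Rabs_le_between in Ha. apply Rabs_le_between in Hb.
  apply Rabs_le. unfold Rmin, Rmax in Ht. destruct (Rle_dec a b); lra.
Qed.

(** [slope g] differs from the identity by a contraction of factor at most [1 / 2], so its inverse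
    is 2-Lipschitz. *)
Lemma slope_expanding g w1 w2 :
  Rabs g <= / 100 -> Rabs w1 <= / 2 -> Rabs w2 <= / 2 ->
  Rabs (w2 - w1) <= 2 * Rabs (slope g w2 - slope g w1).
Proof.
  intros Hg H1 H2.
  generalize (MVT_Rabs_le (fun w => slope g w - w) (fun w => Dslope g w - 1)
                w1 w2 (/ 2)). intros M.
  assert (H : Rabs (slope g w2 - w2 - (slope g w1 - w1)) <= / 2 * Rabs (w2 - w1)).
  { apply M.
    - intros t _. apply @is_derive_minus; [apply is_derive_slope | apply @is_derive_id].
    - intros t Ht. assert (Rabs t <= / 2) by now apply (Rmin_Rmax_between w1 w2).
      generalize (Dslope_near_1 g t Hg H) (sqr_le_small g Hg). lra. }
  generalize (Rabs_triang (slope g w2 - slope g w1)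
                (- (slope g w2 - w2 - (slope g w1 - w1)))).
  rewrite Rabs_Ropp.
  replace (slope g w2 - slope g w1 + - (slope g w2 - w2 - (slope g w1 - w1)))
    with (w2 - w1) by ring. lra.
Qed.

Lemma is_derive_taylor z : is_derive taylor z (- 2 + PI * z - 2 * z ^ 2).
Proof. unfold taylor. auto_derive; [easy | field]. Qed.

Lemma defect_taylor_Lipschitz g w1 w2 M :
  Rabs g <= / 100 -> Rabs w1 <= M -> Rabs w2 <= M -> M <= / 2 ->
  Rabs ((defect g w2 - g * taylor (slope g w2)) - (defect g w1 - g * taylor (slope g w1)))
    <= 10000 * Rabs g * (M ^ 3 + g ^ 2) * Rabs (w2 - w1).
Proof.
  intros Hg H1 H2 HM.
  apply (MVT_Rabs_le (fun w => defect g w - g * taylor (slope g w))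
    (fun w => Ddefect g w
              - g * (- 2 + PI * slope g w - 2 * slope g w ^ 2) * Dslope g w)).
  - intros t _. apply @is_derive_minus; [apply is_derive_defect|].
    evar_last.
    + apply is_derive_scal, (is_derive_comp taylor (slope g)).
      * apply is_derive_taylor.
      * apply is_derive_slope.
    + unfold scal; simpl; unfold mult; simpl. ring.
  - intros t Ht. assert (Ht' : Rabs t <= M) by now apply (Rmin_Rmax_between w1 w2).
    eapply Rle_trans; [apply Ddefect_near; lra|].
    apply Rmult_le_compat_l; [generalize (Rabs_pos g); lra|].
    apply Rplus_le_compat_r, pow_incr. split; [apply Rabs_pos | easy].
Qed.

(** A sigma type, so that the preimage can be turned into a function of [z] in [half_map_exists]. *)
Lemma slope_onto g z :
  Rabs g <= / 100 -> Rabs z <= / 4 -> { w | Rabs w <= / 2 /\ slope g w = z }.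
Proof.
  intros Hg Hz. apply Rabs_le_between in Hz.
  generalize (sqr_le_small g Hg). intros Hg2.
  assert (H1 : / 4 <= slope g (/ 2)).
  { generalize (slope_near g (/ 2) Hg). rewrite Rabs_pos_eq by lra. intros G.
    specialize (G (Rle_refl _)). apply Rabs_le_between in G. lra. }
  assert (H2 : slope g (- / 2) <= - / 4).
  { generalize (slope_near g (- / 2) Hg). rewrite Rabs_Ropp, Rabs_pos_eq by lra.
    intros G. specialize (G (Rle_refl _)). apply Rabs_le_between in G. lra. }
  destruct (IVT_gen (slope g) (- / 2) (/ 2) z) as [w [Hw E]].
  - intros t. apply continuity_pt_filterlim.
    apply (is_derive_continuous _ _ _ (is_derive_slope g t)).
  - rewrite Rmin_left, Rmax_right by lra. lra.
  - rewrite Rmin_left, Rmax_right in Hw by lra. exists w.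
    split; [apply Rabs_le; lra | easy].
Qed.

(** The anchor for the increment estimates. At [w = 0] the defect is
    [sinh (g PI) / (1 + cosh (g PI))], that is [tanh (g PI / 2)], which is odd in [g]; hence the
    cubic error. *)
Lemma defect_at_0 g :
  Rabs g <= / 100 -> Rabs (defect g 0 - g * taylor 0) <= 10000 * Rabs g ^ 3.
Proof.
  intros Hg. assert (H0 : Rabs 0 <= / 2) by (rewrite Rabs_R0; lra).
  unfold defect, slope, taylor, dilation.
  generalize (sinh_angle_minus_le g 0 Hg) (cosh_angle_le g 0 Hg) PI_le_4
    (sqr_le_small g Hg) (pow2_abs g) (Rabs_pos g).
  unfold flight. rewrite atan_0.
  replace (g * (PI - 2 * 0)) with (g * PI) by ring.
  set (S := sinh (g * PI)). set (C := cosh (g * PI)).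
  intros HS HC Hpi Hg2 Hgg Hg0.
  replace (S * (1 + 0 ^ 2) / (2 * (1 + (C - 1) * (1 + 0 ^ 2) / 2))
           - g * (0 / (1 + (C - 1) * (1 + 0 ^ 2) / 2))
           - g * (PI / 2 - 2 * 0 + PI / 2 * 0 ^ 2 - 2 / 3 * 0 ^ 3))
    with (((S - g * PI) + - (g * PI * / 2 * (C - 1))) * / (1 + C))
    by (field; lra).
  assert (Hi : Rabs (/ (1 + C)) <= 1).
  { rewrite Rabs_pos_eq by (left; apply Rinv_0_lt_compat; lra).
    rewrite <- Rinv_1 at 2. apply Rinv_le_contravar; lra. }
  assert (B : Rabs (g * PI * / 2 * (C - 1)) <= Rabs g * 4 * / 2 * (192 * g ^ 2)).
  { apply Rabs_mult_le; [apply Rabs_mult_le; [apply Rabs_mult_le|]|];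
      try lra; rewrite Rabs_pos_eq; lra. }
  replace (10000 * Rabs g ^ 3) with (10000 * Rabs g ^ 3 * 1) by ring.
  apply Rabs_mult_le; [|easy].
  eapply Rle_trans; [apply Rabs_triang|]. rewrite Rabs_Ropp.
  replace (Rabs g ^ 3) with (Rabs g * g ^ 2) in * by (rewrite <- Hgg; ring).
  assert (0 <= Rabs g * g ^ 2) by (apply Rmult_le_pos; lra). lra.
Qed.

(** Leaves room for [10000 * 8 * 2]: the constant of [defect_taylor_Lipschitz], the cube of the
    factor 2 in [|w| <= 2 |z|], and the Lipschitz constant 2 of the inverse of [slope]. *)
Definition half_map_constant : R := 200000.

(** The interface through which the half-return map is used from here on: it produces arcs, is
    small, has controlled increments against [g * taylor], and has a controlled value at [0]. *)
Definition half_map (g : R) (k : R -> R) : Prop :=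
  (forall c r, 0 < r -> Rabs (c / r) <= / 4 ->
     exists tau, half_arc g c (r - r * k (c / r)) (r + r * k (c / r)) tau) /\
  (forall z, Rabs z <= / 4 -> Rabs (k z) <= 16 * Rabs g) /\
  (forall z1 z2 M, Rabs z1 <= M -> Rabs z2 <= M -> M <= / 4 ->
     Rabs ((k z2 - g * taylor z2) - (k z1 - g * taylor z1))
       <= half_map_constant * Rabs g * (M ^ 3 + g ^ 2) * Rabs (z2 - z1)) /\
  Rabs (k 0 - g * taylor 0) <= half_map_constant * Rabs g ^ 3.

Lemma half_map_exists g : Rabs g <= / 100 -> exists k, half_map g k.
Proof.
  intros Hg.
  assert (Hinv : forall z, { w | Rabs z <= / 4 -> Rabs w <= / 2 /\ slope g w = z }).
  { intros z. destruct (Rle_dec (Rabs z) (/ 4)) as [H | H].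
    - destruct (slope_onto g z Hg H) as [w Hw]. now exists w.
    (* Default value outside the range where the inverse is meaningful. *)
    - exists 0. easy. }
  set (W := fun z => proj1_sig (Hinv z)).
  assert (HW : forall z, Rabs z <= / 4 -> Rabs (W z) <= / 2 /\ slope g (W z) = z)
    by (intros z; exact (proj2_sig (Hinv z))).
  assert (HW0 : forall z, Rabs z <= / 4 -> Rabs (W z) <= 2 * Rabs z).
  { intros z Hz. destruct (HW z Hz) as [H1 H2].
    generalize (slope_expanding g 0 (W z) Hg).
    replace (slope g 0) with 0 by (unfold slope, Rdiv; ring).
    rewrite H2, !Rminus_0_r, Rabs_R0. intros G. apply G; lra. }
  exists (fun z => defect g (W z)). split; [|split; [|split]].
  - intros c r Hr Hz. destruct (HW _ Hz) as [H1 H2].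
    exists (flight (W (c / r))).
    generalize (half_arc_param g (W (c / r)) r Hr).
    rewrite H2. replace (r * (c / r)) with c by (field; lra).
    rewrite Rmult_minus_distr_l, Rmult_plus_distr_l, Rmult_1_r.
    intros G. apply G. generalize (defect_le g (W (c / r)) Hg H1). lra.
  - intros z Hz. apply defect_le; [easy | now apply HW].
  - intros z1 z2 M H1 H2 HM.
    destruct (HW z1) as [A1 B1]; [lra|]. destruct (HW z2) as [A2 B2]; [lra|].
    generalize (HW0 z1) (HW0 z2). intros C1 C2.
    assert (HM0 : 0 <= M) by (generalize (Rabs_pos z1); lra).
    generalize (defect_taylor_Lipschitz g (W z1) (W z2) (2 * M) Hg).
    rewrite B1, B2. intros G.
    eapply Rle_trans; [apply G; lra|].
    generalize (slope_expanding g (W z1) (W z2) Hg A1 A2). rewrite B1, B2. intros E.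
    assert (HK : 0 <= Rabs g * (M ^ 3 + g ^ 2)).
    { apply Rmult_le_pos; [apply Rabs_pos|].
      apply Rplus_le_le_0_compat; [now apply pow_le | apply pow2_ge_0]. }
    apply Rle_trans with
      (10000 * (8 * (Rabs g * (M ^ 3 + g ^ 2))) * (2 * Rabs (z2 - z1))).
    + apply Rmult_le_compat; try easy; try apply Rabs_pos.
      * replace ((2 * M) ^ 3) with (8 * M ^ 3) by ring.
        repeat apply Rmult_le_pos; try lra; [apply Rabs_pos|].
        apply Rplus_le_le_0_compat; [|apply pow2_ge_0].
        apply Rmult_le_pos; [lra | now apply pow_le].
      * replace ((2 * M) ^ 3) with (8 * M ^ 3) by ring.
        rewrite Rmult_assoc. apply Rmult_le_compat_l; [lra|].
        assert (0 <= Rabs g * g ^ 2) by (apply Rmult_le_pos; [apply Rabs_pos | apply pow2_ge_0]).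
        lra.
    + unfold half_map_constant.
      assert (0 <= Rabs g * (M ^ 3 + g ^ 2) * Rabs (z2 - z1))
        by (apply Rmult_le_pos; [easy | apply Rabs_pos]).
      lra.
  - generalize (HW0 0). rewrite Rabs_R0, Rmult_0_r. intros G.
    specialize (G ltac:(lra)).
    replace (W 0) with 0.
    + generalize (defect_at_0 g Hg). unfold half_map_constant.
      assert (0 <= Rabs g ^ 3) by (apply pow_le, Rabs_pos). lra.
    + symmetry. destruct (Req_dec (W 0) 0) as [E | N]; [easy|].
      apply Rabs_pos_lt in N. lra.
Qed.

(** * Zeros of the displacement *)

Lemma taylor_Lipschitz z1 z2 :
  Rabs z1 <= / 4 -> Rabs z2 <= / 4 ->
  Rabs (taylor z2 - taylor z1) <= 4 * Rabs (z2 - z1).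
Proof.
  intros H1 H2.
  apply (MVT_Rabs_le taylor (fun z => - 2 + PI * z - 2 * z ^ 2)).
  - intros; apply is_derive_taylor.
  - intros t Ht. assert (Ht' : Rabs t <= / 4) by now apply (Rmin_Rmax_between z1 z2).
    apply Rabs_le_between in Ht'. generalize PI_le_4. intros. apply Rabs_le. nra.
Qed.

(** Taking [M = / 4], the factor of [Rabs g] is at most [200000 (1 / 64 + 1 / 10000) + 4]. *)
Lemma half_map_Lipschitz g k z1 z2 :
  half_map g k -> Rabs g <= / 100 -> Rabs z1 <= / 4 -> Rabs z2 <= / 4 ->
  Rabs (k z2 - k z1) <= 5000 * Rabs g * Rabs (z2 - z1).
Proof.
  intros [_ [_ [Hk _]]] Hg H1 H2.
  generalize (Hk z1 z2 (/ 4) H1 H2 (Rle_refl _)) (taylor_Lipschitz z1 z2 H1 H2)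
    (sqr_le_small g Hg) (Rabs_pos g) (Rabs_pos (z2 - z1)).
  unfold half_map_constant. intros A B C D E.
  assert (F : Rabs (g * (taylor z2 - taylor z1)) <= Rabs g * (4 * Rabs (z2 - z1)))
    by (apply Rabs_mult_le; [lra | easy]).
  assert (0 <= Rabs g * Rabs (z2 - z1)) by now apply Rmult_le_pos.
  replace (k z2 - k z1) with (k z2 - g * taylor z2 - (k z1 - g * taylor z1)
                              + g * (taylor z2 - taylor z1)) by ring.
  eapply Rle_trans; [apply Rabs_triang|]. nra.
Qed.

(** Increments of [r k (c / r)] are at most [(16 + 5000 / 4) |g|] times those of [r]: the first part
    comes from the size of [k], the second from its Lipschitz constant together with
    [r |c / r' - c / r| <= (r' - r) / 4]. The bound on [g] makes this factor less than 1. *)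
Lemma arc_family_of_half_map g c k r1 r2 :
  half_map g k -> Rabs g <= / 100000 -> 0 < r1 -> 4 * Rabs c <= r1 ->
  arc_family g c (fun r => r * k (c / r)) r1 r2.
Proof.
  intros Hk Hg Hr1 Hc.
  assert (Hz : forall r, r1 < r -> Rabs (c / r) <= / 4).
  { intros r Hr. unfold Rdiv. rewrite Rabs_mult, Rabs_inv, (Rabs_pos_eq r) by lra.
    apply Rmult_le_reg_r with r; [lra|]. rewrite Rmult_assoc, Rinv_l by lra. lra. }
  split.
  - intros r Hr. apply Hk; [lra | apply Hz; lra].
  - intros r r' A B C.
    assert (Z := Hz r A). assert (Z' := Hz r' ltac:(lra)).
    generalize (half_map_Lipschitz g k (c / r) (c / r') Hk ltac:(lra) Z Z').
    generalize (proj1 (proj2 Hk) _ Z'). intros K1 K2.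
    replace (r' * k (c / r') - r * k (c / r))
      with ((r' - r) * k (c / r') + r * (k (c / r') - k (c / r))) by ring.
    assert (K3 : Rabs ((r' - r) * k (c / r')) <= (r' - r) * (16 * Rabs g))
      by (apply Rabs_mult_le; [rewrite Rabs_pos_eq; lra | easy]).
    assert (K4 : r * Rabs (c / r' - c / r) <= / 4 * (r' - r)).
    { replace (c / r' - c / r) with (- (c / r' * ((r' - r) / r))) by (field; lra).
      rewrite Rabs_Ropp, Rabs_mult.
      rewrite (Rabs_pos_eq ((r' - r) / r)) by (apply Rdiv_le_0_compat; lra).
      replace (r * (Rabs (c / r') * ((r' - r) / r))) with (Rabs (c / r') * (r' - r))
        by (field; lra).
      apply Rmult_le_compat_r; lra. }
    assert (K5 : Rabs (r * (k (c / r') - k (c / r)))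
                 <= r * (5000 * Rabs g * Rabs (c / r' - c / r)))
      by (apply Rabs_mult_le; [rewrite Rabs_pos_eq; lra | easy]).
    generalize (Rabs_pos g). intros Hg0.
    assert (5000 * Rabs g * (r * Rabs (c / r' - c / r))
              <= 5000 * Rabs g * (/ 4 * (r' - r)))
      by (apply Rmult_le_compat_l; lra).
    assert (Rabs g * (r' - r) <= / 100000 * (r' - r))
      by (apply Rmult_le_compat_r; lra).
    eapply Rle_lt_trans; [apply Rabs_triang|]. lra.
Qed.

(* [displacement / (s X)] at [X] is [KL r + KR r + 2 b] at [r = / (s X)]. *)
Definition displacement (kL kR : R -> R) (b c d s X : R) : R :=
  kL (c * (s * X)) + kR (- d * (s * X)) + 2 * b * (s * X).

(** The substitution [r = / (s X)] reverses the interval. In the conclusion [u + v] recovers [X0],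
    so that cycles from different roots can be told apart, and the lower bound of [u], half of [r]
    minus [b], makes the ordinate large. *)
Lemma limit_cycle_of_root gL gR b c d kL kR s X1 X2 X0 :
  half_map gL kL -> half_map gR kR ->
  Rabs gL <= / 100000 -> Rabs gR <= / 100000 ->
  0 < s -> 0 < X1 -> X1 < X0 < X2 ->
  4 * Rabs c * (s * X2) <= 1 -> 4 * Rabs d * (s * X2) <= 1 ->
  displacement kL kR b c d s X0 = 0 ->
  (forall X, X1 < X < X2 -> displacement kL kR b c d s X = 0 -> X = X0) ->
  exists G u v,
    limit_cycle (gL, gR, b, c, d) G /\
    (forall y, G (0, y) <-> y = u \/ y = - v) /\
    0 < v /\ u + v = 2 / (s * X0) /\ / (2 * (s * X0)) - b <= u.
Proof.
  intros HL HR HgL HgR Hs H1 HX Hc Hd Hz Huniq.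
  assert (P1 : 0 < s * X1) by (apply Rmult_lt_0_compat; lra).
  assert (P0 : 0 < s * X0) by (apply Rmult_lt_0_compat; lra).
  assert (P2 : 0 < s * X2) by (apply Rmult_lt_0_compat; lra).
  assert (Hbound : forall a, 4 * Rabs a * (s * X2) <= 1 -> 4 * Rabs a <= / (s * X2)).
  { intros a Ha. apply Rmult_le_reg_r with (s * X2); [easy|].
    rewrite Rinv_l; lra. }
  assert (Hr : / (s * X2) < / (s * X0) < / (s * X1)).
  { split; apply Rinv_lt_contravar; try now apply Rmult_lt_0_compat.
    - apply Rmult_lt_compat_l; lra.
    - apply Rmult_lt_compat_l; lra. }
  assert (FL := arc_family_of_half_map gL c kL (/ (s * X2)) (/ (s * X1)) HL HgL
                  (Rinv_0_lt_compat _ P2) (Hbound c Hc)).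
  assert (FR := arc_family_of_half_map gR (- d) kR (/ (s * X2)) (/ (s * X1)) HR HgR
                  (Rinv_0_lt_compat _ P2)).
  rewrite Rabs_Ropp in FR. specialize (FR (Hbound d Hd)).
  assert (Hdisp : forall r, 0 < r ->
            r * kL (c / r) + r * kR (- d / r) + 2 * b
            = r * displacement kL kR b c d s (/ (s * r))).
  { intros r Hr0. unfold displacement.
    replace (s * / (s * r)) with (/ r) by (field; lra). unfold Rdiv. field. lra. }
  assert (E0 : / (s * / (s * X0)) = X0) by (field; split; nra).
  destruct (limit_cycle_of_isolated_zero gL gR b c d _ _ _ _ (/ (s * X0)) FL FR Hr)
    as [G [u [v [HG [Hu [Hv [Eu [Ev Hsec]]]]]]]].
  - rewrite Hdisp by now apply Rinv_0_lt_compat. rewrite E0, Hz. ring.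
  - intros r [A B] E.
    assert (Hr0 : 0 < r) by (generalize (Rinv_0_lt_compat _ P2); lra).
    rewrite Hdisp in E by easy.
    apply Rmult_integral in E. destruct E as [E | E]; [lra|].
    assert (HXr : / (s * r) = X0).
    { apply Huniq; [|easy]. split.
      - apply Rmult_lt_reg_l with (s * r); [now apply Rmult_lt_0_compat|].
        rewrite Rinv_r by nra. apply Rmult_lt_compat_r with (r := s * X1) in B; [|easy].
        rewrite Rinv_l in B by lra. lra.
      - apply Rmult_lt_reg_l with (s * r); [now apply Rmult_lt_0_compat|].
        rewrite Rinv_r by nra. apply Rmult_lt_compat_r with (r := s * X2) in A; [|easy].
        rewrite Rinv_l in A by lra. lra. }
    rewrite <- HXr. field. lra.
  - exists G, u, v. split; [easy|]. split; [easy|]. split; [easy|].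
    split; [rewrite Eu, Ev; field; lra|].
    rewrite Eu.
    assert (Hz0 : Rabs (c / / (s * X0)) <= / 4).
    { unfold Rdiv. rewrite Rinv_inv, Rabs_mult, (Rabs_pos_eq (s * X0)) by lra.
      generalize (Rabs_pos c). assert (s * X0 <= s * X2) by (apply Rmult_le_compat_l; lra).
      nra. }
    generalize (proj1 (proj2 HL) _ Hz0). intros K. apply Rabs_le_between in K.
    set (r := / (s * X0)) in *.
    assert (Hr0 : 0 < r) by now apply Rinv_0_lt_compat.
    replace (/ (2 * (s * X0))) with (r / 2) by (unfold r; field; lra).
    nra.
Qed.

(** A simple root survives a perturbation that is small together with its Lipschitz constant:
    [f - L] can overturn neither the signs of [L] at [a] and [b] nor its monotonicity. [sigma] is
    the direction in which [L] crosses zero. The estimates on the larger interval give continuity of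
    [f] up to [a] and [b]. *)
Lemma unique_root_of_perturbation (f L : R -> R) (lo hi a b sigma eps mu : R) :
  lo < a -> a < b -> b < hi -> eps < mu ->
  (sigma = 1 \/ sigma = -1) ->
  (forall X, continuous L X) ->
  (forall X, lo <= X <= hi -> Rabs (f X - L X) <= eps) ->
  (forall X Y, lo <= X <= hi -> lo <= Y <= hi ->
     Rabs ((f Y - L Y) - (f X - L X)) <= eps * Rabs (Y - X)) ->
  sigma * L a <= - mu -> mu <= sigma * L b ->
  (forall X Y, a <= X -> X < Y -> Y <= b -> mu * (Y - X) <= sigma * (L Y - L X)) ->
  exists X0, a < X0 < b /\ f X0 = 0 /\ forall X, a < X < b -> f X = 0 -> X = X0.
Proof.
  intros Hlo Hab Hhi Heps Hsigma HL Hf HfL Ha Hb Hmono.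
  assert (Hcont : forall X, a <= X <= b -> continuity_pt f X).
  { intros X HX.
    apply (continuity_pt_ext (fun Y => (f Y - L Y) + L Y)); [intros; ring|].
    apply continuity_pt_plus; [|apply continuity_pt_filterlim, HL].
    assert (He : 0 <= eps).
    { apply Rle_trans with (Rabs (f X - L X)); [apply Rabs_pos | apply Hf; lra]. }
    intros e Hepos. exists (Rmin (e / (eps + 1)) (Rmin (X - lo) (hi - X))).
    split. { repeat apply Rmin_glb_lt; try lra. apply Rdiv_lt_0_compat; lra. }
    intros Y [_ HY]. simpl in *. unfold Rdist in *.
    generalize (Rmin_l (e / (eps + 1)) (Rmin (X - lo) (hi - X)))
      (Rmin_r (e / (eps + 1)) (Rmin (X - lo) (hi - X)))
      (Rmin_l (X - lo) (hi - X)) (Rmin_r (X - lo) (hi - X)). intros.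
    assert (HY' : Rabs (Y - X) < Rmin (X - lo) (hi - X)) by lra.
    apply Rabs_increment_lt in HY'.
    eapply Rle_lt_trans; [apply HfL; lra|].
    assert (HY2 : Rabs (Y - X) < e / (eps + 1)) by lra.
    apply Rmult_lt_compat_r with (r := eps + 1) in HY2; [|lra].
    unfold Rdiv in HY2. rewrite Rmult_assoc, Rinv_l in HY2 by lra.
    generalize (Rabs_pos (Y - X)). lra. }
  assert (Hmono' : forall X Y, a <= X -> X < Y -> Y <= b -> 0 < sigma * (f Y - f X)).
  { intros X Y A B C. generalize (Hmono X Y A B C) (HfL X Y ltac:(lra) ltac:(lra)).
    rewrite (Rabs_pos_eq (Y - X)) by lra. intros M1 M2. apply Rabs_le_between in M2.
    assert (eps * (Y - X) < mu * (Y - X)) by (apply Rmult_lt_compat_r; lra).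
    destruct Hsigma as [-> | ->]; lra. }
  destruct (IVT_interv (fun X => sigma * f X) a b) as [X0 [HX0 E]].
  - intros X HX. apply continuity_pt_scal. now apply Hcont.
  - easy.
  - generalize (Hf a ltac:(lra)). intros M. apply Rabs_le_between in M.
    destruct Hsigma as [-> | ->]; lra.
  - generalize (Hf b ltac:(lra)). intros M. apply Rabs_le_between in M.
    destruct Hsigma as [-> | ->]; lra.
  - assert (E0 : f X0 = 0) by (destruct Hsigma as [-> | ->]; lra).
    assert (Na : X0 <> a).
    { intros ->. generalize (Hf a ltac:(lra)). intros M. apply Rabs_le_between in M.
      destruct Hsigma as [-> | ->]; lra. }
    assert (Nb : X0 <> b).
    { intros ->. generalize (Hf b ltac:(lra)). intros M. apply Rabs_le_between in M.
      destruct Hsigma as [-> | ->]; lra. }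
    exists X0. split; [lra|]. split; [easy|]. intros X HX EX.
    destruct (Rtotal_order X X0) as [A | [A | A]]; [| easy |].
    + generalize (Hmono' X X0). rewrite E0, EX, Rminus_0_r, Rmult_0_r. lra.
    + generalize (Hmono' X0 X). rewrite E0, EX, Rminus_0_r, Rmult_0_r. lra.
Qed.

(** The arguments have size at most [M = 4 B s], so [M ^ 3 + g ^ 2 <= 68 B ^ 3 s ^ 3]. The factors
    [2 s ^ 2] from [g] and [B s] from the increment of the argument make [136 B ^ 4 s ^ 6]. *)
Lemma half_map_error_Lipschitz g k c B s X Y :
  half_map g k -> Rabs g <= 2 * s ^ 2 -> Rabs c <= B -> 1 <= B ->
  0 < s -> s <= 1 -> 16 * (B * s) <= 1 ->
  0 <= X <= 4 -> 0 <= Y <= 4 ->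
  Rabs ((k (c * (s * Y)) - g * taylor (c * (s * Y)))
        - (k (c * (s * X)) - g * taylor (c * (s * X))))
    <= half_map_constant * (136 * B ^ 4) * s ^ 6 * Rabs (Y - X).
Proof.
  intros [_ [_ [Hk _]]] Hg Hc HB Hs Hs1 HBs HX HY.
  assert (Hz : forall W, 0 <= W <= 4 -> Rabs (c * (s * W)) <= 4 * (B * s)).
  { intros W HW. replace (4 * (B * s)) with (B * (s * 4)) by ring.
    apply Rabs_mult_le; [easy|]. rewrite Rabs_pos_eq by nra.
    apply Rmult_le_compat_l; lra. }
  eapply Rle_trans; [apply (Hk _ _ (4 * (B * s))); [now apply Hz | now apply Hz | lra]|].
  replace (c * (s * Y) - c * (s * X)) with (c * (s * (Y - X))) by ring.
  rewrite (Rabs_mult c), (Rabs_mult s), (Rabs_pos_eq s) by lra.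
  assert (HK : 0 < half_map_constant) by (unfold half_map_constant; lra).
  assert (Hg2 : g ^ 2 <= 4 * s ^ 3).
  { rewrite <- pow2_abs. apply Rle_trans with ((2 * s ^ 2) ^ 2).
    - apply pow_incr. split; [apply Rabs_pos | easy].
    - replace ((2 * s ^ 2) ^ 2) with (4 * s ^ 3 * s) by ring.
      rewrite <- (Rmult_1_r (4 * s ^ 3)) at 2. apply Rmult_le_compat_l; [|easy].
      apply Rmult_le_pos; [lra | apply pow_le; lra]. }
  assert (HB3 : 1 <= B ^ 3) by (apply pow_R1_Rle; lra).
  assert (Hs3 : 0 < s ^ 3) by (apply pow_lt; lra).
  assert (Hsum : (4 * (B * s)) ^ 3 + g ^ 2 <= 68 * B ^ 3 * s ^ 3).
  { replace ((4 * (B * s)) ^ 3) with (64 * B ^ 3 * s ^ 3) by ring. nra. }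
  replace (half_map_constant * (136 * B ^ 4) * s ^ 6 * Rabs (Y - X))
    with (half_map_constant * (2 * s ^ 2) * (68 * B ^ 3 * s ^ 3) * (B * (s * Rabs (Y - X))))
    by ring.
  apply Rmult_le_compat.
  - apply Rmult_le_pos; [apply Rmult_le_pos; [lra | apply Rabs_pos]|].
    apply Rplus_le_le_0_compat; [|apply pow2_ge_0]. apply pow_le. nra.
  - apply Rmult_le_pos; [apply Rabs_pos|]. apply Rmult_le_pos; [lra | apply Rabs_pos].
  - apply Rmult_le_compat; try easy.
    + apply Rmult_le_pos; [lra | apply Rabs_pos].
    + apply Rplus_le_le_0_compat; [|apply pow2_ge_0]. apply pow_le. nra.
    + apply Rmult_le_compat_l; lra.
  - apply Rmult_le_compat_r; [|easy]. apply Rmult_le_pos; [lra | apply Rabs_pos].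
Qed.

(** [552 = 4 * 136 + 8]: the increment from [0] to [X <= 4], plus the error at [0], where
    [|g| ^ 3 <= 8 s ^ 6]. *)
Lemma half_map_error_le g k c B s X :
  half_map g k -> Rabs g <= 2 * s ^ 2 -> Rabs c <= B -> 1 <= B ->
  0 < s -> s <= 1 -> 16 * (B * s) <= 1 -> 0 <= X <= 4 ->
  Rabs (k (c * (s * X)) - g * taylor (c * (s * X)))
    <= half_map_constant * (552 * B ^ 4) * s ^ 6.
Proof.
  intros Hk Hg Hc HB Hs Hs1 HBs HX.
  generalize (half_map_error_Lipschitz g k c B s 0 X Hk Hg Hc HB Hs Hs1 HBs
                ltac:(lra) HX) (proj2 (proj2 (proj2 Hk))).
  replace (c * (s * 0)) with 0 by ring. rewrite Rminus_0_r, (Rabs_pos_eq X) by lra.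
  intros H1 H2.
  assert (HK : 0 < half_map_constant) by (unfold half_map_constant; lra).
  assert (HB4 : 1 <= B ^ 4) by (apply pow_R1_Rle; lra).
  assert (Hs6 : 0 < s ^ 6) by (apply pow_lt; lra).
  assert (H3 : Rabs g ^ 3 <= 8 * s ^ 6).
  { replace (8 * s ^ 6) with ((2 * s ^ 2) ^ 3) by ring.
    apply pow_incr. split; [apply Rabs_pos | easy]. }
  assert (H4 : half_map_constant * Rabs g ^ 3 <= half_map_constant * (8 * s ^ 6))
    by (apply Rmult_le_compat_l; lra).
  set (U := half_map_constant * s ^ 6).
  assert (HU : 0 < U) by (unfold U; now apply Rmult_lt_0_compat).
  assert (HU4 : U <= U * B ^ 4) by nra.
  assert (HUX : U * B ^ 4 * X <= U * B ^ 4 * 4)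
    by (apply Rmult_le_compat_l; [nra | lra]).
  assert (H5 := Rabs_triang (k 0 - g * taylor 0)
    (k (c * (s * X)) - g * taylor (c * (s * X)) - (k 0 - g * taylor 0))).
  replace (_ + _) with (k (c * (s * X)) - g * taylor (c * (s * X))) in H5 by ring.
  unfold U in *. lra.
Qed.

Definition cubic (l0 l1 l2 l3 X : R) : R := l0 + l1 * X + l2 * X ^ 2 + l3 * X ^ 3.

Lemma continuous_cubic l0 l1 l2 l3 X : continuous (cubic l0 l1 l2 l3) X.
Proof.
  apply (@ex_derive_continuous R_AbsRing R_NormedModule).
  unfold cubic. auto_derive. easy.
Qed.

Lemma cubic_le e0 e1 e2 e3 X delta :
  Rabs e0 <= delta -> Rabs e1 <= delta -> Rabs e2 <= delta -> Rabs e3 <= delta ->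
  0 <= X <= 4 -> Rabs (cubic e0 e1 e2 e3 X) <= 85 * delta.
Proof.
  intros H0 H1 H2 H3 HX. unfold cubic.
  replace (85 * delta) with (delta + delta * 4 + delta * 4 ^ 2 + delta * 4 ^ 3) by ring.
  apply Rabs_triang_4; try easy; apply Rabs_mult_le; try easy;
    rewrite Rabs_pos_eq; try lra; try (apply pow_le; lra); apply pow_incr; lra.
Qed.

Lemma cubic_Lipschitz e0 e1 e2 e3 X Y delta :
  Rabs e1 <= delta -> Rabs e2 <= delta -> Rabs e3 <= delta ->
  0 <= X <= 4 -> 0 <= Y <= 4 ->
  Rabs (cubic e0 e1 e2 e3 Y - cubic e0 e1 e2 e3 X) <= 57 * delta * Rabs (Y - X).
Proof.
  intros H1 H2 H3 HX HY. unfold cubic.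
  replace (e0 + e1 * Y + e2 * Y ^ 2 + e3 * Y ^ 3 - (e0 + e1 * X + e2 * X ^ 2 + e3 * X ^ 3))
    with ((e1 * 1 + e2 * (Y + X) + e3 * (Y ^ 2 + Y * X + X ^ 2) + 0) * (Y - X)) by ring.
  apply Rabs_mult_le; [|lra].
  replace (57 * delta) with (delta * 1 + delta * 8 + delta * 48 + 0) by ring.
  apply Rabs_triang_4; try (rewrite Rabs_R0; lra);
    apply Rabs_mult_le; try easy; rewrite Rabs_pos_eq; nra.
Qed.

Lemma finite_choice (A : Type) (a : A) n (Q : nat -> A -> Prop) :
  (forall i, (i < n)%nat -> exists x, Q i x) ->
  exists f, forall i, (i < n)%nat -> Q i (f i).
Proof.
  induction n as [|n IH]; intros H.
  - exists (fun _ => a). lia.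
  - destruct IH as [f Hf]; [intros; apply H; lia|].
    destruct (H n) as [x Hx]; [lia|].
    exists (fun i => if Nat.eq_dec i n then x else f i). intros i Hi.
    destruct (Nat.eq_dec i n) as [-> | Hne]; [easy | apply Hf; lia].
Qed.

(** A quantitative simple root near [i + 1]: [L] changes sign with margin [mu] and has slope at
    least [mu] across a window centred there. Windows of different indices are disjoint. *)
Definition simple_window (L : R -> R) (mu : R) (i : nat) : Prop :=
  exists sigma, (sigma = 1 \/ sigma = -1) /\
    sigma * L (INR i + 3 / 4) <= - mu /\ mu <= sigma * L (INR i + 5 / 4) /\
    forall X Y, INR i + 3 / 4 <= X -> X < Y -> Y <= INR i + 5 / 4 ->
      mu * (Y - X) <= sigma * (L Y - L X).

Lemma small_parameter (s0 A : R) :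
  0 < s0 -> 0 < A -> exists s, 0 < s <= s0 /\ s <= 1 /\ A * s < 1.
Proof.
  intros H0 HA. exists (Rmin s0 (/ (A + 1))).
  assert (Hi : 0 < / (A + 1)) by (apply Rinv_0_lt_compat; lra).
  generalize (Rmin_l s0 (/ (A + 1))) (Rmin_r s0 (/ (A + 1))). intros.
  assert (E : / (A + 1) * (A + 1) = 1) by (apply Rinv_l; lra).
  split; [split; [now apply Rmin_glb_lt | easy]|]. split; nra.
Qed.

(** With [gamma_L = s ^ 2] and [gamma_R = h s ^ 2], the choice of [h] and [b] gives the coefficients
    [l0] and [l1] exactly. The higher ones are dictated by [eta], [d] and [h]; [q2] and [q3] name
    them after division by the leading power [s ^ (p + 3)]. *)
Lemma displacement_expansion eta d h b l0 l1 q2 q3 s p X :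
  h = - 1 + 2 * l0 / PI * s ^ (p + 1) ->
  b = s ^ 2 * (eta - h * d) + l1 * s ^ (p + 2) / 2 ->
  PI / 2 * (eta ^ 2 + h * d ^ 2) * s ^ 4 = s ^ (p + 3) * q2 ->
  - 2 / 3 * (eta ^ 3 - h * d ^ 3) * s ^ 5 = s ^ (p + 3) * q3 ->
  s ^ 2 * taylor (eta * (s * X)) + h * s ^ 2 * taylor (- d * (s * X)) + 2 * b * (s * X)
    = s ^ (p + 3) * cubic l0 l1 q2 q3 X.
Proof.
  intros Hh Hb H2 H3. generalize PI_RGT_0. intros HPI.
  assert (E0 : s ^ 2 * (PI / 2 * (1 + h)) = s ^ (p + 3) * l0).
  { rewrite Hh. replace (p + 3)%nat with (p + 1 + 2)%nat by lia.
    rewrite (pow_add s (p + 1) 2). field. lra. }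
  assert (E1 : s ^ 3 * (- 2 * eta + 2 * h * d) + 2 * b * s = s ^ (p + 3) * l1).
  { rewrite Hb. replace (p + 3)%nat with (p + 2 + 1)%nat by lia.
    rewrite (pow_add s (p + 2) 1). field. }
  unfold cubic.
  replace (s ^ (p + 3) * (l0 + l1 * X + q2 * X ^ 2 + q3 * X ^ 3))
    with (s ^ (p + 3) * l0 + s ^ (p + 3) * l1 * X + s ^ (p + 3) * q2 * X ^ 2
          + s ^ (p + 3) * q3 * X ^ 3) by ring.
  rewrite <- E0, <- E1, <- H2, <- H3. unfold taylor. field.
Qed.

Lemma displacement_root eta d h b l0 l1 l2 l3 q2 q3 kL kR s p B C mu i :
  half_map (s ^ 2) kL -> half_map (h * s ^ 2) kR ->
  h = - 1 + 2 * l0 / PI * s ^ (p + 1) ->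
  b = s ^ 2 * (eta - h * d) + l1 * s ^ (p + 2) / 2 ->
  PI / 2 * (eta ^ 2 + h * d ^ 2) * s ^ 4 = s ^ (p + 3) * q2 ->
  - 2 / 3 * (eta ^ 3 - h * d ^ 3) * s ^ 5 = s ^ (p + 3) * q3 ->
  Rabs (q2 - l2) <= C * s -> Rabs (q3 - l3) <= C * s ->
  (p <= 2)%nat -> (i <= 2)%nat ->
  0 < s -> s <= 1 -> Rabs h <= 2 -> Rabs eta <= B -> Rabs d <= B -> 1 <= B ->
  16 * (B * s) <= 1 ->
  (half_map_constant * (1104 * B ^ 4) + 85 * C) * s < mu ->
  simple_window (cubic l0 l1 l2 l3) mu i ->
  exists X0, INR i + 3 / 4 < X0 < INR i + 5 / 4 /\
    displacement kL kR b eta d s X0 = 0 /\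
    forall X, INR i + 3 / 4 < X < INR i + 5 / 4 ->
      displacement kL kR b eta d s X = 0 -> X = X0.
Proof.
  intros HkL HkR Hh Hb H2 H3 Hq2 Hq3 Hp Hi Hs Hs1 Hh2 Heta Hd HB HBs Hmu
    [sigma [Hsigma [Ha [Hb' Hm]]]].
  assert (HK : 0 < half_map_constant) by (unfold half_map_constant; lra).
  assert (HB4 : 1 <= B ^ 4) by (apply pow_R1_Rle; lra).
  assert (HC : 0 <= C * s) by (generalize (Rabs_pos (q2 - l2)); lra).
  assert (Hi' : 0 <= INR i <= 2).
  { split; [apply pos_INR|]. replace 2 with (INR 2) by (simpl; ring). now apply le_INR. }
  set (N := s ^ (p + 3)).
  assert (HN : 0 < N) by now apply pow_lt.
  (* Here [p <= 2] enters: the remainder [s ^ 6] is still one order smaller than the leading power,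
     even for the cubic case. *)
  assert (HN6 : s ^ 6 <= s * N).
  { unfold N. replace (s * s ^ (p + 3)) with (s ^ (p + 4))
      by (replace (p + 4)%nat with (1 + (p + 3))%nat by lia; rewrite pow_add; ring).
    replace 6%nat with (p + 4 + (2 - p))%nat by lia. rewrite pow_add.
    rewrite <- (Rmult_1_r (s ^ (p + 4))) at 2.
    apply Rmult_le_compat_l; [apply pow_le; lra|].
    rewrite <- (pow1 (2 - p)). apply pow_incr. lra. }
  set (eL := fun X => kL (eta * (s * X)) - s ^ 2 * taylor (eta * (s * X))).
  set (eR := fun X => kR (- d * (s * X)) - h * s ^ 2 * taylor (- d * (s * X))).
  assert (Hs2 : 0 <= s ^ 2) by apply pow2_ge_0.
  assert (GL : Rabs (s ^ 2) <= 2 * s ^ 2) by (rewrite Rabs_pos_eq; lra).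
  assert (GR : Rabs (h * s ^ 2) <= 2 * s ^ 2)
    by (apply Rabs_mult_le; [easy | rewrite Rabs_pos_eq; lra]).
  assert (Hd' : Rabs (- d) <= B) by now rewrite Rabs_Ropp.
  assert (Hf : forall X, displacement kL kR b eta d s X / N
             - cubic l0 l1 l2 l3 X
             = (eL X + eR X) * / N + cubic 0 0 (q2 - l2) (q3 - l3) X).
  { intros X.
    assert (E := displacement_expansion eta d h b l0 l1 q2 q3 s p X Hh Hb H2 H3).
    fold N in E. unfold displacement, eL, eR.
    replace (2 * b * (s * X)) with (N * cubic l0 l1 q2 q3 X
      - s ^ 2 * taylor (eta * (s * X)) - h * s ^ 2 * taylor (- d * (s * X)))
      by (rewrite <- E; ring).
    unfold cubic. field. lra. }
  (* [1104] is [2 * 552], for the remainders of the two half maps, and [85 C] bounds the cubic made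
     of [q2 - l2] and [q3 - l3]. The interval from [1 / 2] to [4] used below contains all
     windows. *)
  set (eps := (half_map_constant * (1104 * B ^ 4) + 85 * C) * s).
  set (Kb := half_map_constant * B ^ 4).
  assert (HKb : 0 < Kb) by (apply Rmult_lt_0_compat; lra).
  assert (HKs : Kb * s ^ 6 * / N <= Kb * s).
  { apply Rmult_le_reg_r with N; [easy|]. rewrite Rmult_assoc, Rinv_l by lra.
    rewrite Rmult_1_r, Rmult_assoc. apply Rmult_le_compat_l; lra. }
  assert (HiN : 0 < / N) by now apply Rinv_0_lt_compat.
  destruct (unique_root_of_perturbation
    (fun X => displacement kL kR b eta d s X / N) (cubic l0 l1 l2 l3)
    (1 / 2) 4 (INR i + 3 / 4) (INR i + 5 / 4) sigma eps mu)
    as [X0 [HX0 [E0 Hu]]]; try easy; try lra.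
  - apply continuous_cubic.
  - intros X HX. rewrite Hf.
    generalize (half_map_error_le _ _ _ B s X HkL GL Heta HB Hs Hs1 HBs ltac:(lra))
      (half_map_error_le _ _ _ B s X HkR GR Hd' HB Hs Hs1 HBs ltac:(lra)).
    fold (eL X) (eR X). intros A1 A2.
    assert (A3 : Rabs ((eL X + eR X) * / N) <= 1104 * (Kb * s ^ 6) * / N).
    { apply Rabs_mult_le; [|rewrite Rabs_pos_eq; lra].
      eapply Rle_trans; [apply Rabs_triang|]. unfold Kb. lra. }
    assert (A4 : Rabs (cubic 0 0 (q2 - l2) (q3 - l3) X) <= 85 * (C * s)).
    { apply cubic_le; try easy; try lra; now rewrite Rabs_R0. }
    eapply Rle_trans; [apply Rabs_triang|]. unfold eps. unfold Kb in *. lra.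
  - intros X Y HX HY. rewrite !Hf.
    generalize (half_map_error_Lipschitz _ _ _ B s X Y HkL GL Heta HB Hs Hs1 HBs
                  ltac:(lra) ltac:(lra))
      (half_map_error_Lipschitz _ _ _ B s X Y HkR GR Hd' HB Hs Hs1 HBs
                  ltac:(lra) ltac:(lra)).
    fold (eL X) (eR X) (eL Y) (eR Y). intros A1 A2.
    replace ((eL Y + eR Y) * / N + cubic 0 0 (q2 - l2) (q3 - l3) Y
             - ((eL X + eR X) * / N + cubic 0 0 (q2 - l2) (q3 - l3) X))
      with (((eL Y - eL X) + (eR Y - eR X)) * / N
            + (cubic 0 0 (q2 - l2) (q3 - l3) Y - cubic 0 0 (q2 - l2) (q3 - l3) X)) by ring.
    generalize (Rabs_pos (Y - X)). intros HXY.
    assert (A3 : Rabs (((eL Y - eL X) + (eR Y - eR X)) * / N)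
                 <= 272 * (Kb * s ^ 6 * Rabs (Y - X)) * / N).
    { apply Rabs_mult_le; [|rewrite Rabs_pos_eq; lra].
      eapply Rle_trans; [apply Rabs_triang|]. unfold Kb. lra. }
    assert (A4 : Rabs (cubic 0 0 (q2 - l2) (q3 - l3) Y - cubic 0 0 (q2 - l2) (q3 - l3) X)
                 <= 57 * (C * s) * Rabs (Y - X)).
    { apply cubic_Lipschitz; try easy; try lra; now rewrite Rabs_R0. }
    assert (A5 : Kb * s ^ 6 * / N * Rabs (Y - X) <= Kb * s * Rabs (Y - X))
      by now apply Rmult_le_compat_r.
    assert (A6 : 0 <= C * s * Rabs (Y - X)) by now apply Rmult_le_pos.
    assert (A7 : 0 <= Kb * s * Rabs (Y - X)) by (repeat apply Rmult_le_pos; lra).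
    eapply Rle_trans; [apply Rabs_triang|]. unfold eps. unfold Kb in *. lra.
  - exists X0. split; [easy|]. split.
    + apply Rmult_eq_reg_r with (/ N); [|lra]. unfold Rdiv in E0. lra.
    + intros X HX EX. apply Hu; [easy|]. rewrite EX. unfold Rdiv. ring.
Qed.

(** * Bifurcation from the periodic orbit at infinity *)

Lemma params_ball eta xi g g' b d eps :
  Rabs g < eps -> Rabs g' < eps -> Rabs b < eps -> Rabs (d - xi) < eps -> 0 < eps ->
  ball ((0, 0, 0, eta, xi) : params) eps ((g, g', b, eta, d) : params).
Proof.
  intros. unfold ball; simpl; unfold prod_ball; simpl.
  unfold ball; simpl; unfold prod_ball; simpl.
  unfold ball; simpl; unfold prod_ball; simpl.
  unfold ball; simpl; unfold prod_ball, AbsRing_ball, ball; simpl.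
  unfold AbsRing_ball, abs, minus, plus, opp; simpl.
  rewrite !Ropp_0, !Rplus_0_r, Rplus_opp_r, Rabs_R0. easy.
Qed.

(** Reduces each case to a model cubic with [n] simple windows and to a curve of parameters on which
    the quadratic and cubic coefficients approach those of the model at rate [s]. Letting [d] depend
    on [s] allows [x_R] to move. *)
Lemma bifurcation_criterion eta xi l0 l1 l2 l3 mu C s0 (p n : nat) :
  (p <= 2)%nat -> (n <= 3)%nat -> 0 < mu -> 0 < s0 -> 0 <= C ->
  (forall i, (i < n)%nat -> simple_window (cubic l0 l1 l2 l3) mu i) ->
  (forall s, 0 < s <= s0 -> s <= 1 -> exists d q2 q3 h,
     h = - 1 + 2 * l0 / PI * s ^ (p + 1) /\
     PI / 2 * (eta ^ 2 + h * d ^ 2) * s ^ 4 = s ^ (p + 3) * q2 /\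
     - 2 / 3 * (eta ^ 3 - h * d ^ 3) * s ^ 5 = s ^ (p + 3) * q3 /\
     Rabs (d - xi) <= C * s /\ Rabs (q2 - l2) <= C * s /\ Rabs (q3 - l3) <= C * s) ->
  bifurcate_from_infinity (0, 0, 0, eta, xi) n.
Proof.
  intros Hp Hn Hmu Hs0 HC Hwin Hpar V [eps HV] M HM.
  generalize (cond_pos eps). intros Heps.
  set (B := 1 + Rabs eta + Rabs xi + C).
  assert (HB : 1 <= B) by (unfold B; generalize (Rabs_pos eta) (Rabs_pos xi); lra).
  assert (HB4 : 1 <= B ^ 4) by (apply pow_R1_Rle; lra).
  assert (HK : 0 < half_map_constant) by (unfold half_map_constant; lra).
  set (E := half_map_constant * (1104 * B ^ 4) + 85 * C).
  assert (HE : 0 <= E).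
  { unfold E. apply Rplus_le_le_0_compat; [|lra]. apply Rmult_le_pos; lra. }
  set (F := 3 * B + Rabs l1).
  assert (HF : 3 <= F) by (unfold F; generalize (Rabs_pos l1); lra).
  set (l0' := Rabs (2 * l0 / PI)).
  assert (Hl0' : 0 <= l0') by apply Rabs_pos.
  set (A1 := E / mu). set (A5 := (2 + C + F) / eps).
  assert (HA1 : 0 <= A1) by (apply Rdiv_le_0_compat; lra).
  assert (HA5 : 0 <= A5) by (apply Rdiv_le_0_compat; lra).
  (* One summand per requirement on [s]: error below [mu], arguments of the half maps within range,
     [2 s <= / 100000] for both gammas, [|h| <= 2], parameters in the ball of radius [eps], and
     ordinates beyond [M], where [F s] bounds [|b|]. *)
  destruct (small_parameter s0 (A1 + 16 * B + 200000 + l0' + A5 + 8 * (M + F)))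
    as [s [Hs [Hs1 HAs]]]; [easy | lra |].
  assert (T1 : 0 <= A1 * s) by (apply Rmult_le_pos; lra).
  assert (T2 : 0 <= B * s) by (apply Rmult_le_pos; lra).
  assert (T3 : 0 <= l0' * s) by (apply Rmult_le_pos; lra).
  assert (T4 : 0 <= A5 * s) by (apply Rmult_le_pos; lra).
  assert (T5 : 0 <= (M + F) * s) by (apply Rmult_le_pos; lra).
  assert (S1 : E * s < mu).
  { replace (E * s) with (A1 * s * mu) by (unfold A1; field; lra). nra. }
  assert (S5 : (2 + C + F) * s < eps).
  { replace ((2 + C + F) * s) with (A5 * s * eps) by (unfold A5; field; lra). nra. }
  destruct (Hpar s Hs Hs1) as [d [q2 [q3 [h [Hh [H2 [H3 [Hd [Hq2 Hq3]]]]]]]]].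
  assert (Hpow : forall m, 0 <= s ^ m <= 1).
  { intros m. split; [apply pow_le; lra|]. rewrite <- (pow1 m). apply pow_incr. lra. }
  assert (Hh2 : Rabs h <= 2).
  { rewrite Hh. eapply Rle_trans; [apply Rabs_triang|].
    rewrite (Rabs_left (- 1)) by lra.
    assert (Rabs (2 * l0 / PI * s ^ (p + 1)) <= l0' * s).
    { apply Rabs_mult_le; [unfold l0'; lra|].
      replace (p + 1)%nat with (S p) by lia. simpl.
      rewrite Rabs_pos_eq by (apply Rmult_le_pos; [lra | apply Hpow]).
      generalize (Hpow p). nra. }
    lra. }
  assert (HdB : Rabs d <= B).
  { unfold B. replace d with ((d - xi) + xi) by ring.
    eapply Rle_trans; [apply Rabs_triang|].
    assert (C * s <= C) by nra. generalize (Rabs_pos eta). lra. }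
  assert (HetaB : Rabs eta <= B) by (unfold B; generalize (Rabs_pos xi); lra).
  set (b := s ^ 2 * (eta - h * d) + l1 * s ^ (p + 2) / 2).
  assert (Hb : Rabs b <= F * s).
  { unfold b. eapply Rle_trans; [apply Rabs_triang|].
    assert (U1 : Rabs (s ^ 2 * (eta - h * d)) <= s * (B + 2 * B)).
    { apply Rabs_mult_le.
      - rewrite Rabs_pos_eq by apply Hpow. nra.
      - eapply Rle_trans; [apply Rabs_triang|]. rewrite Rabs_Ropp.
        apply Rplus_le_compat; [easy | now apply Rabs_mult_le]. }
    assert (U2 : Rabs (l1 * s ^ (p + 2) / 2) <= Rabs l1 * s * / 2).
    { apply Rabs_mult_le; [apply Rabs_mult_le; [lra|] | rewrite Rabs_pos_eq; lra].
      rewrite Rabs_pos_eq by apply Hpow.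
      replace (p + 2)%nat with (S (p + 1)) by lia. simpl. generalize (Hpow (p + 1)%nat).
      nra. }
    assert (0 <= Rabs l1 * s) by (apply Rmult_le_pos; [apply Rabs_pos | lra]).
    unfold F. lra. }
  assert (Hs2 : s ^ 2 <= s) by nra.
  assert (HgL : Rabs (s ^ 2) <= / 100000) by (rewrite Rabs_pos_eq by apply Hpow; lra).
  assert (HgR' : Rabs (h * s ^ 2) <= 2 * s).
  { apply Rabs_mult_le; [easy|]. rewrite Rabs_pos_eq; [easy | apply Hpow]. }
  assert (HgR : Rabs (h * s ^ 2) <= / 100000) by lra.
  destruct (half_map_exists (s ^ 2)) as [kL HkL]; [lra|].
  destruct (half_map_exists (h * s ^ 2)) as [kR HkR]; [lra|].
  exists (s ^ 2, h * s ^ 2, b, eta, d). split.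
  { apply HV. assert (0 <= C * s) by (apply Rmult_le_pos; lra).
    assert (0 <= F * s) by (apply Rmult_le_pos; lra).
    apply params_ball; try lra. rewrite Rabs_pos_eq by apply Hpow. lra. }
  destruct (finite_choice (R * R -> Prop) (fun _ => False) n (fun i G =>
    limit_cycle (s ^ 2, h * s ^ 2, b, eta, d) G /\
    exists u v X, M < u /\ 0 < v /\ INR i + 3 / 4 < X < INR i + 5 / 4 /\
      u + v = 2 / (s * X) /\ forall y, G (0, y) <-> y = u \/ y = - v)) as [G HG].
  { intros i Hi.
    assert (Hi' : 0 <= INR i <= 2).
    { split; [apply pos_INR|]. replace 2 with (INR 2) by (simpl; ring).
      apply le_INR. lia. }
    destruct (displacement_root eta d h b l0 l1 l2 l3 q2 q3 kL kR s p B C mu i)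
      as [X0 [HX0 [EX0 HuX0]]]; try easy; try lra; [lia | now apply Hwin |].
    assert (Hcs : forall a, Rabs a <= B -> 4 * Rabs a * (s * (INR i + 5 / 4)) <= 1).
    { intros a Ha. apply Rle_trans with (4 * B * (s * (13 / 4))); [|lra].
      apply Rmult_le_compat; try lra.
      - generalize (Rabs_pos a). lra.
      - apply Rmult_le_pos; lra.
      - apply Rmult_le_compat_l; lra. }
    destruct (limit_cycle_of_root (s ^ 2) (h * s ^ 2) b eta d kL kR s
                (INR i + 3 / 4) (INR i + 5 / 4) X0)
      as [G [u [v [HG [Hsec [Hv [Huv Hu]]]]]]]; try easy; try lra;
      [now apply Hcs | now apply Hcs |].
    exists G. split; [easy|]. exists u, v, X0. split; [|easy].
    assert (Q : / (2 * (s * X0)) >= M + F).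
    { apply Rle_ge. apply Rmult_le_reg_r with (2 * (s * X0)).
      - apply Rmult_lt_0_compat; [lra | apply Rmult_lt_0_compat; lra].
      - rewrite Rinv_l by (apply Rgt_not_eq, Rmult_lt_0_compat; [lra |
          apply Rmult_lt_0_compat; lra]).
        replace ((M + F) * (2 * (s * X0))) with ((M + F) * s * (2 * X0)) by ring. nra. }
    assert (F * s < F) by nra.
    generalize (Rle_abs b). lra. }
  exists G. split.
  - intros i Hi. destruct (HG i Hi) as [HGi [u [v [X [Hu [Hv [HX [Huv Hsec]]]]]]]].
    split; [easy|]. exists u. split; [easy|]. apply Hsec. now left.
  (* Equal orbits have equal [u] and [v], hence equal [X] by [u + v = 2 / (s * X)]; but the windows
     of [i] and [j] are disjoint. *)
  - intros i j Hi Hj Hij Hsame.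
    destruct (HG i Hi) as [_ [u [v [X [Hu [Hv [HX [Huv Hsec]]]]]]]].
    destruct (HG j Hj) as [_ [u' [v' [X' [Hu' [Hv' [HX' [Huv' Hsec']]]]]]]].
    assert (Eu : u = u').
    { assert (K : G j (0, u)) by (apply Hsame, Hsec; now left).
      apply Hsec' in K. lra. }
    assert (Ev : v = v').
    { assert (K : G j (0, - v)) by (apply Hsame, Hsec; now right).
      apply Hsec' in K. lra. }
    assert (EX : X = X').
    { assert (W : 2 / (s * X) = 2 / (s * X')) by lra.
      generalize (pos_INR i) (pos_INR j). intros I J.
      apply Rmult_eq_reg_l with (2 / (s * X') * s).
      - rewrite <- W at 1. field. lra.
      - apply Rgt_not_eq. apply Rmult_lt_0_compat; [|lra].
        apply Rdiv_lt_0_compat; [lra | apply Rmult_lt_0_compat; lra]. }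
    subst X'. apply Hij. apply INR_eq.
    destruct (Nat.lt_total i j) as [L | [-> | L]]; [| easy |];
      apply le_INR in L; rewrite S_INR in L; lra.
Qed.

Lemma local_cyclicity_ge p k :
  bifurcate_from_infinity p k ->
  Rbar_le (Finite (INR k)) (local_cyclicity_at_infinity p).
Proof.
  intros H. unfold local_cyclicity_at_infinity.
  apply (proj1 (Lub_Rbar_correct (fun r => exists k, r = INR k /\ bifurcate_from_infinity p k))).
  now exists k.
Qed.

(** * Model polynomials and the three cases *)

Lemma simple_window_linear i : (i < 1)%nat -> simple_window (cubic (- 1) 1 0 0) (/ 8) i.
Proof.
  intros Hi. replace i with 0%nat by lia. exists 1. unfold cubic. simpl.
  split; [now left|]. split; [lra|]. split; [lra|]. intros. lra.
Qed.

Lemma simple_window_factor (L P : R -> R) lambda mu i :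
  lambda <> 0 -> (forall X, L X = lambda * P X) -> simple_window P mu i ->
  simple_window L (Rabs lambda * mu) i.
Proof.
  intros Hl HL [sigma [Hs [Ha [Hb Hm]]]].
  destruct (Rlt_or_le 0 lambda) as [Hp | Hp].
  - exists sigma. rewrite !HL, Rabs_pos_eq by lra.
    split; [easy|]. split; [nra|]. split; [nra|].
    intros X Y H1 H2 H3. rewrite !HL. generalize (Hm X Y H1 H2 H3). nra.
  - exists (- sigma). rewrite !HL, Rabs_left by lra.
    split; [lra|]. split; [nra|]. split; [nra|].
    intros X Y H1 H2 H3. rewrite !HL. generalize (Hm X Y H1 H2 H3). nra.
Qed.

Lemma simple_window_quadratic i :
  (i < 2)%nat -> simple_window (fun X => (X - 1) * (X - 2)) (/ 8) i.
Proof.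
  intros Hi. destruct i as [|[|i]]; [| |lia].
  - exists (-1). simpl. split; [now right|]. split; [lra|]. split; [lra|].
    intros X Y H1 H2 H3.
    replace (-1 * ((Y - 1) * (Y - 2) - (X - 1) * (X - 2)))
      with ((3 - X - Y) * (Y - X)) by ring.
    apply Rmult_le_compat_r; lra.
  - exists 1. simpl. split; [now left|]. split; [lra|]. split; [lra|].
    intros X Y H1 H2 H3.
    replace (1 * ((Y - 1) * (Y - 2) - (X - 1) * (X - 2)))
      with ((X + Y - 3) * (Y - X)) by ring.
    apply Rmult_le_compat_r; lra.
Qed.

Lemma simple_window_cubic i :
  (i < 3)%nat -> simple_window (fun X => (X - 1) * (X - 2) * (X - 3)) (/ 8) i.
Proof.
  intros Hi.
  assert (E : forall X Y, (Y - 1) * (Y - 2) * (Y - 3) - (X - 1) * (X - 2) * (X - 3)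
    = ((X - 2) ^ 2 + (X - 2) * (Y - 2) + (Y - 2) ^ 2 - 1) * (Y - X)) by (intros; ring).
  destruct i as [|[|[|i]]]; [| | |lia].
  - exists 1. simpl. split; [now left|]. split; [lra|]. split; [lra|].
    intros X Y H1 H2 H3. rewrite E. rewrite Rmult_1_l.
    apply Rmult_le_compat_r; [lra | nra].
  - exists (-1). simpl. split; [now right|]. split; [lra|]. split; [lra|].
    intros X Y H1 H2 H3. rewrite E, <- Rmult_assoc.
    apply Rmult_le_compat_r; [lra | nra].
  - exists 1. simpl. split; [now left|]. split; [lra|]. split; [lra|].
    intros X Y H1 H2 H3. rewrite E, Rmult_1_l.
    apply Rmult_le_compat_r; [lra | nra].
Qed.

Lemma Rabs_plus_le a b A B : Rabs a <= A -> Rabs b <= B -> Rabs (a + b) <= A + B.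
Proof. intros. eapply Rle_trans; [apply Rabs_triang | lra]. Qed.

Lemma Rabs_minus_le a b A B : Rabs a <= A -> Rabs b <= B -> Rabs (a - b) <= A + B.
Proof. intros. apply Rabs_plus_le; [easy | now rewrite Rabs_Ropp]. Qed.

Lemma Rabs_pow_le a A n : Rabs a <= A -> Rabs (a ^ n) <= A ^ n.
Proof. intros. rewrite <- RPow_abs. apply pow_incr. split; [apply Rabs_pos | easy]. Qed.

Lemma pow_Rabs_le_1 s n : 0 < s -> s <= 1 -> Rabs (s ^ n) <= 1.
Proof.
  intros. rewrite Rabs_pos_eq by (apply pow_le; lra).
  rewrite <- (pow1 n). apply pow_incr. lra.
Qed.

Lemma Rabs_scaled_le e s A C : 0 < s -> Rabs e <= A -> A <= C -> Rabs (e * s) <= C * s.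
Proof. intros. apply Rabs_mult_le; [lra | rewrite Rabs_pos_eq; lra]. Qed.

(** [p = 0]: at order [s ^ 3] the quadratic and cubic coefficients carry extra factors [s] and
    [s ^ 2], and the model is [X - 1]. *)
Lemma bifurcate_one eta xi : bifurcate_from_infinity (0, 0, 0, eta, xi) 1.
Proof.
  generalize PI_RGT_0. intros HPI.
  set (k := 2 * - 1 / PI).
  set (Q2 := PI / 2 * (Rabs eta ^ 2 + (1 + Rabs k) * Rabs xi ^ 2)).
  set (Q3 := 2 / 3 * (Rabs eta ^ 3 + (1 + Rabs k) * Rabs xi ^ 3)).
  assert (Hk : 0 <= Rabs k) by apply Rabs_pos.
  assert (HQ2 : 0 <= Q2).
  { unfold Q2. apply Rmult_le_pos; [lra|]. apply Rplus_le_le_0_compat;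
      [|apply Rmult_le_pos; [lra|]]; apply pow_le, Rabs_pos. }
  assert (HQ3 : 0 <= Q3).
  { unfold Q3. apply Rmult_le_pos; [lra|]. apply Rplus_le_le_0_compat;
      [|apply Rmult_le_pos; [lra|]]; apply pow_le, Rabs_pos. }
  apply (bifurcation_criterion eta xi (- 1) 1 0 0 (/ 8) (Q2 + Q3) 1 0 1); try lia; try lra.
  - intros. now apply simple_window_linear.
  - intros s Hs Hs1. set (h := - 1 + k * s ^ 1).
    assert (Hh : Rabs h <= 1 + Rabs k).
    { unfold h. apply Rabs_plus_le; [rewrite Rabs_left; lra|].
      replace (Rabs k) with (Rabs k * 1) by ring.
      apply Rabs_mult_le; [lra | now apply pow_Rabs_le_1]. }
    exists xi, (PI / 2 * (eta ^ 2 + h * xi ^ 2) * s),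
      (- 2 / 3 * (eta ^ 3 - h * xi ^ 3) * s * s), h.
    split; [reflexivity|]. split; [simpl; ring|]. split; [simpl; ring|].
    split; [rewrite Rminus_diag, Rabs_R0; apply Rmult_le_pos; lra|].
    rewrite !Rminus_0_r. split.
    + apply Rabs_scaled_le with Q2; [easy | | lra].
      apply Rabs_mult_le; [rewrite Rabs_pos_eq; lra|].
      apply Rabs_plus_le; [now apply Rabs_pow_le|].
      apply Rabs_mult_le; [easy | now apply Rabs_pow_le].
    + apply Rabs_scaled_le with (Q3 * 1); [easy | | lra].
      apply Rabs_mult_le; [|rewrite Rabs_pos_eq; lra].
      apply Rabs_mult_le; [rewrite Rabs_left; lra|].
      apply Rabs_minus_le; [now apply Rabs_pow_le|].
      apply Rabs_mult_le; [easy | now apply Rabs_pow_le].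
Qed.

(** [p = 1]: at order [s ^ 4] the quadratic coefficient tends to [lambda], which is not zero, and
    the model is [lambda (X - 1) (X - 2)]. *)
Lemma bifurcate_two eta xi :
  eta ^ 2 <> xi ^ 2 -> bifurcate_from_infinity (0, 0, 0, eta, xi) 2.
Proof.
  intros Hne. generalize PI_RGT_0. intros HPI.
  set (lambda := PI / 2 * (eta ^ 2 - xi ^ 2)).
  assert (Hl : lambda <> 0).
  { unfold lambda. apply Rmult_integral_contrapositive. split; lra. }
  set (k := 2 * (2 * lambda) / PI).
  set (Q2 := PI / 2 * Rabs k * Rabs xi ^ 2).
  set (Q3 := 2 / 3 * (Rabs eta ^ 3 + (1 + Rabs k) * Rabs xi ^ 3)).
  assert (Hk : 0 <= Rabs k) by apply Rabs_pos.
  assert (HQ2 : 0 <= Q2).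
  { unfold Q2. apply Rmult_le_pos; [apply Rmult_le_pos; lra | apply pow_le, Rabs_pos]. }
  assert (HQ3 : 0 <= Q3).
  { unfold Q3. apply Rmult_le_pos; [lra|]. apply Rplus_le_le_0_compat;
      [|apply Rmult_le_pos; [lra|]]; apply pow_le, Rabs_pos. }
  assert (Hmu : 0 < Rabs lambda * / 8)
    by (apply Rmult_lt_0_compat; [now apply Rabs_pos_lt | lra]).
  apply (bifurcation_criterion eta xi (2 * lambda) (- 3 * lambda) lambda 0
           (Rabs lambda * / 8) (Q2 + Q3) 1 1 2); try lia; try lra.
  - intros i Hi. apply simple_window_factor with (fun X => (X - 1) * (X - 2)); [easy | |].
    + intros X. unfold cubic. ring.
    + now apply simple_window_quadratic.
  - intros s Hs Hs1. set (h := - 1 + k * s ^ (1 + 1)).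
    assert (Hh : Rabs h <= 1 + Rabs k).
    { unfold h. apply Rabs_plus_le; [rewrite Rabs_left; lra|].
      replace (Rabs k) with (Rabs k * 1) by ring.
      apply Rabs_mult_le; [lra | now apply pow_Rabs_le_1]. }
    exists xi, (PI / 2 * (eta ^ 2 + h * xi ^ 2)),
      (- 2 / 3 * (eta ^ 3 - h * xi ^ 3) * s), h.
    split; [reflexivity|]. split; [simpl; ring|]. split; [simpl; ring|].
    split; [rewrite Rminus_diag, Rabs_R0; apply Rmult_le_pos; lra|].
    rewrite Rminus_0_r. split.
    + replace (PI / 2 * (eta ^ 2 + h * xi ^ 2) - lambda)
        with (PI / 2 * k * xi ^ 2 * s * s) by (unfold h, lambda; simpl; field).
      apply Rabs_scaled_le with (Q2 * 1); [easy | | lra].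
      apply Rabs_mult_le; [|rewrite Rabs_pos_eq; lra].
      apply Rabs_mult_le; [|now apply Rabs_pow_le].
      apply Rabs_mult_le; [rewrite Rabs_pos_eq; lra | lra].
    + apply Rabs_scaled_le with Q3; [easy | | lra].
      apply Rabs_mult_le; [rewrite Rabs_left; lra|].
      apply Rabs_minus_le; [now apply Rabs_pow_le|].
      apply Rabs_mult_le; [easy | now apply Rabs_pow_le].
Qed.

(** [p = 2]: at order [s ^ 5] the cubic coefficient tends to [l3], and the model is
    [l3 (X - 1) (X - 2) (X - 3)]. Its quadratic coefficient is produced by [x_R = eta + delta s]. *)
Lemma bifurcate_three eta :
  eta <> 0 -> bifurcate_from_infinity (0, 0, 0, eta, eta) 3.
Proof.
  intros Hne. generalize PI_RGT_0. intros HPI.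
  set (l3 := - 4 / 3 * eta ^ 3).
  assert (Hl : l3 <> 0).
  { unfold l3. apply Rmult_integral_contrapositive. split; [lra | now apply pow_nonzero]. }
  set (k := 2 * (- 6 * l3) / PI).
  (* Solves [- PI * eta * delta = - 6 * l3], since [PI / 2 * (eta ^ 2 - d ^ 2)] is
     [- PI * eta * delta * s] to first order in [s]. *)
  set (delta := - 8 * eta ^ 2 / PI).
  set (D := Rabs eta + Rabs delta).
  set (Q2 := PI / 2 * (Rabs delta ^ 2 + Rabs k * D ^ 2)).
  set (Q3 := 2 / 3 * (Rabs delta * (D ^ 2 + D * D + D ^ 2) + Rabs k * D ^ 3)).
  assert (Hk : 0 <= Rabs k) by apply Rabs_pos.
  assert (Hde : 0 <= Rabs delta) by apply Rabs_pos.
  assert (HD : 0 <= D) by (unfold D; generalize (Rabs_pos eta); lra).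
  assert (HQ2 : 0 <= Q2).
  { unfold Q2. apply Rmult_le_pos; [lra|]. apply Rplus_le_le_0_compat;
      [now apply pow_le|]. apply Rmult_le_pos; [lra | now apply pow_le]. }
  assert (HQ3 : 0 <= Q3).
  { unfold Q3. apply Rmult_le_pos; [lra|]. apply Rplus_le_le_0_compat.
    - apply Rmult_le_pos; [easy | nra].
    - apply Rmult_le_pos; [lra | now apply pow_le]. }
  assert (Hmu : 0 < Rabs l3 * / 8)
    by (apply Rmult_lt_0_compat; [now apply Rabs_pos_lt | lra]).
  apply (bifurcation_criterion eta eta (- 6 * l3) (11 * l3) (- 6 * l3) l3
           (Rabs l3 * / 8) (Rabs delta + Q2 + Q3) 1 2 3); try lia; try lra.
  - intros i Hi.
    apply simple_window_factor with (fun X => (X - 1) * (X - 2) * (X - 3)); [easy | |].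
    + intros X. unfold cubic. ring.
    + now apply simple_window_cubic.
  - intros s Hs Hs1. set (h := - 1 + k * s ^ (2 + 1)). set (d := eta + delta * s).
    assert (Hs' : Rabs s <= 1) by (rewrite Rabs_pos_eq; lra).
    assert (Hd : Rabs d <= D).
    { unfold d, D. apply Rabs_plus_le; [lra|].
      replace (Rabs delta) with (Rabs delta * 1) by ring. apply Rabs_mult_le; lra. }
    assert (Heta : Rabs eta <= D) by (unfold D; lra).
    exists d, (PI / 2 * (- 2 * eta * delta - delta ^ 2 * s + k * s ^ 2 * d ^ 2)),
      (- 2 / 3 * (eta ^ 3 - h * d ^ 3)), h.
    split; [reflexivity|]. split; [unfold h, d; simpl; field|].
    split; [simpl; ring|]. split; [|split].
    + replace (d - eta) with (delta * s) by (unfold d; ring).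
      apply Rabs_scaled_le with (Rabs delta); lra.
    + replace (_ - - 6 * l3) with (PI / 2 * (- delta ^ 2 + s * (k * d ^ 2)) * s)
        by (unfold l3, delta; field; lra).
      apply Rabs_scaled_le with (PI / 2 * (Rabs delta ^ 2 + 1 * (Rabs k * D ^ 2)));
        [easy | | unfold Q2; lra].
      apply Rabs_mult_le; [rewrite Rabs_pos_eq; lra|]. apply Rabs_plus_le.
      * rewrite Rabs_Ropp. now apply Rabs_pow_le.
      * apply Rabs_mult_le; [easy|].
        apply Rabs_mult_le; [lra | now apply Rabs_pow_le].
    + replace (- 2 / 3 * (eta ^ 3 - h * d ^ 3) - l3)
        with (- 2 / 3 * (delta * (d ^ 2 + d * eta + eta ^ 2) - s ^ 2 * (k * d ^ 3)) * s)
        by (unfold l3, h, d; simpl; field).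
      apply Rabs_scaled_le
        with (2 / 3 * (Rabs delta * (D ^ 2 + D * D + D ^ 2) + 1 * (Rabs k * D ^ 3)));
        [easy | | unfold Q3; lra].
      apply Rabs_mult_le; [rewrite Rabs_left; lra|]. apply Rabs_minus_le.
      * apply Rabs_mult_le; [lra|].
        repeat apply Rabs_plus_le; try now apply Rabs_pow_le.
        now apply Rabs_mult_le.
      * apply Rabs_mult_le; [now apply pow_Rabs_le_1|].
        apply Rabs_mult_le; [lra | now apply Rabs_pow_le].
Qed.

Theorem proposition11 (eta xi : R) (heta : eta <> 0) (hxi : xi <> 0) :
  center_at_infinity (0, 0, 0, eta, xi) /\
  (eta = - xi ->
     Rbar_le (Finite 1) (local_cyclicity_at_infinity (0, 0, 0, eta, xi))) /\
  (eta <> xi /\ eta <> - xi ->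
     Rbar_le (Finite 2) (local_cyclicity_at_infinity (0, 0, 0, eta, xi))) /\
  (eta = xi ->
     Rbar_le (Finite 3) (local_cyclicity_at_infinity (0, 0, 0, eta, xi))).
Proof.
  split; [|split; [|split]].
  - exists (2 * (Rabs eta + Rabs xi)). intros [px py] H.
    now apply center_crossing_periodic_orbit.
  - intros _. exact (local_cyclicity_ge _ 1 (bifurcate_one eta xi)).
  - intros [H1 H2]. replace 2 with (INR 2) by (simpl; ring).
    apply local_cyclicity_ge, bifurcate_two. intros E.
    assert (E' : (eta - xi) * (eta + xi) = 0) by lra.
    apply Rmult_integral in E'. lra.
  - intros <-. replace 3 with (INR 3) by (simpl; ring).
    apply local_cyclicity_ge, bifurcate_three, heta.
Qed.
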